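(* Let $k$ be a field complete with respect to a non-Archimedean absolute value, let $X$ be the Berkovich closed unit disc over $k$, and let $\varphi$ be a quasisubharmonic function on $X$ with $\varphi\le0$. For every rigid point $x\in X^{\mathrm{rig}}$, $$\mathcal{J}(\varphi)_x=\mathcal{H}_\varphi\cdot\mathcal{O}_{X,x},$$ i.e. the local multiplier ideal of $\varphi$ at $x$ is the extension of the ideal $\mathcal{H}_\varphi\subseteq k\{T\}$ along $k\{T\}\to\mathcal{O}_{X,x}$.
   Context: Disc. Let $k$ be complete with respect to a (possibly trivial) non-Archimedean absolute value $|\cdot|$, $K$ the completion of an algebraic closure $k^a$, $K^\circ=\{|\cdot|\le 1\}\subset K$. $k\{T\}$ is the Tate algebra of power series $\sum a_iT^i$ over $k$ with $|a_i|\to 0$, with Gauss norm $\max_i|a_i|$. $X=\mathscr{M}(k\{T\})$ is the set of multiplicative seminorms $x$, $f\mapsto |f(x)|$, on $k\{T\}$ extending $|\cdot|$ on $k$ and bounded by the Gauss norm, with the topology of pointwise convergence; the Gauss norm is the Gauss point $x_G\in X$. Order: $x\le y$ iff $|f(x)|\le|f(y)|$ for all $f\in k\{T\}$; this makes $X$ a rooted tree with root (maximum) $x_G$; $x\vee y$ is the least upper bound and $[x,y]$ the unique segment joining $x,y$. $\pi\colon X_K=\mathscr{M}(K\{T\})\to X$ is the restriction map. For $w\in K^\circ$, $s\in[0,1]$, $x_{w,s}$ is the seminorm $f\mapsto\sup_{\overline D(w,s)}|f|$ on $K\{T\}$ (or its image in $X$). Rigid points are the images of $x_{w,0}$ with $w\in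 k^a$, $|w|\le 1$; they form the set $X^{\mathrm{rig}}$. The multiplicity is $m(x)=\#\pi^{-1}(x)\in\mathbf{Z}_{>0}\cup\{\infty\}$. Radius and metric. The radius function $r\colon X\to[0,1]$ is induced by the Galois-invariant function on $X_K$ with $r(x_{w,s})=s$ and $r(\lim x_{w_i,s_i})=\lim s_i$ for a point given by a decreasing sequence of discs $\overline D(w_i,s_i)$ with empty intersection. $A=-\log r\colon X\to[0,+\infty]$. The function $\alpha\colon X\to[0,+\infty]$ is determined by $\alpha(x_G)=0$ and $\alpha(x)-\alpha(y)=-\int_y^x\frac{1}{m(u)}\,d(\log r(u))$ along the segment from $y$ to $x$. The generalized metric is $d(x,y)=|\alpha(x)-\alpha(x\vee y)|+|\alpha(y)-\alpha(x\vee y)|$. Directional derivatives and convexity on segments are taken with respect to $d$. Quasisubharmonic functions. A finite subtree is the convex hull of finitely many points. Let $\rho_0$ be a positive real multiple of the Dirac mass $\delta_{x_G}$. A function $\varphi\colon X\to[-\infty,\infty)$ is $\rho_0$-subharmonic if: (i) for every finite subtree $Y\subset X\setminus X^{\mathrm{rig}}$ containing $x_G$, $\varphi|_Y$ is continuous, is convex on every segment of $Y$ not containing $x_G$, and satisfies $\rho_0\{y\}+\sum_{\vec v\in T_yY}d_{\vec v}(\varphi|_Y)\ge 0$ for all $y\in Y$ ($T_yY$ the set of tangent directions at $y$ in $Y$, $d_{\vec v}$ the directional derivative); (ii) $\varphi=\lim_Y \varphi\circ\mathfrak r_Y$ pointwise over the net of such $Y$, $\mathfrak r_Y\colon X\to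 Y$ the retraction. Such $\varphi$ takes the value $-\infty$ only at points with $\alpha=+\infty$. $\varphi$ is quasisubharmonic if it is $\rho_0$-subharmonic for some such $\rho_0$. Ideals. For $\varphi\le 0$ quasisubharmonic and $f\in k\{T\}$, with $Z(\varphi)=\{\varphi=-\infty\}$ and $e^{-\infty}=0$, put $\|f\|_\varphi=\sup_{x\in X\setminus Z(\varphi)}|f(x)|e^{-\varphi(x)-A(x)}$, $\|f\|^+_\varphi=\lim_{\epsilon\to0^+}\|f\|_{(1+\epsilon)\varphi}\in[0,+\infty]$, and $\mathcal{H}_\varphi=\{f\in k\{T\}:\|f\|_\varphi^+<+\infty\}$, an ideal of $k\{T\}$. Local multiplier ideals. $\mathcal{O}_{X,x}$ is the direct limit of the affinoid algebras $\mathcal{A}_V$ over affinoid neighborhoods $V$ of $x$; a germ is defined on $V$ if it lies in the image of $\mathcal{A}_V\to\mathcal{O}_{X,x}$. The local multiplier ideal $\mathcal{J}(\varphi)_x\subseteq\mathcal{O}_{X,x}$ consists of the germs $f$ for which there exist $\epsilon>0$ and an affinoid neighborhood $V$ of $x$ on which $f$ is defined such that $\sup_{V\setminus Z(\varphi)}|f|e^{-(1+\epsilon)\varphi-A}<+\infty$. *)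

(* Defs.v *)
From HB Require Import structures.
From mathcomp Require Import all_boot all_order all_algebra.
From mathcomp Require Import all_classical all_reals all_analysis.
Import Order.TTheory GRing.Theory Num.Theory numFieldNormedType.Exports.

Set Implicit Arguments.
Unset Strict Implicit.
Unset Printing Implicit Defensive.

Local Open Scope classical_set_scope.
Local Open Scope ring_scope.

Definition norm_complete (R : realType) (T : zmodType) (N : T -> R) : Prop :=
  forall u : nat -> T,
    (forall e, 0 < e -> exists n0, forall m n,
       (n0 <= m)%N -> (n0 <= n)%N -> N (u m - u n) < e) ->
  exists l : T, forall e, 0 < e -> exists n0, forall n,
    (n0 <= n)%N -> N (u n - l) < e.

(* The absolute value is allowed to be trivial. *)
Record nafield (R : realType) := NAField {
  nafield_sort :> fieldType;
  nabs : nafield_sort -> R;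
  nabs_ge0 : forall a, 0 <= nabs a;
  nabs_eq0 : forall a, (nabs a == 0) = (a == 0);
  nabsM : forall a b, nabs (a * b) = nabs a * nabs b;
  nabsD : forall a b, nabs (a + b) <= Num.max (nabs a) (nabs b);
  nabs_complete : norm_complete nabs
}.

(* Commutative non-Archimedean Banach k-algebras; the zero ring is allowed.
   [bnorm_const] at 1 gives |1| <= 1, hence |1| = 1 unless the ring is zero. *)
Record banachAlg (R : realType) (k : nafield R) := BanachAlg {
  banach_sort :> comPzRingType;
  bconst : {rmorphism k -> banach_sort};
  bnorm : banach_sort -> R;
  bnorm_ge0 : forall f, 0 <= bnorm f;
  bnorm_eq0 : forall f, (bnorm f == 0) = (f == 0);
  bnormM : forall f g, bnorm (f * g) <= bnorm f * bnorm g;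
  bnormD : forall f g, bnorm (f + g) <= Num.max (bnorm f) (bnorm g);
  bnorm_const : forall a, bnorm (bconst a) <= nabs a;
  bnorm_complete : norm_complete bnorm
}.

Arguments bconst {R k} b.
Arguments bnorm {R k} b.

Section NormTheory.
Variables (R : realType) (k : nafield R).

Lemma nabs0 : nabs (0 : k) = 0.
Proof. by apply/eqP; rewrite nabs_eq0. Qed.

Lemma nabs1 : nabs (1 : k) = 1.
Proof.
have h : nabs (1 : k) * nabs (1 : k) = nabs (1 : k) * 1 by rewrite -nabsM !mulr1.
by apply: (mulfI _ h); rewrite nabs_eq0 oner_eq0.
Qed.

Lemma nabsN1 : nabs (-1 : k) = 1.
Proof.
have h : nabs (-1 : k) ^+ 2 = 1 by rewrite expr2 -nabsM mulrNN mulr1 nabs1.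
apply/eqP; move/eqP: h; rewrite sqrf_eq1 => /orP[//|/eqP h].
by have := nabs_ge0 (-1 : k); rewrite h oppr_ge0 ler10.
Qed.

Variable B : banachAlg k.
Local Notation N := (bnorm B).

Lemma bnorm0 : N 0 = 0.
Proof. by apply/eqP; rewrite bnorm_eq0. Qed.

Lemma bnorm1_le : N 1 <= 1.
Proof. by rewrite -nabs1 -(rmorph1 (bconst B)) bnorm_const. Qed.

Lemma bnormN f : N (- f) = N f.
Proof.
have h g : N (- g) <= N g.
  rewrite -mulN1r -(rmorphN1 (bconst B)).
  apply: (le_trans (bnormM _ _)); rewrite -[leRHS]mul1r.
  by rewrite ler_wpM2r ?bnorm_ge0// -nabsN1 bnorm_const.
by apply/le_anti; rewrite h /= -{1}(opprK f) h.
Qed.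

Lemma bnorm_sum (I : Type) (s : seq I) (P : pred I) (F : I -> B) (M : R) :
  0 <= M -> (forall i, P i -> N (F i) <= M) -> N (\sum_(i <- s | P i) F i) <= M.
Proof.
move=> M0 h; elim/big_ind: _ => [|x y hx hy|//]; first by rewrite bnorm0.
by apply: (le_trans (bnormD _ _)); rewrite ge_max hx hy.
Qed.

Lemma bnorm_distC f g : N (f - g) = N (g - f).
Proof. by rewrite -bnormN opprB. Qed.

End NormTheory.

Definition base_banach (R : realType) (k : nafield R) : banachAlg k.
Proof.
refine (@BanachAlg R k k idfun (@nabs R k) (@nabs_ge0 R k) (@nabs_eq0 R k)
    _ (@nabsD R k) (fun a => lexx _) (@nabs_complete R k)).
abstract by move=> f g; rewrite nabsM.
Defined.

(* B{r^-1 T}: the series sum_i c_i T^i over B with |c_i| r^i -> 0. *)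
Record tate (R : realType) (k : nafield R) (B : banachAlg k) (r : {posnum R}) :=
  Tate {
    tcoef :> nat -> B;
    tcoef_cvg : (fun i => bnorm B (tcoef i) * r%:num ^+ i) @ \oo --> (0 : R)
  }.

Section TateRing.
Variables (R : realType) (k : nafield R) (B : banachAlg k) (r : {posnum R}).
Local Notation N := (bnorm B).
Local Notation A := (tate B r).
Implicit Types (c d : nat -> B) (f g h : A).

Definition is_tate c := (fun i => N (c i) * r%:num ^+ i) @ \oo --> (0 : R).

Lemma tterm_ge0 c i : 0 <= N (c i) * r%:num ^+ i.
Proof. by rewrite mulr_ge0 ?bnorm_ge0 ?exprn_ge0. Qed.

Lemma is_tateP c : is_tate c <->
  forall e, 0 < e -> exists n0, forall i, (n0 <= i)%N -> N (c i) * r%:num ^+ i < e.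
Proof.
rewrite /is_tate; split.
  move=> /cvgrPdist_lt h e e0; have [n0 _ hn] := h _ e0.
  exists n0 => i hi; have := hn _ hi.
  by rewrite /= sub0r normrN ger0_norm ?tterm_ge0.
move=> h; apply/cvgrPdist_lt => e e0; have [n0 hn] := h _ e0.
exists n0 => // i hi.
by rewrite /= sub0r normrN ger0_norm ?tterm_ge0 ?hn.
Qed.

Lemma tateP f g : tcoef f =1 tcoef g -> f = g.
Proof.
case: f => c hc; case: g => d hd /= e.
have {e} e : c = d by apply: funext.
by rewrite e in hc *; congr Tate; apply: Prop_irrelevance.
Qed.

HB.instance Definition _ := gen_eqMixin A.
HB.instance Definition _ := gen_choiceMixin A.

Lemma is_tate_const (b : B) : is_tate (fun i => if i == 0%N then b else 0).
Proof. by apply/is_tateP => e e0; exists 1%N => -[//|i] _ /=; rewrite bnorm0 mul0r. Qed.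

Lemma is_tate_X : is_tate (fun i => (i == 1%N)%:R).
Proof. by apply/is_tateP => e e0; exists 2%N => -[|[|i]]//= _; rewrite bnorm0 mul0r. Qed.

Lemma is_tate_add c d : is_tate c -> is_tate d -> is_tate (fun i => c i + d i).
Proof.
move=> /is_tateP hc /is_tateP hd; apply/is_tateP => e e0.
have [n hn] := hc _ e0; have [m hm] := hd _ e0.
exists (maxn n m) => i; rewrite geq_max => /andP[/hn h1 /hm h2].
rewrite (le_lt_trans (ler_wpM2r _ (bnormD _ _))) ?exprn_ge0//.
by rewrite maxr_pMl ?exprn_ge0// gt_max h1 h2.
Qed.

Lemma is_tate_opp c : is_tate c -> is_tate (fun i => - c i).
Proof. by rewrite /is_tate; under [X in _ -> X @ _ --> _]eq_fun do rewrite bnormN. Qed.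

Lemma is_tate_bounded c : is_tate c ->
  exists2 M, 0 < M & forall i, N (c i) * r%:num ^+ i <= M.
Proof.
move=> /is_tateP /(_ _ ltr01)[n hn].
exists (1 + \sum_(i < n) N (c i) * r%:num ^+ i).
  by rewrite ltr_pwDl// sumr_ge0// => i _; rewrite tterm_ge0.
move=> i; have [ni|ni] := leqP n i.
  by rewrite ler_wpDr ?(ltW (hn _ ni))// sumr_ge0// => j _; rewrite tterm_ge0.
rewrite ler_wpDl// (bigD1 (Ordinal ni))//= lerDl sumr_ge0// => j _.
by rewrite tterm_ge0.
Qed.

Definition tmul_coef c d n := \sum_(i < n.+1) c i * d (n - i)%N.

Lemma tmul_coef_term c d n (i : 'I_n.+1) :
  N (c i * d (n - i)%N) * r%:num ^+ n <=
  (N (c i) * r%:num ^+ i) * (N (d (n - i)%N) * r%:num ^+ (n - i)).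
Proof.
rewrite mulrACA -exprD subnKC ?leq_ord//.
by rewrite ler_wpM2r ?exprn_ge0// bnormM.
Qed.

Lemma tmul_coef_le c d n (M : R) : 0 <= M ->
  (forall i : 'I_n.+1,
    (N (c i) * r%:num ^+ i) * (N (d (n - i)%N) * r%:num ^+ (n - i)) <= M) ->
  N (tmul_coef c d n) * r%:num ^+ n <= M.
Proof.
move=> M0 h; have rn : 0 < r%:num ^+ n by rewrite exprn_gt0.
rewrite -ler_pdivlMr//; apply: bnorm_sum => [|i _].
  by rewrite divr_ge0// ltW.
by rewrite ler_pdivlMr//; apply: le_trans (tmul_coef_term _ _ _) (h i).
Qed.

Lemma is_tate_mul c d : is_tate c -> is_tate d -> is_tate (tmul_coef c d).
Proof.
move=> hc hd; have [M M0 hM] := is_tate_bounded hc.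
have [L L0 hL] := is_tate_bounded hd.
move: hc hd => /is_tateP hc /is_tateP hd; apply/is_tateP => e e0.
have e2 : 0 < e / 2 by rewrite divr_gt0.
have [n hn] := hc _ (divr_gt0 e2 L0); have [m hm] := hd _ (divr_gt0 e2 M0).
exists (n + m)%N => i him; apply: (@le_lt_trans _ _ (e / 2)); last first.
  by rewrite ltr_pdivrMr// ltr_pMr// ltr1n.
apply: tmul_coef_le => [|j]; first exact: ltW.
have [nj|jn] := leqP n j.
  rewrite -(divfK (lt0r_neq0 L0) (e / 2)).
  by rewrite ler_pM ?tterm_ge0// ltW// hn.
rewrite -(divfK (lt0r_neq0 M0) (e / 2)) mulrC.
rewrite ler_pM ?tterm_ge0// ltW// hm//.
by rewrite leq_subRL ?leq_ord// (leq_trans _ him)// leq_add2r ltnW.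
Qed.

Definition tconst (b : B) : A := Tate (is_tate_const b).
Definition tvar : A := Tate is_tate_X.
Definition tadd f g : A := Tate (is_tate_add (tcoef_cvg f) (tcoef_cvg g)).
Definition topp f : A := Tate (is_tate_opp (tcoef_cvg f)).
Definition tmul f g : A := Tate (is_tate_mul (tcoef_cvg f) (tcoef_cvg g)).

Lemma taddA : associative tadd.
Proof. by move=> f g h; apply: tateP => i /=; rewrite addrA. Qed.
Lemma taddC : commutative tadd.
Proof. by move=> f g; apply: tateP => i /=; rewrite addrC. Qed.
Lemma tadd0 : left_id (tconst 0) tadd.
Proof. by move=> f; apply: tateP => i /=; rewrite if_same add0r. Qed.
Lemma taddN : left_inverse (tconst 0) topp tadd.
Proof. by move=> f; apply: tateP => i /=; rewrite if_same addNr. Qed.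

HB.instance Definition _ := GRing.isZmodule.Build A taddA taddC tadd0 taddN.

Lemma tmul_coefC c d : tmul_coef c d =1 tmul_coef d c.
Proof.
move=> n; rewrite /tmul_coef (reindex_inj rev_ord_inj) /=.
by apply: eq_bigr => j _; rewrite subSS subKn ?leq_ord// mulrC.
Qed.

Lemma tmul_coef_rev c d n : tmul_coef c d n = \sum_(i < n.+1) c (n - i)%N * d i.
Proof. by rewrite tmul_coefC; apply: eq_bigr => i _; rewrite mulrC. Qed.

Lemma tmulA : associative tmul.
Proof.
move=> f g h; apply: tateP => i; rewrite [RHS]tmul_coef_rev [LHS]/=.
rewrite {1}/tmul_coef.
pose coef3 j l := f j * (g (i - j - l)%N * h l).
have -> : \sum_(j < i.+1) f j * tmul_coef g h (i - j) =
    \sum_(j < i.+1) \sum_(l < i.+1 | (l <= i - j)%N) coef3 j l.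
  apply: eq_bigr => /= j _; rewrite tmul_coef_rev big_distrr /=.
  by rewrite (big_ord_narrow_leq (leq_subr _ _)).
rewrite (exchange_big_dep predT) //=; apply: eq_bigr => l _.
have -> : \sum_(j < i.+1 | (l <= i - j)%N) coef3 j l =
    \sum_(j < i.+1 | (j <= i - l)%N) coef3 j l.
  apply: eq_bigl => j; rewrite -ltnS -(ltnS j) -!subSn ?leq_ord //.
  by rewrite -subn_gt0 -(subn_gt0 j) -!subnDA addnC.
rewrite (big_ord_narrow_leq (leq_subr _ _)) big_distrl /=.
by apply: eq_bigr => j _; rewrite /coef3 -!subnDA addnC mulrA.
Qed.

Lemma tmulC : commutative tmul.
Proof. by move=> f g; apply: tateP => i; exact: tmul_coefC. Qed.

Lemma tconst_coefM (b : B) c n :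
  tmul_coef (fun i => if i == 0%N then b else 0) c n = b * c n.
Proof.
rewrite /tmul_coef big_ord_recl /= subn0 big1 ?addr0// => i _.
by rewrite mul0r.
Qed.

Lemma tmul1 : left_id (tconst 1) tmul.
Proof. by move=> f; apply: tateP => i /=; rewrite tconst_coefM mul1r. Qed.

Lemma tmulD : left_distributive tmul tadd.
Proof.
move=> f g h; apply: tateP => i /=; rewrite /tmul_coef -big_split.
by apply: eq_bigr => j _; rewrite mulrDl.
Qed.

HB.instance Definition _ :=
  GRing.Zmodule_isComPzRing.Build A tmulA tmulC tmul1 tmulD.

Lemma tcoefD f g i : (f + g) i = f i + g i. Proof. by []. Qed.
Lemma tcoefN f i : (- f) i = - f i. Proof. by []. Qed.
Lemma tcoefB f g i : (f - g) i = f i - g i. Proof. by []. Qed.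
Lemma tcoefM f g i : (f * g) i = \sum_(j < i.+1) f j * g (i - j)%N.
Proof. by []. Qed.
Lemma tcoef0 i : (0 : A) i = 0. Proof. by rewrite /= if_same. Qed.

Lemma tconst_zmod : zmod_morphism tconst.
Proof. by move=> a b; apply: tateP => -[|i] //=; rewrite subr0. Qed.
Lemma tconst_monoid : monoid_morphism tconst.
Proof.
split=> // a b; apply: tateP => i /=; rewrite tconst_coefM.
by case: i => //=; rewrite mulr0.
Qed.

HB.instance Definition _ := GRing.isZmodMorphism.Build B A tconst tconst_zmod.
HB.instance Definition _ := GRing.isMonoidMorphism.Build B A tconst tconst_monoid.

(* The Gauss norm max_i |c_i| r^i. *)
Definition tnorm f : R := sup (range (fun i => N (f i) * r%:num ^+ i)).

Lemma tnorm_has_sup f : has_sup (range (fun i => N (f i) * r%:num ^+ i)).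
Proof.
split; first by exists (N (f 0%N) * r%:num ^+ 0); exists 0%N.
have [M _ hM] := is_tate_bounded (tcoef_cvg f).
by exists M => _ [i _ <-].
Qed.

Lemma tnorm_ub f i : N (f i) * r%:num ^+ i <= tnorm f.
Proof. by apply: ub_le_sup; [case: (tnorm_has_sup f) | exists i]. Qed.

Lemma tnorm_le f (M : R) :
  (forall i, N (f i) * r%:num ^+ i <= M) -> tnorm f <= M.
Proof.
move=> h; apply: ge_sup; first by case: (tnorm_has_sup f).
by move=> _ [i _ <-].
Qed.

Lemma tnorm_ge0 f : 0 <= tnorm f.
Proof. exact: le_trans (tterm_ge0 f 0) (tnorm_ub f 0). Qed.

Lemma tnorm_eq0 f : (tnorm f == 0) = (f == 0).
Proof.
apply/eqP/eqP => [h|->]; last first.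
  apply/le_anti; rewrite tnorm_ge0 andbT; apply: tnorm_le => i.
  by rewrite tcoef0 bnorm0 mul0r.
apply: tateP => i; rewrite tcoef0; apply/eqP; rewrite -bnorm_eq0.
have := tnorm_ub f i; rewrite h pmulr_lle0 ?exprn_gt0// => hi.
by rewrite eq_le hi bnorm_ge0.
Qed.

Lemma tnormM f g : tnorm (f * g) <= tnorm f * tnorm g.
Proof.
apply: tnorm_le => i; apply: tmul_coef_le => [|j].
  by rewrite mulr_ge0 ?tnorm_ge0.
by rewrite ler_pM ?tterm_ge0 ?tnorm_ub.
Qed.

Lemma tnormD f g : tnorm (f + g) <= Num.max (tnorm f) (tnorm g).
Proof.
apply: tnorm_le => i.
rewrite (le_trans (ler_wpM2r _ (bnormD _ _))) ?exprn_ge0//.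
rewrite maxr_pMl ?exprn_ge0// ge_max !le_max !tnorm_ub orbT //.
Qed.

Lemma tnorm_const a : tnorm (tconst (bconst B a)) <= nabs a.
Proof.
apply: tnorm_le => -[|i] /=; first by rewrite mulr1 bnorm_const.
by rewrite bnorm0 mul0r nabs_ge0.
Qed.

Lemma tnorm_complete : norm_complete tnorm.
Proof.
move=> u hu.
have /choice[l hl] : forall i, exists l : B, forall e, 0 < e ->
    exists n0, forall n, (n0 <= n)%N -> N (u n i - l) < e.
  move=> i; apply: (@bnorm_complete _ _ B) => e e0.
  have ri : 0 < r%:num ^+ i by rewrite exprn_gt0.
  have [n0 hn0] := hu _ (mulr_gt0 e0 ri); exists n0 => m n hm hn.
  by rewrite -(ltr_pM2r ri); apply: le_lt_trans (tnorm_ub (u m - u n) i) (hn0 _ _ hm hn).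
have key e : 0 < e -> exists n0, forall n, (n0 <= n)%N ->
    forall i, N (u n i - l i) * r%:num ^+ i < e.
  move=> e0; have [n0 hn0] := hu _ e0; exists n0 => n hn i.
  have ri : 0 < r%:num ^+ i by rewrite exprn_gt0.
  have [n1 hn1] := hl i _ (divr_gt0 e0 ri).
  pose m := maxn n0 n1; have -> : u n i - l i = (u n i - u m i) + (u m i - l i).
    by rewrite addrA subrK.
  apply: (le_lt_trans (ler_wpM2r (ltW ri) (bnormD _ _))).
  rewrite maxr_pMl ?(ltW ri)// gt_max; apply/andP; split.
    by apply: le_lt_trans (tnorm_ub (u n - u m) i) (hn0 _ _ hn _); rewrite leq_maxl.
  by rewrite -ltr_pdivlMr// hn1// leq_maxr.
have ht : is_tate l.
  apply/is_tateP => e e0; have [n hn] := key _ e0.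
  have /is_tateP/(_ _ e0)[m hm] := tcoef_cvg (u n).
  exists m => i hi; have -> : l i = u n i - (u n i - l i) by rewrite subKr.
  rewrite (le_lt_trans (ler_wpM2r _ (bnormD _ _))) ?exprn_ge0//.
  by rewrite bnormN maxr_pMl ?exprn_ge0// gt_max hm// hn.
exists (Tate ht) => e e0.
have e2 : 0 < e / 2 by rewrite divr_gt0.
have [n0 hn0] := key _ e2; exists n0 => n hn.
apply: (@le_lt_trans _ _ (e / 2)); last by rewrite ltr_pdivrMr// ltr_pMr// ltr1n.
by apply: tnorm_le => i; rewrite tcoefB ltW// hn0.
Qed.

Definition tate_banach : banachAlg k :=
  @BanachAlg R k A (tconst \o bconst B) tnorm tnorm_ge0 tnorm_eq0 tnormM tnormD
    tnorm_const tnorm_complete.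

End TateRing.

(* M(B): bounded multiplicative seminorms.  A multiplicative seminorm bounded by
   a multiple of the norm is bounded by the norm, see [berk_pull_le]. *)
Record berk (R : realType) (k : nafield R) (B : banachAlg k) := Berk {
  berk_val :> B -> R;
  berk_ge0 : forall f, 0 <= berk_val f;
  berk1 : berk_val 1 = 1;
  berkM : forall f g, berk_val (f * g) = berk_val f * berk_val g;
  berkD : forall f g, berk_val (f + g) <= berk_val f + berk_val g;
  berk_const : forall a, berk_val (bconst B a) = nabs a;
  berk_le : forall f, berk_val f <= bnorm B f
}.

Section BerkTopology.
Variables (R : realType) (k : nafield R) (B : banachAlg k).

HB.instance Definition _ := gen_eqMixin (berk B).
HB.instance Definition _ := gen_choiceMixin (berk B).
HB.instance Definition _ := Topological.copy (berk B)
  (initial_topology (fun x : berk B => (x : {ptws B -> R}))).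

Lemma berkP (x y : berk B) : x =1 y -> x = y.
Proof.
case: x => x a1 a2 a3 a4 a5 a6; case: y => y b1 b2 b3 b4 b5 b6 /= e.
have {e} e : x = y by apply: funext.
by rewrite e in a1 a2 a3 a4 a5 a6 *; congr Berk; apply: Prop_irrelevance.
Qed.

End BerkTopology.

Record bhom (R : realType) (k : nafield R) (B C : banachAlg k) := BHom {
  bhom_val :> {rmorphism B -> C};
  bhom_const : forall a, bhom_val (bconst B a) = bconst C a;
  bhom_bounded : exists M, forall f, bnorm C (bhom_val f) <= M * bnorm B f
}.

Section BerkFunctor.
Variables (R : realType) (k : nafield R).

Definition bhom_id (B : banachAlg k) : bhom B B.
Proof.
refine (@BHom R k B B idfun _ _); abstract by [|exists 1 => f; rewrite mul1r].
Defined.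

Variables (B C : banachAlg k) (h : bhom B C) (y : berk C).

Lemma berkX (D : banachAlg k) (x : berk D) f n : x (f ^+ n) = x f ^+ n.
Proof. by elim: n => [|n ih]; rewrite ?berk1// !exprS berkM ih. Qed.

Lemma bnormX (D : banachAlg k) (f : D) n : bnorm D (f ^+ n) <= bnorm D f ^+ n.
Proof.
elim: n => [|n ih]; first by rewrite !expr0 bnorm1_le.
rewrite !exprS; apply: (le_trans (bnormM _ _)).
by rewrite ler_wpM2l ?bnorm_ge0.
Qed.

Lemma berk_pull_le f : y (h f) <= bnorm B f.
Proof.
have [M hM] := bhom_bounded h.
have hn n : y (h f) ^+ n <= `|M| * bnorm B f ^+ n.
  rewrite -berkX -rmorphXn (le_trans (berk_le _ _))//.
  apply: (le_trans (hM _)); apply: (@le_trans _ _ (`|M| * bnorm B (f ^+ n))).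
    by rewrite ler_wpM2r ?bnorm_ge0 ?ler_norm.
  by rewrite ler_wpM2l ?bnormX.
have := bnorm_ge0 f; rewrite le_eqVlt => /predU1P[f0|f0].
  by have := hn 1%N; rewrite !expr1 -f0 mulr0.
rewrite leNgt; apply/negP => lt1.
pose q := y (h f) / bnorm B f.
have q1 : 1 < q by rewrite /q ltr_pdivlMr ?mul1r.
have qn n : q ^+ n <= `|M|.
  by rewrite /q expr_div_n ler_pdivrMr ?exprn_gt0.
have bern n : 1 + n%:R * (q - 1) <= q ^+ n.
  elim: n => [|n ih]; first by rewrite mul0r addr0.
  have q10 : 0 <= q - 1 by rewrite subr_ge0 ltW.
  have -> : q ^+ n.+1 = q ^+ n + (q - 1) * q ^+ n.
    by rewrite exprS mulrBl mul1r addrC subrK.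
  rewrite -natr1 mulrDl mul1r addrA lerD// -[leLHS]mulr1 ler_wpM2l//.
  by rewrite exprn_ege1// ltW.
have q0 : 0 < q - 1 by rewrite subr_gt0.
have [n hn'] : exists n : nat, `|M| / (q - 1) < n%:R.
  by exists (Num.bound (`|M| / (q - 1))); rewrite archi_boundP// divr_ge0// ltW.
have := le_trans (bern n) (qn n).
rewrite leNgt => /negP; apply.
by rewrite ltr_pwDl// ltW// -ltr_pdivrMr.
Qed.

Definition berk_pull : berk B.
Proof.
refine (@Berk R k B (y \o h) _ _ _ _ _ berk_pull_le) => /=.
- abstract by move=> f; exact: berk_ge0.
- abstract by rewrite rmorph1 berk1.
- abstract by move=> f g; rewrite rmorphM berkM.
- abstract by move=> f g; rewrite rmorphD berkD.
- abstract by move=> a; rewrite bhom_const berk_const.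
Defined.

End BerkFunctor.

(* k{r_1^-1 T_1, ..., r_n^-1 T_n}, adjoining one variable at a time. *)
Definition tate_iter (R : realType) (k : nafield R) (rs : seq {posnum R}) :
    banachAlg k :=
  foldr (fun r B => tate_banach B r) (base_banach k) rs.

(* A quotient of k{r^-1 T}, the norm being equivalent to the residue norm. *)
Definition is_affinoid (R : realType) (k : nafield R) (B : banachAlg k) : Prop :=
  exists (rs : seq {posnum R}) (h : bhom (tate_iter k rs) B) (M : R),
    forall b, exists2 f, h f = b & bnorm _ f <= M * bnorm B b.

Record affinoid_domain (R : realType) (k : nafield R) (B : banachAlg k) :=
  AffinoidDomain {
    ad_set : set (berk B);
    ad_alg :> banachAlg k;
    ad_res : bhom B ad_alg;
    ad_closed : closed ad_set;
    ad_affinoid : is_affinoid ad_alg;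
    ad_image : forall y : berk ad_alg, ad_set (berk_pull ad_res y);
    ad_univ : forall (C : banachAlg k) (h : bhom B C), is_affinoid C ->
      (forall z : berk C, ad_set (berk_pull h z)) ->
      exists2 u : bhom ad_alg C, (forall f, u (ad_res f) = h f) &
        forall v : bhom ad_alg C, (forall f, v (ad_res f) = h f) -> v =1 u
  }.

Record affinoid_nbhd (R : realType) (k : nafield R) (B : banachAlg k)
    (x : berk B) := AffinoidNbhd {
  an_dom :> affinoid_domain B;
  an_nbhd : nbhs x (ad_set an_dom)
}.

(* The local ring at x, as a filtered direct limit: every germ comes from some
   affinoid neighborhood, and sections have the same germ iff they agree after
   restriction to a common smaller one.  A homomorphism compatible with the
   restrictions from the ambient algebra is the transition map. *)
Record stalk (R : realType) (k : nafield R) (B : banachAlg k) (x : berk B) :=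
  Stalk {
    stalk_ring :> comPzRingType;
    germ : forall V : affinoid_nbhd x, {rmorphism V -> stalk_ring};
    germ_surj : forall g : stalk_ring,
      exists (V : affinoid_nbhd x) (f : V), germ V f = g;
    germ_eq : forall (V V' : affinoid_nbhd x) (f : V) (f' : V'),
      germ V f = germ V' f' <->
      exists (W : affinoid_nbhd x) (u : bhom V W) (u' : bhom V' W),
        [/\ forall b, u (ad_res V b) = ad_res W b,
            forall b, u' (ad_res V' b) = ad_res W b & u f = u' f']
  }.

Definition tate_alg (R : realType) (k : nafield R) : banachAlg k :=
  tate_banach (base_banach k) 1%:pos.

Definition disc (R : realType) (k : nafield R) := berk (tate_alg k).

Section GaussPoint.
Variables (R : realType) (k : nafield R).
Local Notation A := (tate_alg k).

Lemma gauss_max (f : A) : f != 0 -> exists i : nat,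
  nabs (tcoef f i) = bnorm A f /\ forall j, (j < i)%N -> nabs (tcoef f j) < bnorm A f.
Proof.
move=> f0; set M := bnorm A f.
have M0 : 0 < M by rewrite lt_def bnorm_ge0 bnorm_eq0 f0.
have ub j : nabs (tcoef f j) <= M.
  by have := tnorm_ub f j; rewrite expr1n mulr1.
have [n hn] : exists n, forall i, (n <= i)%N -> nabs (tcoef f i) < M / 2.
  have /is_tateP/(_ _ (divr_gt0 M0 (ltr0n _ 2)))[n hn] := tcoef_cvg f.
  by exists n => i /hn; rewrite expr1n mulr1.
have [i hi] : exists i, nabs (tcoef f i) == M.
  apply: contrapT => /forallNP hne.
  have lt j : nabs (tcoef f j) < M by rewrite lt_neqAle ub andbT; apply/negP/hne.
  pose L := \big[Num.max/(M / 2)]_(i < n) nabs (tcoef f i).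
  have ML : M <= L.
    apply: tnorm_le => j; rewrite expr1n mulr1; have [nj|jn] := leqP n j.
      by rewrite (le_trans (ltW (hn _ nj)))// /L bigmax_ge_id.
    exact: (le_bigmax _ (fun i : 'I_n => nabs (tcoef f i)) (Ordinal jn)).
  have : L < M.
    apply/bigmax_ltP; split=> [|j _]; last exact: lt.
    by rewrite ltr_pdivrMr// ltr_pMr// ltr1n.
  by rewrite ltNge ML.
have ex : exists i, nabs (tcoef f i) == M by exists i.
exists (ex_minn ex); case: ex_minnP => m /eqP hm hmin; split=> // j jm.
rewrite lt_neqAle ub andbT; apply/negP => /hmin.
by rewrite leqNgt jm.
Qed.

Lemma nabs_sum_lt (I : Type) (s : seq I) (P : pred I) (F : I -> k) (M : R) :
  0 < M -> (forall i, P i -> nabs (F i) < M) -> nabs (\sum_(i <- s | P i) F i) < M.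
Proof.
move=> M0 h; elim/big_ind: _ => [|x y hx hy|//]; first by rewrite nabs0.
by apply: (le_lt_trans (nabsD _ _)); rewrite gt_max hx hy.
Qed.

Lemma gaussM (f g : A) : bnorm A (f * g) = bnorm A f * bnorm A g.
Proof.
have [->|f0] := eqVneq f 0; first by rewrite mul0r !bnorm0 mul0r.
have [->|g0] := eqVneq g 0; first by rewrite mulr0 !bnorm0 mulr0.
apply/le_anti; rewrite bnormM /=.
have [i [hi mi]] := gauss_max f0; have [j [hj mj]] := gauss_max g0.
have Mf : 0 < bnorm A f by rewrite lt_def bnorm_ge0 bnorm_eq0 f0.
have Mg : 0 < bnorm A g by rewrite lt_def bnorm_ge0 bnorm_eq0 g0.
have ubf l : nabs (tcoef f l) <= bnorm A f.
  by have := tnorm_ub f l; rewrite expr1n mulr1.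
have ubg l : nabs (tcoef g l) <= bnorm A g.
  by have := tnorm_ub g l; rewrite expr1n mulr1.
have key : nabs (tcoef (f * g : A) (i + j)) = bnorm A f * bnorm A g; last first.
  by have := tnorm_ub (f * g) (i + j); rewrite expr1n mulr1 => /(le_trans _); apply; rewrite -key.
have ij : (i < (i + j).+1)%N by rewrite ltnS leq_addr.
have -> : tcoef (f * g : A) (i + j) = tcoef f i * tcoef g j +
   \sum_(l < (i + j).+1 | l != Ordinal ij) tcoef f l * tcoef g (i + j - l)%N.
  by rewrite tcoefM (bigD1 (Ordinal ij))//= addKn.
set S := (\sum_(l < _ | _) _).
have hS : nabs (S : k) < bnorm A f * bnorm A g.
  apply: nabs_sum_lt => [|l li]; first by rewrite mulr_gt0.
  rewrite nabsM; have := li; rewrite -val_eqE /= neq_ltn => /orP[l_i|i_l].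
    apply: (@le_lt_trans _ _ (nabs (tcoef f l) * bnorm A g)).
      by rewrite ler_wpM2l ?nabs_ge0.
    by rewrite ltr_pM2r// mi.
  apply: (@le_lt_trans _ _ (bnorm A f * nabs (tcoef g (i + j - l)%N))).
    by rewrite ler_wpM2r ?nabs_ge0.
  by rewrite ltr_pM2l// mj// ltn_subLR ?ltn_add2r// -ltnS ltn_ord.
have e1 : nabs (tcoef f i * tcoef g j : k) = bnorm A f * bnorm A g.
  by rewrite nabsM; congr (_ * _).
apply/le_anti/andP; split.
  by apply: (le_trans (nabsD _ _)); rewrite ge_max e1 lexx ltW.
rewrite leNgt; apply/negP => lt1.
have : nabs (tcoef f i * tcoef g j : k) < bnorm A f * bnorm A g; last by rewrite e1 ltxx.
rewrite -{1}[(tcoef f i * tcoef g j : k)](addrK (S : k)).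
apply: (le_lt_trans (nabsD _ _)); rewrite gt_max lt1/=.
by have := @bnormN R k (base_banach k) S => /= ->.
Qed.

Definition gauss_pt : disc k.
Proof.
refine (@Berk R k A (bnorm A) (@bnorm_ge0 _ _ A) _ gaussM _ _ (fun f => lexx _)).
- abstract (by apply/le_anti; rewrite bnorm1_le /=;
  apply: le_trans (tnorm_ub (1 : A) 0); rewrite expr1n mulr1 /= nabs1).
- abstract (by move=> f g; apply: (le_trans (bnormD _ _));
  rewrite ge_max lerDl lerDr !bnorm_ge0).
- abstract (by move=> a; apply/le_anti; rewrite bnorm_const /=;
  apply: le_trans (tnorm_ub (tconst _ _) 0); rewrite expr1n mulr1).
Defined.

End GaussPoint.

Section WholeDisc.
Variables (R : realType) (k : nafield R).
Local Notation A := (tate_alg k).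

Lemma tate_alg_affinoid : is_affinoid A.
Proof.
by exists [:: 1%:pos], (bhom_id A), 1 => b; exists b; rewrite ?mul1r.
Qed.

(* k{T} as the affinoid algebra of the whole disc, giving k{T} -> O_{X,x}. *)
Definition whole_domain : affinoid_domain A.
Proof.
refine (@AffinoidDomain R k A setT A (bhom_id A) closedT tate_alg_affinoid _ _).
- abstract (by move=> y).
- abstract (by move=> C h _ _; exists h => // v).
Defined.

Definition whole_disc (x : disc k) : affinoid_nbhd x :=
  @AffinoidNbhd R k A x whole_domain filterT.

End WholeDisc.

(* k^a is [cc_alg] and its completion K is [cc_field]. *)
Record completed_closure (R : realType) (k : nafield R) := CompletedClosure {
  cc_alg : fieldType;
  cc_field :> nafield R;
  cc_base : {rmorphism k -> cc_alg};
  cc_incl : {rmorphism cc_alg -> cc_field};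
  cc_closed : GRing.closed_field_axiom cc_alg;
  cc_algebraic : forall z, algebraicOver cc_base z;
  cc_abs : forall a, nabs (cc_incl (cc_base a)) = nabs a;
  cc_dense : forall (z : cc_field) e, 0 < e ->
    exists w, nabs (z - cc_incl w) < e
}.

Section Restriction.
Variables (R : realType) (k : nafield R) (K : completed_closure k).

Definition cc_emb : k -> K := cc_incl K \o cc_base K.

Lemma tate_emb_cvg (f : tate_alg k) :
  (fun i => bnorm (base_banach K) (cc_emb (tcoef f i)) * 1%:pos%:num ^+ i)
    @ \oo --> (0 : R).
Proof.
have := tcoef_cvg f; rewrite /=.
by under [X in _ -> X @ _ --> _]eq_fun do rewrite cc_abs.
Qed.

Definition tate_emb (f : tate_alg k) : tate_alg K := Tate (tate_emb_cvg f).

Lemma tate_emb1 : tate_emb 1 = 1.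
Proof. by apply: tateP => -[|i] /=; rewrite /cc_emb /= ?rmorph1 ?rmorph0. Qed.

Lemma tate_embM f g : tate_emb (f * g) = tate_emb f * tate_emb g.
Proof.
apply: tateP => i; rewrite tcoefM /= /cc_emb /= /tmul_coef !rmorph_sum /=.
by apply: eq_bigr => j _; rewrite !rmorphM.
Qed.

Lemma tate_embD f g : tate_emb (f + g) = tate_emb f + tate_emb g.
Proof. by apply: tateP => i; rewrite tcoefD /= /cc_emb /= !rmorphD. Qed.

Lemma tate_emb_const a :
  tate_emb (bconst (tate_alg k) a) = bconst (tate_alg K) (cc_emb a).
Proof. by apply: tateP => -[|i] //=; rewrite /cc_emb /= !rmorph0. Qed.

Lemma tate_emb_norm f : bnorm (tate_alg K) (tate_emb f) <= bnorm (tate_alg k) f.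
Proof. by apply: tnorm_le => i /=; rewrite cc_abs; exact: (tnorm_ub f i). Qed.

(* The map pi : X_K -> X. *)
Definition restr (y : disc K) : disc k.
Proof.
refine (@Berk R k (tate_alg k) (fun f => y (tate_emb f)) _ _ _ _ _ _).
- abstract (by move=> f; exact: berk_ge0).
- abstract (by rewrite tate_emb1 berk1).
- abstract (by move=> f g; rewrite tate_embM berkM).
- abstract (by move=> f g; rewrite tate_embD; exact: berkD).
- abstract (by move=> a; rewrite tate_emb_const berk_const cc_abs).
- abstract (by move=> f; apply: le_trans (berk_le _ _) (tate_emb_norm f)).
Defined.

End Restriction.

Section Disc.
Variables (R : realType) (k : nafield R) (K : completed_closure k).
Local Notation X := (disc k).
Local Notation xG := (gauss_pt k).
Implicit Types (x y z u : X) (Y : set X) (phi : X -> \bar R).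

Definition disc_le x y : Prop := forall f, x f <= y f.

Definition disc_join x y : X :=
  xget xG [set z | [/\ disc_le x z, disc_le y z &
    forall u, disc_le x u -> disc_le y u -> disc_le z u]].

Definition segment x y : set X :=
  [set z | disc_le z (disc_join x y) /\ (disc_le x z \/ disc_le y z)].

(* The supremum is taken over the Berkovich disc |T - w| <= s in X_K: over its
   K-points alone it would only see s = 0, 1 when k is trivially valued; when
   the value group is nontrivial, hence dense, both suprema agree. *)
Definition is_disc_pt (w : K) (s : R) (x : disc K) : Prop :=
  forall f : tate_alg K,
    x f = sup [set y f | y in [set y : disc K |
                 y (tvar _ _ - bconst (tate_alg K) w) <= s]].

Definition closed_disc (w : K) (s : R) : set K := [set z | nabs (z - w) <= s].

Definition has_radius (x : disc K) (s : R) : Prop :=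
  (exists w : K, [/\ nabs w <= 1, 0 <= s <= 1 & is_disc_pt w s x]) \/
  (exists (w : nat -> K) (t : nat -> R) (y : nat -> disc K),
    [/\ forall i, [/\ nabs (w i) <= 1, 0 <= t i <= 1 &
                      is_disc_pt (w i) (t i) (y i)],
        forall i, closed_disc (w i.+1) (t i.+1) `<=` closed_disc (w i) (t i),
        \bigcap_i closed_disc (w i) (t i) = set0,
        y @ \oo --> x & t @ \oo --> s]).

Definition radius x : R :=
  xget 0 [set s | exists2 y : disc K, restr y = x & has_radius y s].

Definition logradius x : \bar R := (- lne (radius x)%:E)%E.

Definition mult x : \bar R := counting [set y : disc K | restr y = x].

Definition rigid : set X :=
  [set x | exists w : cc_alg K, nabs (cc_incl K w) <= 1 /\
     exists2 y : disc K, is_disc_pt (cc_incl K w) 0 y & restr y = x].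

(* The point of [x, x_G] at which - log r = t. *)
Definition path_to_gauss x (t : R) : X :=
  xget xG [set u | disc_le x u /\ logradius u = t%:E].

(* Minus the integral of (1/m) d(log r) from x_G to x, in the variable
   t = - log r; [fine] and the convention 0^-1 = 0 give 1/m = 0 if m = +oo. *)
Definition alpha x : \bar R :=
  (\int[@lebesgue_measure R]_(t in [set t : R | (0 <= t)%R /\ t%:E <= logradius x])
     ((fine (mult (path_to_gauss x t)))^-1)%:E)%E.

(* The case x = y is separate because +oo - +oo is not 0 in \bar R. *)
Definition disc_dist x y : \bar R :=
  (if x == y then 0
   else `|alpha x - alpha (disc_join x y)| + `|alpha y - alpha (disc_join x y)|)%E.

Definition disc_convex Y : Prop :=
  forall x y, Y x -> Y y -> segment x y `<=` Y.

Definition convex_hull (S : set X) : set X := smallest disc_convex S.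

Definition finite_subtree Y : Prop :=
  exists2 S : set X, finite_set S & Y = convex_hull S.

Definition admissible_subtree Y : Prop :=
  [/\ finite_subtree Y, Y `<=` ~` rigid & Y xG].

Definition is_retraction Y x y : Prop := segment x y `&` Y = [set y].

Definition retraction Y x : X := xget xG (is_retraction Y x).

(* Tangent directions at y in Y: z and z' in Y \ {y} are identified when the
   segments ]y, z] and ]y, z'] intersect.  A direction is its class. *)
Definition direction Y y z : set X :=
  [set z' | [/\ Y z', z' <> y &
     exists u, [/\ u <> y, segment y z u & segment y z' u]]].

Definition tangent Y y : set (set X) :=
  [set direction Y y z | z in [set z | Y z /\ z <> y]].

(* If y is at infinite distance, the quotient is 0 since [fine +oo = 0]. *)
Definition has_dir_derivative phi y (v : set X) (l : R) : Prop :=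
  (fun z => (fine (phi z) - fine (phi y)) / fine (disc_dist y z))
    @ within v (nbhs y) --> l.

Definition convex_on_segment phi x y : Prop :=
  (disc_dist x y < +oo)%E -> forall z, segment x y z ->
    fine (disc_dist x y) * fine (phi z) <=
    fine (disc_dist z y) * fine (phi x) + fine (disc_dist x z) * fine (phi y).

(* rho_0 = c delta_{x_G}.  Directional derivatives at every point of Y only make
   sense if phi is real-valued on Y.  Convexity is asked on segments of finite
   length; by continuity this also governs ends at infinite distance. *)
Definition subharmonic_on (c : R) phi Y : Prop :=
  [/\ forall y, Y y -> phi y \is a fin_num,
      {within Y, continuous phi},
      forall x y, Y x -> Y y -> ~ segment x y xG -> convex_on_segment phi x y &
      forall y, Y y -> exists l : set X -> R,
        (forall v, tangent Y y v -> has_dir_derivative phi y v (l v)) /\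
        0 <= (if y == xG then c else 0) + \sum_(v \in tangent Y y) l v].

Definition subharmonic (c : R) phi : Prop :=
  [/\ forall x, (phi x < +oo)%E,
      forall Y, admissible_subtree Y -> subharmonic_on c phi Y &
      forall x (U : set (\bar R)), nbhs (phi x) U ->
        exists2 Y0, admissible_subtree Y0 &
          forall Y, admissible_subtree Y -> Y0 `<=` Y -> U (phi (retraction Y x))].

Definition quasisubharmonic phi : Prop := exists2 c : R, 0 < c & subharmonic c phi.

Definition poles phi : set X := [set x | phi x = -oo%E].

Definition norm_phi phi (f : tate_alg k) : \bar R :=
  ereal_sup [set ((x f)%:E * expeR (- phi x - logradius x))%E | x in ~` poles phi].

Definition norm_phi_plus phi (f : tate_alg k) : \bar R :=
  lim ((fun e : R => norm_phi (fun x => (1 + e)%:E * phi x)%E f) @ 0^'+).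

Definition Hphi phi : set (tate_alg k) :=
  [set f | (norm_phi_plus phi f < +oo)%E].

(* The points of V are identified with the spectrum of its affinoid algebra. *)
Definition local_multiplier_ideal phi (x : X) (O : stalk x) : set O :=
  [set g | exists (e : R) (V : affinoid_nbhd x) (f : V),
    [/\ 0 < e, germ O V f = g &
      (ereal_sup [set (y f)%:E *
          expeR (- ((1 + e)%:E * phi (berk_pull (ad_res V) y))
                 - logradius (berk_pull (ad_res V) y))
        | y in [set y : berk V | ~ poles phi (berk_pull (ad_res V) y)]] < +oo)%E]].

Definition extended_ideal (x : X) (O : stalk x) (I : set (tate_alg k)) : set O :=
  [set g | exists (n : nat) (h : 'I_n -> tate_alg k) (a : 'I_n -> O),
    (forall i, I (h i)) /\ g = \sum_(i < n) germ O (whole_disc x) (h i) * a i].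

End Disc.

Arguments local_multiplier_ideal {R k} K phi {x} O.
Arguments extended_ideal {R k x} O I.

(* Main.v *)
(** Write A = k{T}.  Along a path to the Gauss point x_G, phi increases with
    slopes (with respect to alpha) that increase and stay below c.  Call a point
    steep if phi has slope > 1/2 somewhere just below it.  The Laplacian condition
    adds up the slopes of disjoint branches, so an antichain of steep points has
    at most 2c members; as phi is finite and continuous at non-rigid points, steep
    points of large alpha lie above one of finitely many rigid points e.  Where
    there is no steep point above z, -2 phi(z) - alpha(z) is bounded; in general
    it is at most 2c alpha(u) up to a constant for some steep u above z.  If P_e
    generates the ideal of e and |P_e| = 1, then |P_e| <= r <= e^(-alpha) above e,
    so |P_e|^N with N >= 2c compensates the weight near e.

    Given a section f on V, let P and q be the products of the P_e^N over the e in
    V, respectively outside V.  The universal property of V, tested on the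
    quotients of A and of O(V) by P, gives f = a + P g with a in A.  As q has no
    zero on V, it is a unit there, spectra of non-zero Banach algebras being
    non-empty.  Then aq and Pq lie in H_phi: near e in V, points of X lift to V,
    where a = f - P g.  Finally f = (aq) q^-1 + (Pq) (q^-1 g). *)

Require Import Defs.
From HB Require Import structures.
From mathcomp Require Import all_boot all_order all_algebra.
From mathcomp Require Import all_classical all_reals all_analysis.
From mathcomp Require Import generic_quotient lra ring zify finmap measurable_realfun.
Import Order.TTheory GRing.Theory Num.Theory numFieldNormedType.Exports.

Set Implicit Arguments.
Unset Strict Implicit.
Unset Printing Implicit Defensive.

Local Open Scope classical_set_scope.
Local Open Scope ring_scope.

(** * Seminorms *)

(** The threshold 1/2 for steepness comes from shrinking epsilon to at most 1: as phi <= 0 and alpha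
    <= -log r, the exponent of the weight is then at most -2 phi - alpha, and a slope of at most 1/2
    lets -2 phi grow no faster than alpha. Points of radius 0 that are not poles have weight 0, so
    all estimates are made at positive radius, where phi and alpha are finite. The algebra of V is
    accessible only through its universal property and a presentation, and nothing says that the
    ideal of P is closed. Quotients are therefore taken by closures of ideals, and f = a + P g comes
    out first up to an error. To make it exact, a and g must be bounded by the size of f with a
    constant independent of f; this is why the division is carried out monomial by monomial in a
    presentation of V. The resulting constant M serves a second time: it controls expansions in
    powers of P, and a point z with |P(z)| < M^-2 lifts to V because these expansions converge at
    z. *)

Section WeightedGauss.
Variables (R : realType).

Record mult_seminorm (S : pzRingType) (N : S -> R) : Prop := MultSeminorm {
  ms_ge0 : forall x, 0 <= N x;
  ms0 : N 0 = 0;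
  ms1 : N 1 = 1;
  msM : forall x y, N (x * y) = N x * N y;
  msD : forall x y, N (x + y) <= Num.max (N x) (N y)
}.

Section Theory.
Variables (S : pzRingType) (N : S -> R) (hN : mult_seminorm N).

Lemma msN x : N (- x) = N x.
Proof.
have h : N (-1) = 1.
  have : N (-1) ^+ 2 = 1 by rewrite expr2 -(msM hN) mulrNN mulr1 (ms1 hN).
  move/eqP; rewrite sqrf_eq1 => /orP[/eqP//|/eqP h].
  by have := ms_ge0 hN (-1); rewrite h oppr_ge0 ler10.
by rewrite -mulN1r (msM hN) h mul1r.
Qed.

Lemma ms_sum (I : Type) (s : seq I) (P : pred I) (F : I -> S) (M : R) :
  0 <= M -> (forall i, P i -> N (F i) <= M) -> N (\sum_(i <- s | P i) F i) <= M.
Proof.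
move=> M0 h; elim/big_ind: _ => [|x y hx hy|//]; first by rewrite (ms0 hN).
by apply: (le_trans (msD hN _ _)); rewrite ge_max hx hy.
Qed.

Lemma ms_sum_lt (I : Type) (s : seq I) (P : pred I) (F : I -> S) (M : R) :
  0 < M -> (forall i, P i -> N (F i) < M) -> N (\sum_(i <- s | P i) F i) < M.
Proof.
move=> M0 h; elim/big_ind: _ => [|x y hx hy|//]; first by rewrite (ms0 hN).
by apply: (le_lt_trans (msD hN _ _)); rewrite gt_max hx hy.
Qed.

Lemma msB_le x y : N (x - y) <= Num.max (N x) (N y).
Proof. by rewrite -[N y]msN (msD hN). Qed.

Lemma ms_distC x y : N (x - y) = N (y - x).
Proof. by rewrite -msN opprB. Qed.

Lemma msD_eq x y : N y < N x -> N (x + y) = N x.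
Proof.
move=> h; apply/le_anti/andP; split.
  by apply: (le_trans (msD hN _ _)); rewrite ge_max lexx ltW.
rewrite leNgt; apply/negP => lt1.
have : N x < N x; last by rewrite ltxx.
rewrite -{1}(addrK y x); apply: (le_lt_trans (msB_le _ _)).
by rewrite gt_max lt1 h.
Qed.

Lemma msX x n : N (x ^+ n) = N x ^+ n.
Proof. by elim: n => [|n ih]; rewrite ?expr0 ?(ms1 hN)// !exprS (msM hN) ih. Qed.

Lemma ms_prod (I : Type) (s : seq I) (P : pred I) (F : I -> S) :
  N (\prod_(i <- s | P i) F i) = \prod_(i <- s | P i) N (F i).
Proof. by apply: (big_morph N (msM hN) (ms1 hN)). Qed.

Lemma ms_natr_le1 n : N n%:R <= 1.
Proof.
elim: n => [|n ih]; first by rewrite (ms0 hN).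
by rewrite -natr1; apply: (le_trans (msD hN _ _)); rewrite ge_max ih (ms1 hN) lexx.
Qed.

End Theory.

Variables (S : comNzRingType) (N : S -> R) (hN : mult_seminorm N) (t : R).
Hypothesis t0 : 0 <= t.
Implicit Types P Q : {poly S}.

(** For t = 0 the convention that the power of exponent 0 is 1 makes this the value of N at the
    constant term. *)
Definition gnorm P : R := \big[Num.max/0]_(i < size P) (N P`_i * t ^+ i).

Lemma gterm_ge0 P i : 0 <= N P`_i * t ^+ i.
Proof. by rewrite mulr_ge0 ?(ms_ge0 hN) ?exprn_ge0. Qed.

Lemma gnorm_ub P i : N P`_i * t ^+ i <= gnorm P.
Proof.
have [iP|Pi] := ltnP i (size P).
  exact: (le_bigmax _ (fun i : 'I_(size P) => N P`_i * t ^+ i) (Ordinal iP)).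
by rewrite nth_default// (ms0 hN) mul0r bigmax_ge_id.
Qed.

Lemma gnorm_le P M : 0 <= M -> (forall i, N P`_i * t ^+ i <= M) -> gnorm P <= M.
Proof. by move=> M0 h; apply/bigmax_leP; split. Qed.

Lemma gnorm_ge0 P : 0 <= gnorm P. Proof. exact: bigmax_ge_id. Qed.

Lemma gnormC c : gnorm c%:P = N c.
Proof.
apply/le_anti/andP; split.
  apply: gnorm_le; first exact: (ms_ge0 hN).
  by move=> [|i]; rewrite coefC/= ?mulr1// (ms0 hN) mul0r (ms_ge0 hN).
by have := gnorm_ub c%:P 0; rewrite coefC mulr1.
Qed.

Lemma gnormD P Q : gnorm (P + Q) <= Num.max (gnorm P) (gnorm Q).
Proof.
apply: gnorm_le => [|i]; first by rewrite le_max gnorm_ge0.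
rewrite coefD (le_trans (ler_wpM2r _ (msD hN _ _))) ?exprn_ge0//.
by rewrite maxr_pMl ?exprn_ge0// ge_max !le_max !gnorm_ub orbT.
Qed.

Lemma gnormM_le P Q : gnorm (P * Q) <= gnorm P * gnorm Q.
Proof.
apply: gnorm_le => [|i]; first by rewrite mulr_ge0 ?gnorm_ge0.
have := t0; rewrite le_eqVlt => /predU1P[t_0|tp].
  case: i => [|i]; last by rewrite -t_0 expr0n/= mulr0 mulr_ge0 ?gnorm_ge0.
  rewrite expr0 mulr1 coefM big_ord1 (msM hN).
  have := gnorm_ub P 0; have := gnorm_ub Q 0; rewrite !expr0 !mulr1 => hq hp.
  by rewrite ler_pM ?(ms_ge0 hN).
have ti : 0 < t ^+ i by rewrite exprn_gt0.
rewrite -ler_pdivlMr// coefM; apply: (ms_sum hN) => [|j _].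
  by rewrite divr_ge0 ?mulr_ge0 ?gnorm_ge0 ?ltW.
have ti2 : t ^+ i = t ^+ j * t ^+ (i - j) by rewrite -exprD subnKC ?leq_ord.
by rewrite ler_pdivlMr// (msM hN) ti2 mulrACA ler_pM ?gterm_ge0 ?gnorm_ub.
Qed.

Lemma gnorm_max P : 0 < gnorm P -> exists i : nat,
  N P`_i * t ^+ i = gnorm P /\
  forall j, (j < i)%N -> N P`_j * t ^+ j < gnorm P.
Proof.
move=> P0.
have ex : exists i, N P`_i * t ^+ i == gnorm P.
  have szP : (0 < size P)%N.
    rewrite lt0n size_poly_eq0; apply: contraTneq P0 => ->.
    by rewrite gnormC (ms0 hN) ltxx.
  pose i0 := Ordinal szP.
  have [i|i _ hi] := @eq_bigmax _ _ _ 0 i0 xpredT (fun i : 'I__ => N P`_i * t ^+ i) isT.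
    by move=> _; exact: gterm_ge0.
  by exists i; rewrite /gnorm hi.
exists (ex_minn ex); case: ex_minnP => m /eqP hm hmin; split=> // j jm.
rewrite lt_neqAle gnorm_ub andbT; apply/negP => /hmin.
by rewrite leqNgt jm.
Qed.

(** At the smallest indices i and j where P and Q reach their norms, one term dominates strictly in
    the coefficient of index i + j of the product. The power of t at that index is positive, even if
    t = 0, because both norms are. *)
Lemma gnormM P Q : gnorm (P * Q) = gnorm P * gnorm Q.
Proof.
apply/le_anti; rewrite gnormM_le /=.
have [p0|Mf] := leP (gnorm P) 0.
  by rewrite (@le_anti _ _ (gnorm P) 0) ?p0 ?gnorm_ge0// mul0r gnorm_ge0.
have [q0|Mg] := leP (gnorm Q) 0.
  by rewrite (@le_anti _ _ (gnorm Q) 0) ?q0 ?gnorm_ge0// mulr0 gnorm_ge0.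
have [i [hi mi]] := gnorm_max Mf; have [j [hj mj]] := gnorm_max Mg.
have tij : 0 < t ^+ (i + j).
  rewrite lt_def exprn_ge0// andbT; apply: contraTneq (mulr_gt0 Mf Mg).
  by rewrite exprD -hi -hj mulrACA => ->; rewrite mulr0 ltxx.
have tn n : (n <= i + j)%N -> 0 < t ^+ n.
  move=> nij; rewrite lt_def exprn_ge0// andbT; apply: contraTneq tij => h.
  by rewrite -(subnKC nij) exprD h mul0r ltxx.
apply: le_trans (gnorm_ub _ (i + j)).
have ij : (i < (i + j).+1)%N by rewrite ltnS leq_addr.
rewrite coefM (bigD1 (Ordinal ij))//= addKn.
set T := (\sum_(l < _ | _) _).
have e1 : N (P`_i * Q`_j) * t ^+ (i + j) = gnorm P * gnorm Q.
  by rewrite (msM hN) exprD mulrACA hi hj.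
rewrite (msD_eq hN) ?e1//.
rewrite -(ltr_pM2r tij) e1 -ltr_pdivlMr//; apply: (ms_sum_lt hN) => [|l li].
  by rewrite divr_gt0 ?mulr_gt0.
have lij : (l <= i + j)%N by rewrite -ltnS ltn_ord.
have tl : t ^+ (i + j) = t ^+ l * t ^+ (i + j - l) by rewrite -exprD subnKC.
rewrite ltr_pdivlMr// (msM hN) tl mulrACA.
have := li; rewrite -val_eqE /= neq_ltn => /orP[l_i|i_l].
  apply: (@le_lt_trans _ _ (N P`_l * t ^+ l * gnorm Q)).
    by rewrite ler_wpM2l ?gterm_ge0 ?gnorm_ub.
  by rewrite ltr_pM2r// mi.
apply: (@le_lt_trans _ _ (gnorm P * (N Q`_(i + j - l) * t ^+ (i + j - l)))).
  by rewrite ler_wpM2r ?gterm_ge0 ?gnorm_ub.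
by rewrite ltr_pM2l// mj// ltn_subLR ?ltn_add2r.
Qed.

Lemma gnorm_ms : mult_seminorm gnorm.
Proof.
split; [exact: gnorm_ge0| |by rewrite gnormC (ms1 hN)|exact: gnormM|exact: gnormD].
by rewrite gnormC (ms0 hN).
Qed.

End WeightedGauss.

Lemma eq_gnorm (R : realType) (S : comNzRingType) (N N' : S -> R) (t : R) (P : {poly S}) :
  N =1 N' -> gnorm N t P = gnorm N' t P.
Proof. by move=> h; apply: eq_bigr => i _; rewrite h. Qed.

Section BerkSeminorm.
Variables (R : realType) (k : nafield R).

Lemma nabs_ms : mult_seminorm (@nabs R k).
Proof. by split; [exact: nabs_ge0|exact: nabs0|exact: nabs1|exact: nabsM|exact: nabsD]. Qed.

(** If q > 1, the square of Bernoulli's inequality gives q ^+ (2 n) >= (n (q - 1))^2, which outgrows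
    2 n + 1; the choice n (q - 1)^2 > 3 is enough. *)
Lemma expr_bounded_linear_le1 (q : R) :
  0 <= q -> (forall n, q ^+ n <= n.+1%:R) -> q <= 1.
Proof.
move=> q0 h; rewrite leNgt; apply/negP => q1.
have bern n : 1 + n%:R * (q - 1) <= q ^+ n.
  elim: n => [|n ih]; first by rewrite mul0r addr0.
  have q10 : 0 <= q - 1 by rewrite subr_ge0 ltW.
  have -> : q ^+ n.+1 = q ^+ n + (q - 1) * q ^+ n.
    by rewrite exprS mulrBl mul1r addrC subrK.
  rewrite -natr1 mulrDl mul1r addrA lerD// -[leLHS]mulr1 ler_wpM2l//.
  by rewrite exprn_ege1// ltW.
have e0 : 0 < q - 1 by rewrite subr_gt0.
pose e := q - 1.
pose n := (Num.bound (3 / e ^+ 2)).+1.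
have hn : 3 / e ^+ 2 < n%:R.
  rewrite (lt_le_trans (archi_boundP _)) ?ler_nat//.
  by rewrite divr_ge0// exprn_ge0// ltW.
have h3 : 3 < n%:R * e ^+ 2 by rewrite -ltr_pdivrMr ?exprn_gt0.
have := h (n * 2)%N; rewrite exprM leNgt => /negP; apply.
have n1 : (1 : R) <= n%:R by rewrite ler1n.
have en : 0 <= n%:R * e by rewrite mulr_ge0// ltW.
apply: (@lt_le_trans _ _ ((n%:R * e) ^+ 2)); last first.
  rewrite ler_pXn2r ?nnegrE ?exprn_ge0//; apply: le_trans (bern n); rewrite -/e.
  by rewrite lerDr.
rewrite -natr1 natrM; move: h3 n1; rewrite exprMn; set x := n%:R; nra.
Qed.

Section Ultrametric.
Variables (B : banachAlg k) (x : berk B).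

Lemma berk0 : x 0 = 0.
Proof. by rewrite -(rmorph0 (bconst B)) berk_const nabs0. Qed.

Lemma berk_natr_le1 n : x n%:R <= 1.
Proof. by rewrite -(rmorph_nat (bconst B)) berk_const; exact: (ms_natr_le1 nabs_ms). Qed.

Lemma berk_sum_le (I : Type) (s : seq I) (F : I -> B) :
  x (\sum_(i <- s) F i) <= \sum_(i <- s) x (F i).
Proof.
elim: s => [|i s ih]; first by rewrite !big_nil berk0.
by rewrite !big_cons; apply: le_trans (berkD _ _ _) _; rewrite lerD2l.
Qed.

(** A point is only assumed to be subadditive. Integers have value at most 1, so the binomial
    expansion of (f + g) ^+ n costs a factor n + 1, which disappears on taking roots. *)
Lemma berk_ultra f g : x (f + g) <= Num.max (x f) (x g).
Proof.
set M := Num.max _ _.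
have M0 : 0 <= M by rewrite le_max berk_ge0.
have key n : x (f + g) ^+ n <= n.+1%:R * M ^+ n.
  rewrite -berkX exprDn (le_trans (berk_sum_le _ _))//.
  rewrite -[n.+1 in leRHS]card_ord mulr_natl -sumr_const ler_sum// => i _.
  rewrite -mulr_natr berkM -[leRHS]mulr1 ler_pM ?berk_ge0 ?berk_natr_le1//.
  have Mn : M ^+ n = M ^+ (n - i) * M ^+ i by rewrite -exprD subnK ?leq_ord.
  rewrite berkM !berkX Mn ler_pM ?exprn_ge0 ?berk_ge0//.
    by rewrite lerXn2r ?nnegrE ?berk_ge0// le_max lexx.
  by rewrite lerXn2r ?nnegrE ?berk_ge0// le_max lexx orbT.
have [Mn|Mp] := leP M 0.
  have M_0 : M = 0 by apply/le_anti; rewrite Mn M0.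
  by have := key 1%N; rewrite M_0 !expr1 mulr0.
rewrite -[leRHS]mul1r -ler_pdivrMr//; apply: expr_bounded_linear_le1.
  by rewrite divr_ge0 ?berk_ge0.
by move=> n; rewrite expr_div_n ler_pdivrMr ?exprn_gt0.
Qed.

Lemma berk_ms : mult_seminorm x.
Proof.
split; [exact: berk_ge0|exact: berk0|exact: berk1|exact: berkM|exact: berk_ultra].
Qed.

Lemma berk_lip f g : x f <= x g + bnorm B (f - g).
Proof.
rewrite -{1}(subrK g f) addrC; apply: le_trans (berkD _ _ _) _.
by rewrite lerD2l berk_le.
Qed.

End Ultrametric.

Local Notation A := (tate_alg k).

Lemma is_tate_poly (p : {poly k}) :
  is_tate (B := base_banach k) 1%:pos (fun i => p`_i).
Proof.
apply/is_tateP => e e0; exists (size p) => i hi.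
by rewrite nth_default//= nabs0 mul0r.
Qed.

Definition tpoly (p : {poly k}) : A := Tate (is_tate_poly p).

Lemma tpoly_zmod : zmod_morphism tpoly.
Proof. by move=> p q; apply: tateP => i; rewrite tcoefB /= coefB. Qed.
Lemma tpoly_monoid : monoid_morphism tpoly.
Proof.
split; first by apply: tateP => -[|i] /=; rewrite coef1.
by move=> p q; apply: tateP => i; rewrite tcoefM /= coefM.
Qed.

HB.instance Definition _ := GRing.isZmodMorphism.Build {poly k} A tpoly tpoly_zmod.
HB.instance Definition _ := GRing.isMonoidMorphism.Build {poly k} A tpoly tpoly_monoid.

Lemma tpolyM p q : tpoly (p * q) = tpoly p * tpoly q.
Proof. exact: rmorphM. Qed.

Lemma tpolyD p q : tpoly (p + q) = tpoly p + tpoly q.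
Proof. exact: rmorphD. Qed.

Lemma tpolyB p q : tpoly (p - q) = tpoly p - tpoly q.
Proof. exact: rmorphB. Qed.

Lemma tpolyXn p n : tpoly (p ^+ n) = tpoly p ^+ n.
Proof. exact: rmorphXn. Qed.

Lemma tpolyC c : tpoly c%:P = bconst A c.
Proof. by apply: tateP => -[|i] /=; rewrite coefC. Qed.

Lemma tpolyX : tpoly 'X = tvar (base_banach k) 1%:pos.
Proof. by apply: tateP => i /=; rewrite coefX. Qed.

Lemma tnorm_ub1 (f : A) i : nabs (tcoef f i) <= bnorm A f.
Proof. by have := tnorm_ub f i; rewrite expr1n mulr1. Qed.

Lemma tnorm_le1 (f : A) (M : R) : (forall i, nabs (tcoef f i) <= M) -> bnorm A f <= M.
Proof. by move=> h; apply: tnorm_le => i; rewrite expr1n mulr1 h. Qed.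

Lemma tpoly_dense (f : A) (e : R) : 0 < e -> exists p, bnorm A (f - tpoly p) < e.
Proof.
move=> e0; have e2 : 0 < e / 2 by rewrite divr_gt0.
have /is_tateP/(_ _ e2)[n hn] := tcoef_cvg f.
exists (\poly_(i < n) tcoef f i).
apply: (@le_lt_trans _ _ (e / 2)); last by rewrite ltr_pdivrMr// ltr_pMr// ltr1n.
apply: tnorm_le1 => i; rewrite tcoefB /= coef_poly.
case: ltnP => [_|ni]; first by rewrite subrr nabs0 ltW.
by rewrite subr0; have := hn _ ni; rewrite expr1n mulr1 => /ltW.
Qed.

Lemma tpoly_dense_eq (f : A) (e : R) : 0 < e ->
  exists p, bnorm A (f - tpoly p) < e /\ bnorm A (tpoly p) <= bnorm A f.
Proof.
move=> e0; have e2 : 0 < e / 2 by rewrite divr_gt0.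
have /is_tateP/(_ _ e2)[n hn] := tcoef_cvg f.
exists (\poly_(i < n) tcoef f i); split.
  apply: (@le_lt_trans _ _ (e / 2)); last by rewrite ltr_pdivrMr// ltr_pMr// ltr1n.
  apply: tnorm_le1 => i; rewrite tcoefB /= coef_poly.
  case: ltnP => [_|ni]; first by rewrite subrr nabs0 ltW.
  by rewrite subr0; have := hn _ ni; rewrite expr1n mulr1 => /ltW.
apply: tnorm_le1 => i /=; rewrite coef_poly; case: ifP => _; first exact: tnorm_ub1.
by rewrite nabs0; exact: (@bnorm_ge0 _ _ A f).
Qed.

Implicit Types x y z : disc k.

(* A point of the disc is determined by its values on polynomials, which are
   dense; this transfers non-strict inequalities. *)
Lemma disc_le_poly x y : (forall p, x (tpoly p) <= y (tpoly p)) -> disc_le x y.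
Proof.
move=> h f; apply/ler_addgt0Pr => e e0.
have e2 : 0 < e / 2 by rewrite divr_gt0.
have [p hp] := tpoly_dense f e2.
apply: le_trans (berk_lip x f (tpoly p)) _.
have := berk_lip y (tpoly p) f; have := h p; rewrite (bnorm_distC (tpoly p) f); lra.
Qed.

Lemma disc_eq_poly x y : (forall p, x (tpoly p) = y (tpoly p)) -> x = y.
Proof.
move=> h; apply: berkP => f; apply/le_anti/andP.
by split; apply: disc_le_poly => p; rewrite h.
Qed.

Lemma disc_le_anti x y : disc_le x y -> disc_le y x -> x = y.
Proof. by move=> h1 h2; apply: berkP => f; apply/le_anti; rewrite h1 h2. Qed.

Lemma disc_le_refl x : disc_le x x. Proof. by []. Qed.

Lemma disc_le_trans y x z : disc_le x y -> disc_le y z -> disc_le x z.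
Proof. by move=> h1 h2 f; exact: le_trans (h1 f) (h2 f). Qed.

Lemma disc_le_gauss x : disc_le x (gauss_pt k).
Proof. by move=> f; exact: berk_le. Qed.

(** These are exactly the restrictions to k[T] of the points of the disc, by [berk_ds] and
    [disc_of]. *)
Record disc_seminorm (N : {poly k} -> R) : Prop := DiscSeminorm {
  ds_ms :> mult_seminorm N;
  dsC : forall c, N c%:P = nabs c;
  dsX : N 'X <= 1
}.

Lemma berk_ds x : disc_seminorm (x \o tpoly).
Proof.
split.
- split => [p||||] /=; first exact: berk_ge0.
  + by rewrite rmorph0 berk0.
  + by rewrite rmorph1 berk1.
  + by move=> p q; rewrite rmorphM berkM.
  + by move=> p q; rewrite rmorphD berk_ultra.
- by move=> c /=; rewrite tpolyC berk_const.
- apply: le_trans (berk_le _ _) _; apply: tnorm_le1 => i /=.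
  by rewrite coefX; case: eqP => _; rewrite ?nabs1 ?nabs0.
Qed.

Section Extension.
Variables (N : {poly k} -> R) (hN : disc_seminorm N).

Lemma ds_le_tnorm p : N p <= bnorm A (tpoly p).
Proof.
rewrite -{1}[p]coefK poly_def; apply: (ms_sum hN) => [|i _]; first exact: bnorm_ge0.
rewrite -mul_polyC (msM hN) (dsC hN) (msX hN) -[leRHS]mulr1.
rewrite ler_pM ?nabs_ge0 ?exprn_ge0 ?(ms_ge0 hN)//; first exact: (tnorm_ub1 (tpoly p)).
by rewrite exprn_ile1 ?(ms_ge0 hN) ?(dsX hN).
Qed.

Lemma ds_lip p q : N p <= N q + bnorm A (tpoly p - tpoly q).
Proof.
rewrite -{1}(subrK q p) addrC (le_trans (msD hN _ _))// ge_max.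
rewrite lerDl bnorm_ge0/= -rmorphB.
by rewrite (le_trans (ds_le_tnorm _))// lerDr (ms_ge0 hN).
Qed.

(* The McShane extension of the 1-Lipschitz function N. *)
Definition ds_ext (f : A) : R := sup (range (fun p => N p - bnorm A (f - tpoly p))).

Lemma ds_ext_bounds f p :
  N p - bnorm A (f - tpoly p) <= ds_ext f <= N p + bnorm A (f - tpoly p).
Proof.
have ub q p' : N q - bnorm A (f - tpoly q) <= N p' + bnorm A (f - tpoly p').
  rewrite lerBlDr -addrA (le_trans (ds_lip q p'))// lerD2l.
  have -> : tpoly q - tpoly p' = (f - tpoly p') - (f - tpoly q).
    by rewrite opprB [RHS]addrC addrA subrK.
  apply: (le_trans (bnormD _ _)); rewrite bnormN ge_max.
  by rewrite lerDl lerDr !bnorm_ge0.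
apply/andP; split.
  apply: ub_le_sup; last by exists p.
  by exists (N p + bnorm A (f - tpoly p)) => _ [q _ <-].
apply: ge_sup; first by exists (N 0 - bnorm A (f - tpoly 0)); exists 0.
by move=> _ [q _ <-].
Qed.

Lemma ds_ext_approx f e : 0 < e -> exists p,
  [/\ bnorm A (f - tpoly p) < e, ds_ext f < N p + e, N p < ds_ext f + e &
      bnorm A (tpoly p) <= bnorm A f].
Proof.
move=> e0; have [p [hp hp2]] := tpoly_dense_eq f e0; exists p.
have /andP[h1 h2] := ds_ext_bounds f p; split=> //; lra.
Qed.

Lemma ds_ext_lim f (l : R) :
  (forall e, 0 < e -> exists p, bnorm A (f - tpoly p) <= e /\ `|N p - l| <= e) ->
  ds_ext f = l.
Proof.
move=> h; apply/eqP; rewrite -subr_eq0 -normr_le0.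
apply/ler_addgt0Pr => e e0; rewrite add0r.
have e2 : 0 < e / 2 by rewrite divr_gt0.
have [p [h1 h2]] := h _ e2.
have /andP[h3 h4] := ds_ext_bounds f p.
move: h2; rewrite !ler_norml => /andP[]; lra.
Qed.

Lemma ds_ext_poly p : ds_ext (tpoly p) = N p.
Proof.
by apply: ds_ext_lim => e e0; exists p; rewrite !subrr bnorm0 normr0 ltW.
Qed.

Lemma ds_ext_ge0 f : 0 <= ds_ext f.
Proof.
apply/ler_addgt0Pr => e e0; have [p [_ _ h _]] := ds_ext_approx f e0.
by apply: le_trans (ltW h); exact: (ms_ge0 hN).
Qed.

Lemma ds_ext_le f : ds_ext f <= bnorm A f.
Proof.
apply/ler_addgt0Pr => e e0; have [p [_ h _ h2]] := ds_ext_approx f e0.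
apply: (le_trans (ltW h)); rewrite lerD2r.
exact: le_trans (ds_le_tnorm _) h2.
Qed.

Lemma ds_extD f g : ds_ext (f + g) <= ds_ext f + ds_ext g.
Proof.
apply/ler_addgt0Pr => e e0; have e4 : 0 < e / 4 by rewrite divr_gt0.
have [p [p1 p2 p3 _]] := ds_ext_approx f e4.
have [q [q1 q2 q3 _]] := ds_ext_approx g e4.
have /andP[_ h] := ds_ext_bounds (f + g) (p + q).
have h2 : bnorm A (f + g - tpoly (p + q)) <= e / 4.
  by rewrite rmorphD opprD addrACA (le_trans (bnormD _ _))// ge_max !ltW.
have h3 := msD hN p q.
have h4 : Num.max (N p) (N q) <= N p + N q.
  by rewrite ge_max lerDl lerDr !(ms_ge0 hN).
by move: h h2 h3 h4 p3 q3; lra.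
Qed.

Lemma ds_extM f g : ds_ext (f * g) = ds_ext f * ds_ext g.
Proof.
apply: ds_ext_lim => e e0.
(* K bounds both factors with room to spare, so errors of at most d = e / (2 K) on each of them give
   at most e on the product. *)
pose K := 1 + bnorm A f + bnorm A g.
have nf := bnorm_ge0 f; have ng := bnorm_ge0 g.
have K0 : 0 < K by rewrite /K; lra.
pose d := e / (2 * K).
have d0 : 0 < d by rewrite divr_gt0// mulr_gt0.
have dK : d * (2 * K) = e by rewrite divfK// gt_eqF// mulr_gt0.
have [p [p1 p2 p3 p4]] := ds_ext_approx f d0.
have [q [q1 q2 q3 q4]] := ds_ext_approx g d0.
exists (p * q); split.
  have -> : f * g - tpoly (p * q) = (f - tpoly p) * g + tpoly p * (g - tpoly q).
    by rewrite rmorphM mulrBl mulrBr addrA subrK.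
  apply: (le_trans (bnormD _ _)); rewrite ge_max; apply/andP; split.
    apply: (le_trans (bnormM _ _)); apply: (@le_trans _ _ (d * K)); last by nra.
    by rewrite ler_pM ?bnorm_ge0 ?ltW// /K; lra.
  apply: (le_trans (bnormM _ _)); apply: (@le_trans _ _ (K * d)); last by nra.
  by rewrite ler_pM ?bnorm_ge0 ?ltW// (le_lt_trans p4)// /K; lra.
rewrite (msM hN).
have ef := ds_ext_le f; have eg := ds_ext_le g; have := ds_ext_ge0 f; have := ds_ext_ge0 g.
have np := ds_le_tnorm p; have nq := ds_le_tnorm q.
have := ms_ge0 hN p; have := ms_ge0 hN q.
have -> : N p * N q - ds_ext f * ds_ext g =
  (N p - ds_ext f) * N q + ds_ext f * (N q - ds_ext g).
  by rewrite mulrBl mulrBr addrA subrK.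
move=> nq0 np0 eg0 ef0.
apply: (le_trans (ler_normD _ _)); rewrite !normrM -dK.
have -> : d * (2 * K) = d * K + K * d by rewrite mulrCA mulr_natl mulr2n mulrC.
rewrite lerD// ler_pM//.
- by rewrite ler_norml; apply/andP; lra.
- by rewrite ger0_norm// (le_trans nq)// (le_trans q4)// /K; lra.
- by rewrite ger0_norm// /K; lra.
- by rewrite ler_norml; apply/andP; lra.
Qed.

Definition disc_of : disc k.
Proof.
refine (@Berk R k A ds_ext ds_ext_ge0 _ ds_extM ds_extD _ ds_ext_le).
- abstract (by rewrite -(rmorph1 tpoly) ds_ext_poly (ms1 hN)).
- abstract (by move=> a; rewrite -tpolyC ds_ext_poly (dsC hN)).
Defined.

Lemma disc_ofE p : disc_of (tpoly p) = N p.
Proof. exact: ds_ext_poly. Qed.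

End Extension.

End BerkSeminorm.

Section PointwiseTopology.

Lemma initial_cvg (S : choiceType) (T : topologicalType) (f : S -> T)
    (F : set_system S) (s : S) : Filter F ->
  f @ F --> f s -> F --> (s : initial_topology f).
Proof.
move=> FF h U; rewrite nbhsE => -[V [oV Vs] VU]; apply: filterS VU _.
have [W oW WV] := oV.
rewrite -WV; apply: h; apply: open_nbhs_nbhs; split => //.
by move: Vs; rewrite -WV.
Qed.

Variables (R : realType) (k : nafield R) (B : banachAlg k).

Lemma berk_eval_continuous (f : B) : continuous (fun x : berk B => x f).
Proof.
move=> x.
have h1 := @initial_continuous (berk B) {ptws B -> R} (fun x => (x : {ptws B -> R})) x.
have h2 := @proj_continuous {classic B} (fun _ => R : topologicalType) f
  (fun g => berk_val x g).
exact: (cvg_comp _ _ h1 h2).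
Qed.

Lemma berk_cvg (F : set_system (berk B)) (x : berk B) : Filter F ->
  (forall f, (fun y : berk B => y f) @ F --> x f) -> F --> x.
Proof.
move=> FF h; apply: (@initial_cvg _ {ptws B -> R}).
have FF' := fmap_filter (fun y : berk B => berk_val y : {ptws B -> R}) FF.
apply/cvg_sup => f; apply: (@initial_cvg _ R) => //.
exact: h.
Qed.

End PointwiseTopology.

(** * Paths to the Gauss point *)

Section Flow.
Variables (R : realType) (k : nafield R).
Local Notation "p ^`N ( n )" := (nderivn n p) : ring_scope.
Implicit Types (p q : {poly k}) (u v : disc k) (t s : R).

(* p(T + S) as a polynomial in S over k[T]; its coefficients are the divided
   derivatives of p. *)
Definition taylor_poly p : {poly {poly k}} := map_poly polyC p \Po ('X + ('X)%:P).

Lemma taylor_polyM p q : taylor_poly (p * q) = taylor_poly p * taylor_poly q.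
Proof. by rewrite /taylor_poly rmorphM/= comp_polyM. Qed.

Lemma taylor_polyD p q : taylor_poly (p + q) = taylor_poly p + taylor_poly q.
Proof. by rewrite /taylor_poly rmorphD/= comp_polyD. Qed.

Lemma taylor_polyC (c : k) : taylor_poly c%:P = c%:P%:P.
Proof. by rewrite /taylor_poly map_polyC/= comp_polyC. Qed.

Lemma taylor_polyX : taylor_poly 'X = 'X + ('X)%:P.
Proof. by rewrite /taylor_poly map_polyX/= comp_polyX. Qed.

Lemma coef_taylor_poly p i : (taylor_poly p)`_i = p^`N(i).
Proof.
elim/poly_ind: p i => [|p c ih] i.
  by rewrite /taylor_poly map_poly0 comp_poly0 coef0 linear0.
rewrite taylor_polyD taylor_polyM taylor_polyC taylor_polyX mulrDr.
case: i => [|i].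
  by rewrite !coefD coefMX/= coefMC coefC/= ih !nderivn0 add0r.
by rewrite !coefD coefMX/= coefMC coefC/= !ih nderivnMXaddC addr0.
Qed.

(** Coefficientwise both sides carry the multinomial coefficient (i + j + l)! / (i! j! l!). *)
Lemma nderivn_nderivn p i j : (p^`N(j))^`N(i) = p^`N(i + j) *+ 'C(i + j, i).
Proof.
apply/polyP => l; rewrite coefMn !coef_nderivn -!mulrnA addnA (addnC j i).
congr (_ *+ _).
have e1 : ('C(i + j + l, i + j) * (i + j)`! * l`! = (i + j + l)`!)%N.
  by rewrite -[RHS](@bin_fact _ (i + j)) ?leq_addr// addKn mulnA.
have e2 : ('C(i + j, i) * i`! * j`! = (i + j)`!)%N.
  by rewrite -[RHS](@bin_fact _ i) ?leq_addr// addKn mulnA.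
have e3 : ('C(i + l, i) * i`! * l`! = (i + l)`!)%N.
  by rewrite -[RHS](@bin_fact _ i) ?leq_addr// addKn mulnA.
have e4 : ('C(i + j + l, j) * j`! * (i + l)`! = (i + j + l)`!)%N.
  rewrite -[RHS](@bin_fact _ j); last by rewrite addnAC leq_addl.
  by rewrite addnAC addnK mulnA.
apply/eqP; rewrite -(@eqn_pmul2r (i`! * j`! * l`!)) ?muln_gt0 ?fact_gt0//.
apply/eqP; transitivity ((i + j + l)`!).
  rewrite -e4 -e3; lia.
rewrite -e1 -e2; lia.
Qed.

(** Geometrically, the supremum of p over the disc of radius t around the point N. *)
Definition flow_norm (N : {poly k} -> R) t p : R := gnorm N t (taylor_poly p).

Section FlowNorm.
Variables (N : {poly k} -> R) (hN : disc_seminorm N).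

Lemma flow_ub t p i : N (p^`N(i)) * t ^+ i <= flow_norm N t p.
Proof. by rewrite -coef_taylor_poly; exact: (gnorm_ub hN). Qed.

Lemma flow_le t p M : 0 <= M ->
  (forall i, N (p^`N(i)) * t ^+ i <= M) -> flow_norm N t p <= M.
Proof. by move=> M0 h; apply: gnorm_le => // i; rewrite coef_taylor_poly. Qed.

Lemma flow_norm_ms t : 0 <= t -> mult_seminorm (flow_norm N t).
Proof.
move=> t0; have hg := gnorm_ms hN t0; split.
- by move=> p; exact: (ms_ge0 hg).
- by rewrite /flow_norm taylor_polyC (ms0 hg).
- by rewrite /flow_norm taylor_polyC (ms1 hg).
- by move=> p q; rewrite /flow_norm taylor_polyM (msM hg).
- by move=> p q; rewrite /flow_norm taylor_polyD (msD hg).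
Qed.

Lemma flow_ds t : 0 <= t <= 1 -> disc_seminorm (flow_norm N t).
Proof.
move=> /andP[t0 t1]; split.
- exact: flow_norm_ms.
- by move=> c; rewrite /flow_norm taylor_polyC (gnormC hN)// (dsC hN).
- rewrite /flow_norm taylor_polyX (le_trans (gnormD hN t0 _ _))// ge_max.
  rewrite (gnormC hN)// (dsX hN) andbT; apply: gnorm_le => // i.
  by rewrite coefX; case: eqP => [->|_]; rewrite ?(ms1 hN) ?mul1r// (ms0 hN) mul0r.
Qed.

Lemma taylor_poly_linear a : taylor_poly ('X - a%:P) = 'X + ('X - a%:P)%:P.
Proof. by rewrite -polyCN taylor_polyD taylor_polyX taylor_polyC -addrA -polyCD. Qed.

Lemma flow_linear t a : 0 <= t -> flow_norm N t ('X - a%:P) = Num.max (N ('X - a%:P)) t.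
Proof.
move=> t0; rewrite /flow_norm taylor_poly_linear; apply/le_anti/andP; split.
  apply: gnorm_le => [|[|[|i]]]; first by rewrite le_max t0 orbT.
  - by rewrite coefD coefX coefC/= add0r mulr1 le_max lexx.
  - by rewrite coefD coefX coefC/= addr0 (ms1 hN) mul1r le_max lexx orbT.
  - by rewrite coefD coefX coefC/= addr0 (ms0 hN) mul0r le_max t0 orbT.
have h0 := gnorm_ub hN t ('X + ('X - a%:P)%:P) 0.
have h1 := gnorm_ub hN t ('X + ('X - a%:P)%:P) 1.
rewrite ge_max; apply/andP; split.
  by move: h0; rewrite coefD coefX coefC/= add0r mulr1.
by move: h1; rewrite coefD coefX coefC/= addr0 (ms1 hN) mul1r.
Qed.

Lemma nderivn_shift p a j :
  (p \Po ('X - a%:P))^`N(j) = p^`N(j) \Po ('X - a%:P).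
Proof.
elim/poly_ind: p j => [|p c ih] j; first by rewrite !(comp_poly0, linear0).
rewrite comp_polyD comp_polyM comp_polyX comp_polyC.
case: j => [|j].
  by rewrite !nderivn0 comp_polyD comp_polyM comp_polyX comp_polyC.
rewrite nderivnMXaddC comp_polyD comp_polyM comp_polyX -!ih.
set f := p \Po _.
have -> : f * ('X - a%:P) + c%:P = (f * 'X + c%:P) - a *: f.
  by rewrite mulrBr addrAC (mulrC f a%:P) mul_polyC.
rewrite nderivnB nderivnZ nderivnMXaddC mulrBr addrA.
by rewrite (mulrC _ a%:P) mul_polyC.
Qed.

(* Seen from the largest index where |p_i| t^i is maximal, p^`N(i) is dominated
   by its constant term at a. *)
Lemma flow_center t a p : 0 <= t -> N ('X - a%:P) <= t ->
  flow_norm N t p = gnorm (@nabs R k) t (p \Po ('X + a%:P)).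
Proof.
move=> t0 Nat; set q := p \Po _.
have hk := nabs_ms k.
have pE : p = q \Po ('X - a%:P).
  by rewrite /q -comp_polyA comp_polyD comp_polyX comp_polyC subrK comp_polyXr.
apply/le_anti/andP; split.
  apply: flow_le => [|j]; first exact: gnorm_ge0.
  have [t_0|tp] := eqVneq t 0.
    have [->|j0] := eqVneq j 0%N; last by rewrite t_0 expr0n (negbTE j0) mulr0 gnorm_ge0.
    rewrite mulr1 nderivn0 pE comp_polyE.
    apply: (ms_sum hN) => [|i _]; first exact: gnorm_ge0.
    rewrite -mul_polyC (msM hN) (dsC hN) (msX hN).
    rewrite (le_trans _ (gnorm_ub hk t q i))// ler_wpM2l ?nabs_ge0//.
    by rewrite lerXn2r ?nnegrE ?(ms_ge0 hN).
  have tj : 0 < t ^+ j by rewrite exprn_gt0// lt_def tp.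
  rewrite -ler_pdivlMr// pE nderivn_shift comp_polyE.
  apply: (ms_sum hN) => [|i _]; first by rewrite divr_ge0 ?gnorm_ge0// ltW.
  rewrite ler_pdivlMr// -mul_polyC (msM hN) (dsC hN) (msX hN) coef_nderivn.
  rewrite (le_trans _ (gnorm_ub hk t q (j + i)))//.
  rewrite -mulr_natr nabsM exprD (mulrC (t ^+ j)) mulrA ler_wpM2r ?(ltW tj)//.
  rewrite -mulrA ler_wpM2l ?nabs_ge0// -[leRHS]mul1r ler_pM ?nabs_ge0//.
  - by rewrite exprn_ge0 ?(ms_ge0 hN).
  - exact: (ms_natr_le1 hk).
  - by rewrite lerXn2r ?nnegrE ?(ms_ge0 hN).
have [g0|gp] := leP (gnorm (@nabs R k) t q) 0.
  by apply: le_trans g0 _; exact: gnorm_ge0.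
pose M := gnorm (@nabs R k) t q.
pose good i := nabs q`_i * t ^+ i == M.
have ex : exists i, good i by have [i [/eqP hi _]] := gnorm_max hk t0 gp; exists i.
have bd i : good i -> (i <= size q)%N.
  move=> /eqP hi; rewrite leqNgt; apply/negP => si.
  by move: gp; rewrite -/M -hi nth_default ?(ltnW si)// nabs0 mul0r ltxx.
have [j /eqP hj jmax] := ex_maxnP ex bd.
have tj : 0 < t ^+ j.
  rewrite lt_def exprn_ge0// andbT; apply: contraTneq gp => tj0.
  by rewrite -/M -hj tj0 mulr0 ltxx.
rewrite -/M -hj; apply: le_trans (flow_ub _ _ j); rewrite ler_wpM2r ?(ltW tj)//.
have qj0 : 0 < nabs q`_j by rewrite -(pmulr_lgt0 _ tj) hj.
rewrite pE nderivn_shift comp_polyE.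
have [s0|sp] := posnP (size q^`N(j)).
  have : q^`N(j)`_0 = 0 by rewrite nth_default// s0.
  by rewrite coef_nderivn addn0 binn mulr1n => h; rewrite h nabs0 ltxx in qj0.
rewrite -(prednK sp) big_ord_recl /= expr0 coef_nderivn addn0 binn mulr1n.
have e : N (q`_j *: 1) = nabs q`_j by rewrite -mul_polyC mulr1 (dsC hN).
rewrite (msD_eq hN) ?e//; apply: (ms_sum_lt hN) => // i _.
rewrite /bump add1n coef_nderivn -mul_polyC (msM hN) (dsC hN) (msX hN).
rewrite -(ltr_pM2r tj) hj.
apply: (@le_lt_trans _ _ (nabs q`_(j + i.+1) * t ^+ (j + i.+1))).
  rewrite -mulr_natr nabsM exprD (mulrC (t ^+ j)) mulrA ler_wpM2r ?(ltW tj)//.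
  rewrite -mulrA ler_wpM2l ?nabs_ge0// -[leRHS]mul1r ler_pM ?nabs_ge0//.
  - by rewrite exprn_ge0 ?(ms_ge0 hN).
  - exact: (ms_natr_le1 hk).
  - by rewrite lerXn2r ?nnegrE ?(ms_ge0 hN).
rewrite lt_neqAle (gnorm_ub hk) andbT; apply/negP => /jmax.
by rewrite leqNgt addnS ltnS leq_addr.
Qed.

End FlowNorm.

(** Composing divided derivatives only costs binomial coefficients, of absolute value at most 1.
    Conversely, it suffices to keep the derivatives attached to the larger of s and t. *)
Lemma flow_norm_flow_norm (N : {poly k} -> R) (hN : disc_seminorm N) t s p : 0 <= t -> 0 <= s ->
  flow_norm (flow_norm N s) t p = flow_norm N (Num.max s t) p.
Proof.
move=> t0 s0; have m0 : 0 <= Num.max s t by rewrite le_max s0.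
apply/le_anti/andP; split.
  apply: flow_le => [|j]; first exact: gnorm_ge0.
  have [->|tj] := eqVneq (t ^+ j) 0; first by rewrite mulr0; exact: gnorm_ge0.
  have tjp : 0 < t ^+ j by rewrite lt_def tj exprn_ge0.
  rewrite -ler_pdivlMr//; apply: flow_le => [|i].
    by apply: divr_ge0; [exact: gnorm_ge0|exact: ltW].
  rewrite ler_pdivlMr// nderivn_nderivn -mulr_natr (msM hN) -polyC_natr (dsC hN).
  apply: le_trans (flow_ub hN _ _ (i + j)); rewrite exprD -!mulrA ler_wpM2l ?(ms_ge0 hN)//.
  rewrite -[leRHS]mul1r ler_pM ?nabs_ge0 ?mulr_ge0 ?exprn_ge0//.
    exact: (ms_natr_le1 (nabs_ms k)).
  by rewrite ler_pM ?exprn_ge0// lerXn2r ?nnegrE// le_max lexx ?orbT.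
have ubt q i : flow_norm N s (q^`N(i)) * t ^+ i <= flow_norm (flow_norm N s) t q.
  rewrite /(flow_norm (flow_norm N s)) -coef_taylor_poly.
  exact: (gnorm_ub (flow_norm_ms hN s0)).
have [st|ts] := leP s t.
  apply: flow_le => [|j]; first exact: gnorm_ge0.
  apply: le_trans (ubt _ j); rewrite ler_wpM2r ?exprn_ge0//.
  by have := flow_ub hN s (p^`N(j)) 0; rewrite nderivn0 mulr1.
by have := ubt p 0; rewrite nderivn0 mulr1.
Qed.

Definition clip01 t : R := Num.max 0 (Num.min t 1).

Lemma clip01_itv t : 0 <= clip01 t <= 1.
Proof. by rewrite le_max lexx/= ge_max ler01 ge_min lexx orbT. Qed.

Lemma clip01E t : 0 <= t <= 1 -> clip01 t = t.
Proof. by move=> /andP[t0 t1]; rewrite /clip01 (min_idPl t1) (max_idPr t0). Qed.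

Lemma clip01_le t s : t <= s -> clip01 t <= clip01 s.
Proof. by move=> ts; rewrite ge_max le_max lexx/= le_max le_min !ge_min ts lexx !orbT. Qed.

(* The point at height t on the path from u to the Gauss point; t is clipped to
   [0, 1]. *)
Definition flow u t : disc k := disc_of (flow_ds (berk_ds u) (clip01_itv t)).

Arguments flow : simpl never.

Lemma flowE u t p : 0 <= t <= 1 -> flow u t (tpoly p) = flow_norm (u \o @tpoly R k) t p.
Proof. by move=> t01; rewrite /flow disc_ofE clip01E. Qed.

Lemma flow_clip u t : flow u (clip01 t) = flow u t.
Proof.
apply: disc_eq_poly => p; rewrite flowE ?clip01_itv//.
by rewrite /flow disc_ofE.
Qed.

Lemma flow0 u : flow u 0 = u.
Proof.
apply: disc_eq_poly => p; rewrite flowE ?lexx ?ler01//.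
apply/le_anti/andP; split.
  apply: flow_le => [|[|i]]; first exact: berk_ge0.
    by rewrite nderivn0 mulr1.
  by rewrite expr0n mulr0; exact: berk_ge0.
by have := flow_ub (berk_ds u) 0 p 0; rewrite nderivn0 mulr1.
Qed.

Lemma flow_ge u t : disc_le u (flow u t).
Proof.
apply: disc_le_poly => p; rewrite -flow_clip flowE ?clip01_itv//.
by have := flow_ub (berk_ds u) (clip01 t) p 0; rewrite nderivn0 mulr1.
Qed.

Lemma flow_mono u v t s : disc_le u v -> t <= s -> disc_le (flow u t) (flow v s).
Proof.
move=> uv ts; rewrite -(flow_clip u) -(flow_clip v).
have /andP[t0 _] := clip01_itv t; have /andP[s0 _] := clip01_itv s.
apply: disc_le_poly => p; rewrite !flowE ?clip01_itv//.
apply: flow_le => [|i]; first exact: gnorm_ge0.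
apply: le_trans (flow_ub (berk_ds v) _ _ i).
rewrite ler_pM ?exprn_ge0//; [exact: berk_ge0|exact: uv|].
by rewrite lerXn2r ?nnegrE// clip01_le.
Qed.

Lemma flow_flow u s t : 0 <= t <= 1 -> 0 <= s <= 1 ->
  flow (flow u s) t = flow u (Num.max s t).
Proof.
move=> /andP[t0 t1] /andP[s0 s1]; apply: disc_eq_poly => p.
rewrite !flowE ?t0 ?le_max ?t0 ?ge_max ?s1 ?orbT//.
rewrite -(flow_norm_flow_norm (berk_ds u))//; apply: eq_gnorm => q.
by apply: flowE; rewrite s0.
Qed.

Lemma flow_lin u t a : 0 <= t <= 1 ->
  flow u t (tpoly ('X - a%:P)) = Num.max (u (tpoly ('X - a%:P))) t.
Proof. by move=> t01; rewrite flowE// (flow_linear (berk_ds u))//; case/andP: t01. Qed.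

(** By [flow_center] both sides are the Gauss norm of weight t centred at a, in which u and v no
    longer appear. *)
Lemma flow_centered u v a t : 0 <= t <= 1 ->
  u (tpoly ('X - a%:P)) <= t -> v (tpoly ('X - a%:P)) <= t -> flow u t = flow v t.
Proof.
move=> t01 hu hv; apply: disc_eq_poly => p; rewrite !flowE//.
have /andP[t0 _] := t01.
by rewrite (flow_center (berk_ds u) _ t0 hu) (flow_center (berk_ds v) _ t0 hv).
Qed.

Lemma le_flow_centered u v a t : 0 <= t <= 1 ->
  u (tpoly ('X - a%:P)) <= t -> v (tpoly ('X - a%:P)) <= t -> disc_le u (flow v t).
Proof.
by move=> t01 hu hv; rewrite -(flow_centered t01 hu hv); exact: flow_ge.
Qed.

Lemma flow1 u : flow u 1 = gauss_pt k.
Proof.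
have t01 : 0 <= (1 : R) <= 1 by rewrite ler01 lexx.
have h v : v (tpoly ('X - (0 : k)%:P)) <= 1.
  by rewrite subr0; exact: (dsX (berk_ds v)).
apply: disc_le_anti; first exact: disc_le_gauss.
rewrite (flow_centered t01 (h u) (h (gauss_pt k))); exact: flow_ge.
Qed.

End Flow.

(** * The tree structure *)

Section MacLane.
Variables (R : realType) (k : nafield R).
Implicit Types (p q c g : {poly k}) (u v w x y z : disc k) (t s : R).
Local Notation "u $ p" := (berk_val u (tpoly p)) (at level 11).
Local Notation "p ^`N ( n )" := (nderivn n p) : ring_scope.

Section MinDegree.
Variables (v u : disc k) (q : {poly k}).
Hypotheses (vu : disc_le v u) (vq : v $ q < u $ q).
Hypothesis qmin : forall p, (size p < size q)%N -> u $ p <= v $ p.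

(* If q has minimal degree among the polynomials on which v < u, then in a
   q-expansion no cancellation can occur for u: it would force v(q) = u(q). *)
Lemma maclane_expansion c g : (size c < size q)%N ->
  u $ c <= u $ (c + g * q) /\ u $ q * u $ g <= u $ (c + g * q).
Proof.
move=> cq; have hu := berk_ms u; have hv := berk_ms v.
have uq0 : 0 < u $ q by apply: le_lt_trans vq; exact: berk_ge0.
have cv : u $ c = v $ c by apply/le_anti; rewrite qmin//= vu.
rewrite rmorphD rmorphM; set a := tpoly c in cv *; set b := tpoly g * tpoly q.
have ub : u b = u (tpoly g) * u $ q by rewrite berkM.
have vb : v b = v (tpoly g) * v $ q by rewrite berkM.
have bE : b = - a + (a + b) by rewrite addKr.
have ce : u a <= u (a + b).
  rewrite leNgt; apply/negP => lt1.
  have e1 : u b = u a by rewrite bE (msD_eq hu) (msN hu).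
  have e2 : v b = v a.
    rewrite bE (msD_eq hv) (msN hv)// -cv; apply: le_lt_trans lt1; exact: vu.
  have cp : 0 < u a by apply: le_lt_trans lt1; exact: berk_ge0.
  have g0 : 0 < u (tpoly g).
    rewrite lt_def berk_ge0 andbT; apply: contraTneq cp => g0.
    by rewrite -e1 ub g0 mul0r ltxx.
  have : v b < u b.
    rewrite ub vb; apply: (@le_lt_trans _ _ (u (tpoly g) * v $ q)).
      by rewrite ler_wpM2r ?berk_ge0.
    by rewrite ltr_pM2l.
  by rewrite e1 e2 cv ltxx.
split=> //; rewrite mulrC -ub {1}bE.
apply: le_trans (msD hu _ _) _; by rewrite (msN hu) ge_max lexx andbT.
Qed.

(** Divide f by q and induct on the degree: the remainder is controlled by the first hypothesis, the
    quotient by induction, and [maclane_expansion] says that for u neither part exceeds the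
    whole. *)
Lemma maclane_le w : (forall c, (size c < size q)%N -> w $ c <= v $ c) ->
  w $ q <= u $ q -> disc_le w u.
Proof.
move=> wv wq; apply: disc_le_poly => f.
have q0 : q != 0.
  apply: contraTneq vq => ->; rewrite rmorph0 !berk0 ltxx //.
have [n] := ubnP (size f); elim: n f => // n ih f; rewrite ltnS => fn.
have sm := ltn_modp f q; rewrite q0 in sm.
have [h1 h2] := maclane_expansion (f %/ q) sm.
rewrite addrC -divp_eq in h1 h2.
rewrite {1}(divp_eq f q) addrC rmorphD.
apply: le_trans (berk_ultra _ _ _) _; rewrite ge_max; apply/andP; split.
  by apply: le_trans h1; apply: le_trans (wv _ sm) _; exact: vu.
rewrite rmorphM berkM mulrC; apply: le_trans h2.
have [fq0|fq] := eqVneq (f %/ q) 0.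
  by rewrite fq0 !rmorph0 !berk0 !mulr0.
rewrite ler_pM ?berk_ge0//.
have [sq|sq] := leqP (size q) 1.
  have /eqP sq1 : size q == 1%N by rewrite eqn_leq sq lt0n size_poly_eq0.
  have /size_poly1P[a a0 qa] : size q == 1%N by rewrite sq1.
  by move: vq; rewrite qa !tpolyC !berk_const ltxx.
apply: ih; apply: leq_trans fn.
rewrite size_divp// ltn_subrL; apply/andP; split; first by rewrite -subn1 subn_gt0.
rewrite lt0n size_poly_eq0; apply: contraNneq fq => ->.
by rewrite div0p.
Qed.

End MinDegree.

Lemma min_degree_separating v u : ~ disc_le u v -> exists2 q,
  v $ q < u $ q & forall p, (size p < size q)%N -> u $ p <= v $ p.
Proof.
move=> nuv.
have [p0 hp0] : exists p, v $ p < u $ p.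
  apply: contrapT => /forallNP h; apply: nuv; apply: disc_le_poly => p.
  by rewrite leNgt; apply/negP/h.
pose Pn n := `[< exists2 p : {poly k}, size p = n & v $ p < u $ p >].
have ex : exists n, Pn n by exists (size p0); apply/asboolP; exists p0.
have [n /asboolP[q sq hq] nmin] := ex_minnP ex.
exists q => // p; rewrite sq => pn; rewrite leNgt; apply/negP => h.
have : Pn (size p) by apply/asboolP; exists p.
by move=> /nmin; rewrite leqNgt pn.
Qed.

(** This is what makes X a tree. Take polynomials q and r of minimal degree that separate v from u
    and from w: the one of smaller degree decides which of u and w is smaller, and if the degrees
    agree the values of u and w at q do. *)
Lemma disc_le_total v u w : disc_le v u -> disc_le v w -> disc_le u w \/ disc_le w u.
Proof.
move=> vu vw.
have [uv|nuv] := pselect (disc_le u v); first by left; exact: disc_le_trans vw.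
have [wv|nwv] := pselect (disc_le w v); first by right; exact: disc_le_trans vu.
have [q hq qmin] := min_degree_separating nuv.
have [r hr rmin] := min_degree_separating nwv.
have [qr|rq|qr] := ltngtP (size q) (size r).
- right; apply: (maclane_le vu hq qmin) => [c cq|].
    by apply: rmin; exact: ltn_trans qr.
  by apply: le_trans (ltW hq); exact: rmin.
- left; apply: (maclane_le vw hr rmin) => [c cr|].
    by apply: qmin; exact: ltn_trans rq.
  by apply: le_trans (ltW hr); exact: qmin.
- have [wu|uw] := leP (w $ q) (u $ q).
    right; apply: (maclane_le vu hq qmin) => // c cq.
    by apply: rmin; rewrite -qr.
  left; apply: (maclane_le vw (lt_trans hq uw)) => [p pq||]; last exact: ltW.
    by apply: rmin; rewrite -qr.
  by move=> c cq; exact: qmin.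
Qed.

Lemma expr_lip s t n : 0 <= s -> s <= t -> t <= 1 -> t ^+ n - s ^+ n <= n%:R * (t - s).
Proof.
move=> s0 st t1; elim: n => [|n ih]; first by rewrite !expr0 subrr mul0r.
have tn : t ^+ n <= 1 by rewrite exprn_ile1// (le_trans s0).
have s1 : s <= 1 by exact: le_trans t1.
have tsn : s ^+ n <= t ^+ n by rewrite lerXn2r ?nnegrE// (le_trans s0).
have n0 : (0 : R) <= n%:R by [].
rewrite !exprS -natr1; move: ih tn tsn n0; set a := t ^+ n; set b := s ^+ n.
have b0 : 0 <= b by rewrite exprn_ge0.
set m := n%:R => *; nra.
Qed.

Lemma nderivn_tnorm p i : bnorm (tate_alg k) (tpoly (p^`N(i))) <= bnorm (tate_alg k) (tpoly p).
Proof.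
apply: tnorm_le1 => j /=; rewrite coef_nderivn -mulr_natr nabsM -[leRHS]mulr1.
by rewrite ler_pM ?nabs_ge0//; [exact: (tnorm_ub1 (tpoly p))|exact: (ms_natr_le1 (nabs_ms k))].
Qed.

Lemma flow_lip u p s t : 0 <= s -> s <= t -> t <= 1 ->
  (flow u t) $ p <= (flow u s) $ p + bnorm (tate_alg k) (tpoly p) * (size p)%:R * (t - s).
Proof.
move=> s0 st t1; rewrite !flowE ?s0 ?t1 ?(le_trans s0)//= ?(le_trans st)//.
have ts0 : 0 <= t - s by rewrite subr_ge0.
have hN := berk_ds u; set N := _ \o _ in hN *.
have nn := @bnorm_ge0 _ _ _ (tpoly p).
apply: flow_le => [|i].
  by apply: addr_ge0; [exact: gnorm_ge0|rewrite !mulr_ge0].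
have [ip|pi] := ltnP i (size p); last first.
  rewrite nderivn_poly0// (ms0 hN) mul0r.
  by apply: addr_ge0; [exact: gnorm_ge0|rewrite !mulr_ge0].
rewrite -{1}(subrK (s ^+ i) (t ^+ i)) mulrDr addrC lerD//; first exact: (flow_ub hN).
rewrite -mulrA ler_pM ?(ms_ge0 hN)//.
- by rewrite subr_ge0 lerXn2r ?nnegrE// (le_trans s0).
- by apply: le_trans (ds_le_tnorm hN _) _; exact: nderivn_tnorm.
- by rewrite (le_trans (expr_lip _ s0 st t1))// ler_wpM2r// ler_nat ltnW.
Qed.

Lemma flow_unif u f (e : R) : 0 < e -> exists2 d, 0 < d & forall s t : R,
  0 <= s <= 1 -> 0 <= t <= 1 -> `|t - s| < d -> `|flow u t f - flow u s f| < e.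
Proof.
move=> e0; have e4 : 0 < e / 4 by rewrite divr_gt0.
have [p hp] := tpoly_dense f e4.
pose K := bnorm (tate_alg k) (tpoly p) * (size p)%:R + 1.
have K0 : 0 < K.
  by rewrite ltr_wpDl// mulr_ge0// bnorm_ge0.
exists (e / 4 / K); first by rewrite divr_gt0.
have key s t : 0 <= s -> s <= t -> t <= 1 -> t - s < e / 4 / K ->
  flow u t f - flow u s f < e.
  move=> s0 st t1 d.
  have h1 := berk_lip (flow u t) f (tpoly p).
  have h2 := berk_lip (flow u s) (tpoly p) f.
  rewrite (bnorm_distC (tpoly p) f) in h2.
  have h3 := flow_lip u p s0 st t1.
  have h4 : bnorm (tate_alg k) (tpoly p) * (size p)%:R * (t - s) <= e / 4.
    apply: (@le_trans _ _ (K * (t - s))).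
      by rewrite ler_wpM2r ?subr_ge0// lerDl.
    by rewrite mulrC -ler_pdivlMr// ltW.
  lra.
move=> s t /andP[s0 s1] /andP[t0 t1] d.
have [st|ts] := leP s t.
  have h := flow_mono (disc_le_refl u) st f.
  by rewrite ger0_norm ?subr_ge0// key//; apply: le_lt_trans (ler_norm _) d.
have h := flow_mono (disc_le_refl u) (ltW ts) f.
rewrite ler0_norm ?subr_le0// opprB key ?(ltW ts)//.
by rewrite distrC in d; apply: le_lt_trans (ler_norm _) d.
Qed.

Lemma flow_le_closed u w t0 : 0 <= t0 <= 1 ->
  (forall d, 0 < d -> exists t, [/\ 0 <= t <= 1, `|t - t0| < d & disc_le (flow u t) w]) ->
  disc_le (flow u t0) w.
Proof.
move=> t01 h f; apply/ler_addgt0Pr => e e0.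
have [d d0 hd] := flow_unif u f e0.
have [t [t1 td tw]] := h _ d0.
have /ltr_normlP[] := hd _ _ t01 t1 td; have := tw f; lra.
Qed.

Lemma flow_ge_closed u w t0 : 0 <= t0 <= 1 ->
  (forall d, 0 < d -> exists t, [/\ 0 <= t <= 1, `|t - t0| < d & disc_le w (flow u t)]) ->
  disc_le w (flow u t0).
Proof.
move=> t01 h f; apply/ler_addgt0Pr => e e0.
have [d d0 hd] := flow_unif u f e0.
have [t [t1 td tw]] := h _ d0.
have /ltr_normlP[] := hd _ _ t01 t1 td; have := tw f; lra.
Qed.

(** The point w is reached at the supremum of the t with flow u t <= w: for larger t the flow is not
    below w, hence above it by [disc_le_total], and continuity in t closes the gap. *)
Lemma disc_above u w : disc_le u w -> exists2 t, 0 <= t <= 1 & w = flow u t.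
Proof.
move=> uw; pose T := [set t : R | 0 <= t <= 1 /\ disc_le (flow u t) w].
have T0 : T 0 by split; rewrite ?lexx ?ler01// flow0.
have supT : has_sup T.
  by split; [exists 0|exists 1 => t [/andP[]]].
have t01 : 0 <= sup T <= 1.
  apply/andP; split; first by apply: ub_le_sup => //; case: supT.
  by apply: ge_sup; [exists 0|move=> t [/andP[]]].
exists (sup T) => //; apply: disc_le_anti; last first.
  apply: flow_le_closed => // d d0.
  have [t Tt td] := sup_adherent d0 supT; have [t1 tw] := Tt.
  exists t; split=> //; have ts : t <= sup T by apply: ub_le_sup => //; case: supT.
  by rewrite ler0_norm ?subr_le0//; lra.
have [->|ne1] := eqVneq (sup T) 1; first by rewrite flow1; exact: disc_le_gauss.
have lt1 : sup T < 1 by rewrite lt_neqAle ne1; case/andP: t01.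
have /andP[s0 _] := t01.
apply: flow_ge_closed => // d d0.
pose m := Num.min (d / 2) (1 - sup T).
have m0 : 0 < m by rewrite lt_min divr_gt0//= subr_gt0.
have md : m <= d / 2 by rewrite ge_min lexx.
have m1 : m <= 1 - sup T by rewrite ge_min lexx orbT.
have mt1 : 0 <= sup T + m <= 1 by apply/andP; split; lra.
exists (sup T + m); split=> //.
  by rewrite addrAC subrr add0r gtr0_norm//; lra.
have [//|h] := disc_le_total uw (flow_ge u (sup T + m)).
have : sup T + m <= sup T by apply: ub_le_sup => //; case: supT.
by rewrite gerDl leNgt m0.
Qed.

End MacLane.

(** * Uniqueness of the extension of the absolute value to k[T]/p *)

Section UniqueExtension.
Variables (R : realType) (k : nafield R).
Implicit Types (p q c g : {poly k}) (u v e z : disc k).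
Local Notation A := (tate_alg k).

Lemma ltr_power_bounded (a b C : R) : 0 <= a -> 0 <= b -> 0 <= C ->
  (forall n, a ^+ n <= C * b ^+ n) -> a <= b.
Proof.
move=> a0 b0 C0 h.
have [b_0|bn] := eqVneq b 0.
  by have := h 1%N; rewrite !expr1 b_0 mulr0.
have bp : 0 < b by rewrite lt_def bn.
rewrite leNgt; apply/negP => ab.
pose q := a / b.
have q1 : 0 < q - 1 by rewrite subr_gt0 ltr_pdivlMr ?mul1r.
have qn n : q ^+ n <= C by rewrite expr_div_n ler_pdivrMr ?exprn_gt0.
have bern n : 1 + n%:R * (q - 1) <= q ^+ n.
  elim: n => [|n ih]; first by rewrite mul0r addr0.
  have -> : q ^+ n.+1 = q ^+ n + (q - 1) * q ^+ n.
    by rewrite exprS mulrBl mul1r addrC subrK.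
  rewrite -natr1 mulrDl mul1r addrA lerD// -[leLHS]mulr1 ler_wpM2l ?(ltW q1)//.
  by rewrite exprn_ege1// -subr_ge0 ltW.
have := le_trans (bern (Num.bound (C / (q - 1)))) (qn _).
have := archi_boundP (divr_ge0 C0 (ltW q1)); rewrite ltr_pdivrMr//; lra.
Qed.

Section NormEquivalence.
Variables (N : {poly k} -> R) (hN : disc_seminorm N).

(** Otherwise some 'X^j + q n tend to 0 for N. By equivalence in degree below j the q n form a
    Cauchy sequence for the norm of A, and their limit r satisfies N ('X^j + r) = 0. *)
Lemma norm_equiv_step j : (forall q, q != 0 -> (size q <= j.+1)%N -> N q != 0) ->
  (exists2 C, 0 < C & forall q, (size q <= j)%N -> bnorm A (tpoly q) <= C * N q) ->
  exists2 d, 0 < d & forall q, (size q <= j)%N -> d <= N ('X^j + q).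
Proof.
move=> nz [C C0 hC]; apply: contrapT => hn.
have /choice[q hq] : forall n : nat, exists q, (size q <= j)%N /\ N ('X^j + q) < n.+1%:R^-1.
  move=> n; apply: contrapT => /forallNP h; apply: hn; exists n.+1%:R^-1 => // q qj.
  by rewrite leNgt; apply/negP => lt1; apply: (h q).
have eps (e : R) : 0 < e -> exists n0 : nat, forall n, (n0 <= n)%N -> n.+1%:R^-1 < e.
  move=> e0; exists (Num.bound e^-1) => n hn0.
  rewrite invf_plt ?posrE// (lt_le_trans (archi_boundP _)) ?invr_ge0 ?(ltW e0)//.
  by rewrite ler_nat ltnW.
have szB n m : (size (q n - q m)%R <= j)%N.
  by rewrite (leq_trans (size_polyD _ _))// size_polyN geq_max !(hq _).1.
have diff n m : bnorm A (tpoly (q n) - tpoly (q m)) <= C * Num.max (N ('X^j + q n)) (N ('X^j + q m)).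
  rewrite -rmorphB (le_trans (hC _ (szB _ _)))// ler_wpM2l ?(ltW C0)//.
  have -> : q n - q m = ('X^j + q n) - ('X^j + q m) by rewrite opprD addrACA subrr add0r.
  exact: (msB_le hN).
have [l hl] : exists l : A, forall e : R, 0 < e -> exists n0, forall n, (n0 <= n)%N ->
    bnorm A (tpoly (q n) - l) < e.
  apply: bnorm_complete => e e0.
  have [n0 hn0] := eps _ (divr_gt0 e0 C0); exists n0 => m n hm hn'.
  apply: (le_lt_trans (diff _ _)); rewrite mulrC -ltr_pdivlMr// gt_max.
  by rewrite (lt_trans (hq _).2) ?hn0// (lt_trans (hq _).2) ?hn0.
pose r : {poly k} := \poly_(i < j) tcoef l i.
have lr : l = tpoly r.
  apply: tateP => i /=; rewrite coef_poly; case: ltnP => // ji.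
  apply/eqP; rewrite -nabs_eq0 -[_ == _]/(_ == 0); apply/eqP/le_anti.
  rewrite nabs_ge0 andbT; apply/ler_addgt0Pr => e e0; rewrite add0r.
  have [n0 hn0] := hl _ e0.
  have := le_lt_trans (tnorm_ub1 _ i) (hn0 _ (leqnn _)).
  rewrite tcoefB /= nth_default ?(leq_trans (hq _).1)// sub0r.
  by rewrite (msN (nabs_ms k)) => /ltW.
have sr : (size r <= j)%N by rewrite size_poly.
have : N ('X^j + r) != 0.
  apply: nz; last by rewrite size_polyDl ?size_polyXn// ltnS.
  by rewrite -size_poly_eq0 size_polyDl ?size_polyXn// ltnS.
apply/negP; rewrite negbK; apply/eqP/le_anti; rewrite (ms_ge0 hN) andbT.
apply/ler_addgt0Pr => e e0; rewrite add0r.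
have [n0 hn0] := hl _ e0; have [n1 hn1] := eps _ e0.
pose m := maxn n0 n1.
have -> : 'X^j + r = ('X^j + q m) - (q m - r).
  by rewrite opprB [RHS]addrC (addrC _ (q m)) addrA subrK addrC.
apply: (le_trans (msB_le hN _ _)); rewrite ge_max; apply/andP; split.
  by rewrite ltW// (lt_trans (hq _).2)// hn1// leq_maxr.
apply: (le_trans (ds_le_tnorm hN _)).
by have := hn0 m (leq_maxl _ _); rewrite lr -rmorphB => /ltW.
Qed.

(** Equivalence of norms on a finite-dimensional space over a complete field, by induction on the
    dimension; the distance d from 'X^j to the lower degrees bounds the leading coefficient. *)
Lemma norm_equiv j : (forall q, q != 0 -> (size q <= j)%N -> N q != 0) ->
  exists2 C, 0 < C & forall q, (size q <= j)%N -> bnorm A (tpoly q) <= C * N q.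
Proof.
elim: j => [|j ih] nz.
  exists 1 => // q; rewrite leqn0 size_poly_eq0 => /eqP ->.
  by rewrite rmorph0 bnorm0 mul1r (ms_ge0 hN).
have hj : exists2 C, 0 < C & forall q, (size q <= j)%N -> bnorm A (tpoly q) <= C * N q.
  by apply: ih => q q0 qj; apply: nz => //; exact: leqW.
have [d d0 hd] := norm_equiv_step nz hj; have [C C0 hC] := hj.
exists (d^-1 + C * (1 + d^-1)).
  by rewrite addr_gt0 ?mulr_gt0 ?addr_gt0 ?invr_gt0.
move=> q qj; pose b := q`_j; pose q' := q - b *: 'X^j.
have qE : q = b *: 'X^j + q' by rewrite /q' addrC subrK.
have sq' : (size q' <= j)%N.
  apply/leq_sizeP => i ji; rewrite coefB coefZ coefXn.
  have [->|ij] := eqVneq i j; first by rewrite mulr1 subrr.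
  by rewrite mulr0 subr0 nth_default// (leq_trans qj)// ltn_neqAle eq_sym ij.
have Nb : nabs b * d <= N q.
  have [b0|b0] := eqVneq b 0; first by rewrite b0 nabs0 mul0r (ms_ge0 hN).
  have -> : q = b%:P * ('X^j + b^-1 *: q').
    by rewrite {1}qE mulrDr !mul_polyC scalerA divff// scale1r.
  rewrite (msM hN) (dsC hN) ler_wpM2l ?nabs_ge0// hd//.
  by rewrite (leq_trans (size_scale_leq _ _)).
have bd : nabs b <= d^-1 * N q by rewrite mulrC ler_pdivlMr.
have d1 : 0 < d^-1 by rewrite invr_gt0.
have Nq0 := ms_ge0 hN q.
have Nq' : N q' <= (1 + d^-1) * N q.
  apply: (le_trans (msB_le hN _ _)); rewrite -mul_polyC (msM hN) (dsC hN) (msX hN).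
  have x1 : N 'X ^+ j <= 1 by rewrite exprn_ile1 ?(ms_ge0 hN) ?(dsX hN).
  have x0 : 0 <= N 'X ^+ j by rewrite exprn_ge0 ?(ms_ge0 hN).
  have b0 := nabs_ge0 b.
  rewrite ge_max; apply/andP; split; first by nra.
  apply: (@le_trans _ _ (nabs b)); first by nra.
  by apply: (le_trans bd); nra.
rewrite {1}qE tpolyD (le_trans (bnormD _ _))// ge_max; apply/andP; split.
  apply: (@le_trans _ _ (nabs b)).
    rewrite -mul_polyC tpolyM (le_trans (bnormM _ _))// tpolyC.
    rewrite -[leRHS]mulr1 ler_pM ?bnorm_ge0 ?bnorm_const//.
    by apply: tnorm_le1 => i /=; rewrite coefXn; case: eqP => _; rewrite ?nabs1 ?nabs0.
  rewrite (le_trans bd)// ler_wpM2r// lerDl.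
  by rewrite mulr_ge0 ?addr_ge0 ?ltW.
apply: (le_trans (hC _ sq')).
apply: (@le_trans _ _ (C * ((1 + d^-1) * N q))); first by rewrite ler_wpM2l ?(ltW C0).
by rewrite mulrA ler_wpM2r// lerDr ltW.
Qed.

End NormEquivalence.

(** Such a p generates the prime ideal of the polynomials that vanish at e. *)
Definition min_killer e p := [/\ p != 0, e (tpoly p) = 0 &
  forall q, q != 0 -> e (tpoly q) = 0 -> (size p <= size q)%N].

Lemma min_killerP e q : q != 0 -> e (tpoly q) = 0 -> exists p, min_killer e p.
Proof.
move=> q0 eq0.
pose Pn n := `[< exists p : {poly k}, [/\ size p = n, p != 0 & e (tpoly p) = 0] >].
have ex : exists n, Pn n by exists (size q); apply/asboolP; exists q.
have [n /asboolP[p [sp p0 ep]] nmin] := ex_minnP ex.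
exists p; split=> // r r0 er; rewrite sp; apply: nmin.
by apply/asboolP; exists r.
Qed.

Section Killer.
Variables (e : disc k) (p : {poly k}).
Hypothesis ep : min_killer e p.

Lemma killer_size_gt1 : (1 < size p)%N.
Proof.
have [p0 epz _] := ep; rewrite ltnNge; apply/negP => s1.
have /size_poly1P[c c0 pc] : size p == 1%N.
  by rewrite eqn_leq s1 lt0n size_poly_eq0.
by move/eqP: epz; rewrite pc tpolyC berk_const nabs_eq0 (negbTE c0).
Qed.

Lemma killer_coprime q : q != 0 -> (size q < size p)%N -> coprimep p q.
Proof.
move=> q0 qp; have [p0 epz pmin] := ep.
have gq : (size (gcdp p q) <= size q)%N by rewrite dvdp_leq ?dvdp_gcdr.
have g0 : gcdp p q != 0 by rewrite gcdp_eq0 negb_and p0.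
have gp := dvdp_gcdl p q.
have : e (tpoly (p %/ gcdp p q * gcdp p q)) = 0 by rewrite divpK.
rewrite rmorphM berkM => /eqP; rewrite mulf_eq0 => /orP[|] /eqP h; last first.
  by have := pmin _ g0 h; rewrite leqNgt (leq_ltn_trans gq).
have d0 : p %/ gcdp p q != 0 by rewrite divp_eq0 !negb_or p0 g0/= -leqNgt dvdp_leq.
have := pmin _ d0 h; rewrite size_divp// /coprimep.
have : (0 < size (gcdp p q))%N by rewrite lt0n size_poly_eq0.
case: (size (gcdp p q)) => [//|[//|n]] _ /=.
by rewrite leqNgt ltn_subrL /= (ltn_trans _ killer_size_gt1).
Qed.

Lemma killer_nz z q : z (tpoly p) = 0 -> q != 0 -> (size q < size p)%N ->
  z (tpoly q) != 0.
Proof.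
move=> zp q0 qp; have /Bezout_coprimepP[[a b] /= h] := killer_coprime q0 qp.
apply/eqP => zq.
have [c c0 hc] : exists2 c, c != 0 & a * p + b * q = c%:P.
  by move: h; rewrite -size_poly_eq1 => /size_poly1P[c c0 ->]; exists c.
have := berk_const z c; rewrite -tpolyC -hc tpolyD !tpolyM => h2.
have := berk_ultra z (tpoly a * tpoly p) (tpoly b * tpoly q).
rewrite h2 !berkM zp zq !mulr0 maxxx => h3.
by move: c0; rewrite -nabs_eq0 eq_le h3 nabs_ge0.
Qed.

Lemma killer_modp z q : z (tpoly p) = 0 -> z (tpoly (q %% p)) = z (tpoly q).
Proof.
move=> zp; rewrite [in RHS](divp_eq q p) addrC tpolyD tpolyM.
apply/esym/le_anti/andP; split.
  apply: le_trans (berk_ultra _ _ _) _.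
  by rewrite berkM zp mulr0 ge_max lexx berk_ge0.
rewrite -{1}(addrK (tpoly (q %/ p) * tpoly p) (tpoly (q %% p))).
apply: le_trans (msB_le (berk_ms z) _ _) _.
by rewrite berkM zp mulr0 ge_max lexx berk_ge0.
Qed.

(** On remainders modulo p the value at z2 is a norm, equivalent to the Gauss norm, which bounds z1.
    Applied to the powers of r, the equivalence constant disappears. *)
Lemma killer_modp_le z1 z2 : z1 (tpoly p) = 0 -> z2 (tpoly p) = 0 -> disc_le z1 z2.
Proof.
move=> h1 h2; apply: disc_le_poly => r.
have [p0 _ _] := ep.
have nz2 : forall q, q != 0 -> (size q <= (size p).-1)%N -> (z2 \o tpoly (k := k)) q != 0.
  move=> q q0 qs; apply: killer_nz => //; apply: leq_ltn_trans qs _.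
  by rewrite prednK// (ltn_trans _ killer_size_gt1).
have [C C0 hC] := norm_equiv (berk_ds z2) nz2.
apply: (ltr_power_bounded (C := C)); rewrite ?berk_ge0 ?(ltW C0)// => n.
rewrite -!berkX -!tpolyXn -(killer_modp (r ^+ n) h1) -(killer_modp (r ^+ n) h2).
apply: le_trans (berk_le _ _) _; apply: hC.
by rewrite -ltnS prednK ?ltn_modp// (ltn_trans _ killer_size_gt1).
Qed.

(* k[T]/p is a finite extension of the complete field k, so the absolute value
   has only one extension to it. *)
Lemma killer_unique z : z (tpoly p) = 0 -> z = e.
Proof.
by move=> zp; have [_ ? _] := ep; apply: disc_le_anti; apply: killer_modp_le.
Qed.

End Killer.

End UniqueExtension.

(** * Radius, multiplicity and alpha *)

Section Evaluation.
Variables (R : realType) (F : nafield R) (w : F).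
Hypothesis w1 : nabs w <= 1.

Lemma ev_ds : disc_seminorm (fun p : {poly F} => nabs p.[w]).
Proof.
split; [split|by move=> c; rewrite hornerC|by rewrite hornerX].
- by move=> p; exact: nabs_ge0.
- by rewrite horner0 nabs0.
- by rewrite hornerC nabs1.
- by move=> p q; rewrite hornerM nabsM.
- by move=> p q; rewrite hornerD nabsD.
Qed.

Definition ev_pt : disc F := disc_of ev_ds.

Lemma ev_ptE p : ev_pt (tpoly p) = nabs p.[w].
Proof. exact: disc_ofE. Qed.

Lemma ev_pt_lin a : ev_pt (tpoly ('X - a%:P)) = nabs (w - a).
Proof. by rewrite ev_ptE hornerXsubC. Qed.

End Evaluation.

Section ClosedSplit.
Variables (F : fieldType) (closedF : GRing.closed_field_axiom F).

Lemma closed_root (p : {poly F}) : (1 < size p)%N -> exists x, root p x.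
Proof.
move=> s1; have p0 : lead_coef p != 0 by rewrite lead_coef_eq0 -size_poly_gt0 ltnW.
have n0 : (0 < (size p).-1)%N by rewrite -subn1 subn_gt0.
have [x hx] := closedF (fun i => - (p`_i / lead_coef p)) n0.
exists x; apply/rootP; rewrite horner_coef.
have -> : size p = (size p).-1.+1 by rewrite prednK// ltnW.
rewrite big_ord_recr/= -lead_coefE hx mulr_sumr -big_split big1//= => i _.
by rewrite mulNr mulrN mulrCA mulrA divfK// subrr.
Qed.

Lemma closed_split (p : {poly F}) : p != 0 ->
  exists rs, p = lead_coef p *: \prod_(a <- rs) ('X - a%:P).
Proof.
have [n] := ubnP (size p); elim: n p => // n ih p; rewrite ltnS => pn p0.
have [s1|s1] := leqP (size p) 1.
  exists [::]; rewrite big_nil.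
  have /size_poly1P[c c0 ->] : size p == 1%N by rewrite eqn_leq s1 lt0n size_poly_eq0.
  by rewrite lead_coefC -mul_polyC mulr1.
have [x /factor_theorem[q pq]] := closed_root s1.
have q0 : q != 0 by apply: contra_neq p0; rewrite pq => ->; rewrite mul0r.
have [|rs hrs] := ih q _ q0.
  by move: pn; rewrite pq size_Mmonic ?monicXsubC// size_XsubC addn2.
exists (x :: rs); rewrite {1}pq {1}hrs big_cons pq lead_coefM lead_coefXsubC mulr1.
by rewrite -scalerAl mulrC.
Qed.

End ClosedSplit.

Section OverK.
Variables (R : realType) (k : nafield R) (K : completed_closure k).
Implicit Types (y : disc K) (u z : disc k) (p q : {poly k}) (a b : cc_alg K).
Local Notation "u $ p" := (berk_val u (tpoly p)) (at level 11).

Definition pemb p : {poly cc_alg K} := map_poly (cc_base K) p.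
Definition pincl (q : {poly cc_alg K}) : {poly K} := map_poly (cc_incl K) q.

Lemma tate_emb_tpoly p : tate_emb K (tpoly p) = tpoly (pincl (pemb p)).
Proof. by apply: tateP => i /=; rewrite !coef_map. Qed.

Lemma restrE y p : restr y $ p = y $ (pincl (pemb p)).
Proof. by rewrite -tate_emb_tpoly. Qed.

Definition dist_to y a : R := y $ ('X - (cc_incl K a)%:P).

Lemma pincl_linear a : pincl ('X - a%:P) = 'X - (cc_incl K a)%:P.
Proof. by rewrite /pincl rmorphB/= map_polyX map_polyC. Qed.

Lemma poly_value_roots (qa : {poly cc_alg K}) rs y :
  qa = lead_coef qa *: \prod_(a <- rs) ('X - a%:P) ->
  y $ (pincl qa) = nabs (cc_incl K (lead_coef qa)) * \prod_(a <- rs) dist_to y a.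
Proof.
move=> e; rewrite {1}e -mul_polyC /pincl rmorphM/= map_polyC/= tpolyM berkM tpolyC berk_const.
congr (_ * _); rewrite rmorph_prod/= (big_morph _ (@tpolyM _ _) (_ : _ = 1)); last first.
  exact: (rmorph1 (tpoly (k := K))).
rewrite (ms_prod (berk_ms y)); apply: eq_bigr => a _.
by rewrite -[map_poly _ _]/(pincl _) pincl_linear.
Qed.

Lemma pincl_dense (p : {poly K}) (e : R) : 0 < e -> exists q : {poly cc_alg K},
  bnorm (tate_alg K) (tpoly p - tpoly (pincl q)) <= e.
Proof.
move=> e0; have /choice[c hc] : forall i : nat, exists w, nabs (p`_i - cc_incl K w) < e.
  by move=> i; exact: cc_dense.
exists (\poly_(i < size p) c i); rewrite -tpolyB; apply: tnorm_le1 => i /=.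
rewrite coefB coef_map coef_poly; case: ltnP => h /=; first exact: ltW.
by rewrite nth_default// rmorph0 subr0 nabs0 ltW.
Qed.

(** Polynomials over the algebraic closure split into linear factors, and they are dense. *)
Lemma dist_to_le y1 y2 : (forall a, dist_to y1 a <= dist_to y2 a) -> disc_le y1 y2.
Proof.
move=> h.
have hq (q : {poly cc_alg K}) : y1 $ (pincl q) <= y2 $ (pincl q).
  have [->|q0] := eqVneq q 0.
    by rewrite /pincl map_poly0 (rmorph0 (tpoly (k := K))) !berk0.
  have [rs e] := closed_split (@cc_closed _ _ K) q0.
  rewrite !(poly_value_roots _ e) ler_wpM2l ?nabs_ge0//.
  by apply: ler_prod => a _; rewrite berk_ge0 h.
apply: disc_le_poly => p; apply/ler_addgt0Pr => e e0.
have e2 : 0 < e / 2 by rewrite divr_gt0.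
have [q pq] := pincl_dense p e2.
have := berk_lip y1 (tpoly p) (tpoly (pincl q)).
have := berk_lip y2 (tpoly (pincl q)) (tpoly p); have := hq q.
rewrite (bnorm_distC (tpoly (pincl q))); lra.
Qed.

Lemma dist_to_eq y1 y2 : dist_to y1 =1 dist_to y2 -> y1 = y2.
Proof.
by move=> h; apply: disc_le_anti; apply: dist_to_le => a; rewrite h.
Qed.

Lemma dist_to_flow y t a : 0 <= t <= 1 -> dist_to (flow y t) a = Num.max (dist_to y a) t.
Proof. exact: flow_lin. Qed.

Lemma restr_flow y t : restr (flow y t) = flow (restr y) t.
Proof.
rewrite -(flow_clip y) -(flow_clip (restr y)); have := clip01_itv t.
set s := clip01 t => s01; apply: disc_eq_poly => p; rewrite restrE !flowE//.
have nE i : nderivn i (pincl (pemb p)) = pincl (pemb (nderivn i p)).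
  by rewrite /pincl /pemb !nderivn_map.
have cE i : (restr y \o @tpoly R k) (nderivn i p) =
    (y \o @tpoly R K) (nderivn i (pincl (pemb p))).
  by rewrite nE /comp restrE.
apply/le_anti/andP; split; (apply: flow_le => [|i]; first exact: gnorm_ge0).
  by rewrite -cE; exact: (flow_ub (berk_ds (restr y))).
by rewrite cE; exact: (flow_ub (berk_ds y)).
Qed.

(** If y were closer than t to some a, take a polynomial over k with root a: its value is a product
    of distances to its roots, none of which decreases along the flow, while the one to a strictly
    increases. *)
Lemma flow_fixed_restr y t : 0 <= t <= 1 ->
  flow (restr y) t = restr y <-> forall a, t <= dist_to y a.
Proof.
move=> t01; have /andP[t0 t1] := t01; split=> [h a|h]; last first.
  rewrite -restr_flow; congr restr; apply: dist_to_eq => a.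
  by rewrite dist_to_flow// (max_idPl (h a)).
have [p p0 pa] := @cc_algebraic _ _ K a.
have qp0 : pemb p != 0 by rewrite map_poly_eq0.
have [rs e] := closed_split (@cc_closed _ _ K) qp0.
have ars : a \in rs.
  rewrite -root_prod_XsubC; move: pa; rewrite -/(pemb p) e rootZ//.
  by rewrite lead_coef_eq0.
have : restr (flow y t) $ p = restr y $ p by rewrite restr_flow h.
rewrite !restrE !(poly_value_roots _ e) => he.
have {}he := mulfI (_ : nabs (cc_incl K (lead_coef (pemb p))) != 0) he.
move: he => /(_ _)/[!(nabs_eq0, fmorph_eq0, lead_coef_eq0)] /(_ qp0) he.
rewrite leNgt; apply/negP => lt1.
have tp : 0 < t by apply: le_lt_trans lt1; exact: berk_ge0.
have : \prod_(b <- rs) dist_to y b < \prod_(b <- rs) dist_to (flow y t) b; last first.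
  by rewrite he ltxx.
have mt b : t <= dist_to (flow y t) b by rewrite dist_to_flow// le_max lexx orbT.
have my b : dist_to y b <= dist_to (flow y t) b by rewrite dist_to_flow// le_max lexx.
elim: rs ars {e he} => // b rs ih; rewrite inE !big_cons => /orP[/eqP <-|ars].
  apply: (@le_lt_trans _ _ (dist_to y a * \prod_(j <- rs) dist_to (flow y t) j)).
    rewrite ler_wpM2l ?berk_ge0//; apply: ler_prod => i _.
    by rewrite berk_ge0 my.
  rewrite ltr_pM2r; last by apply: prodr_gt0 => i _; apply: lt_le_trans (mt i).
  exact: lt_le_trans (mt a).
apply: (@le_lt_trans _ _ (dist_to (flow y t) b * \prod_(j <- rs) dist_to y j)).
  by rewrite ler_wpM2r// prodr_ge0// => i _; exact: berk_ge0.
by rewrite ltr_pM2l ?ih//; apply: lt_le_trans (mt b).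
Qed.

(** The flow of the centre up to height s is the largest point of the Berkovich disc |T - w| <= s,
    so it attains the supremum. *)
Lemma is_disc_ptP (w : K) (s : R) y (w1 : nabs w <= 1) : 0 <= s <= 1 ->
  is_disc_pt w s y <-> y = flow (ev_pt w1) s.
Proof.
move=> s01; have /andP[s0 s1] := s01.
have lE (y' : disc K) : y' (tvar _ _ - bconst (tate_alg K) w) = y' $ ('X - w%:P).
  by rewrite tpolyB tpolyX tpolyC.
have ew : ev_pt w1 $ ('X - w%:P) <= s by rewrite ev_pt_lin subrr nabs0.
have key f : sup [set y' f | y' in [set y' : disc K |
    y' (tvar _ _ - bconst (tate_alg K) w) <= s]] = flow (ev_pt w1) s f.
  apply/le_anti/andP; split.
    apply: ge_sup.
      by exists (ev_pt w1 f); exists (ev_pt w1) => //; rewrite /mkset lE.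
    move=> _ [y' + <-]; rewrite /mkset lE => hy'.
    exact: (le_flow_centered s01 hy' ew).
  apply: ub_le_sup.
    by exists (bnorm (tate_alg K) f) => _ [y' _ <-]; exact: berk_le.
  by exists (flow (ev_pt w1) s) => //; rewrite /mkset lE flow_lin// ge_max ew lexx.
split=> [h|->].
  by apply: berkP => f; rewrite h key.
by move=> f; rewrite key.
Qed.

End OverK.

(** * The radius function *)

Section Radius.
Variables (R : realType) (k : nafield R) (K : completed_closure k).
Implicit Types (y : disc K) (u z e : disc k) (p q : {poly k}) (a b : cc_alg K) (s t d : R).
Local Notation "u $ p" := (berk_val u (tpoly p)) (at level 11).
Local Notation r := (Defs.radius K).
Local Notation xG := (gauss_pt k).

(** In both cases of [has_radius], s is the infimum of the distances from y to the points w of the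
    unit disc of K. It is not this form that the definition takes, but it is the only one used from
    here on. *)
Lemma has_radius_spec y s : has_radius y s ->
  [/\ 0 <= s <= 1, forall w : K, s <= y $ ('X - w%:P) &
    forall d, 0 < d -> exists2 w : K, nabs w <= 1 & y $ ('X - w%:P) < s + d].
Proof.
move=> [[w [w1 s01 /(is_disc_ptP _ w1 s01)->]]|].
  split=> // [v|d d0]; first by rewrite flow_lin// le_max lexx orbT.
  exists w => //; rewrite flow_lin// ev_pt_lin subrr nabs0 gt_max.
  by case/andP: s01 => s0 _; rewrite ltr_wpDl// ltrDl d0.
move=> [w [t [x [hx nest _ xy ts]]]].
have [w1 t01] : (forall i, nabs (w i) <= 1) /\ (forall i, 0 <= t i <= 1).
  by split=> i; have [] := hx i.
have xE i : x i = flow (ev_pt (w1 i)) (t i).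
  by have [_ _ /(is_disc_ptP _ (w1 i) (t01 i))] := hx i.
have xl i v : x i $ ('X - v%:P) = Num.max (nabs (w i - v)) (t i).
  by rewrite xE flow_lin// ev_pt_lin.
have lim_ev f : (fun i => x i f) @ \oo --> y f.
  exact: (cvg_comp x (fun z : disc K => z f) xy (@berk_eval_continuous _ _ _ f y)).
have s01 : 0 <= s <= 1.
  apply/andP; split.
    by apply: (cvgr_to_ge ts); apply: nearW => n; case/andP: (t01 n).
  by apply: (cvgr_to_le ts); apply: nearW => n; case/andP: (t01 n).
split=> // [v|d d0].
  apply: (ler_cvg_to ts (lim_ev (tpoly ('X - v%:P)))).
  by apply: nearW => i; rewrite xl le_max lexx orbT.
have sd : s < s + d / 2 by rewrite ltrDl divr_gt0.
have [n _ hn] := cvgr_lt s ts _ sd.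
have hj : t n < s + d / 2 by apply: hn => /=.
exists (w n) => //.
have incl i : (n <= i)%N -> closed_disc (w i) (t i) `<=` closed_disc (w n) (t n).
  elim: i => [|i ih]; first by rewrite leqn0 => /eqP ->.
  rewrite leq_eqVlt => /predU1P[->//|]; rewrite ltnS => /ih h.
  by apply: subset_trans h; exact: nest.
have : y $ ('X - (w n)%:P) <= s + d / 2; last by move: d0; lra.
apply: (cvgr_to_le (lim_ev _)); exists n => // i /= ni.
rewrite xl ge_max [X in _ && X]ltW ?andbT; last exact: hn.
apply: le_trans (ltW hj); apply: (incl i ni (w i)).
by rewrite /closed_disc /mkset subrr nabs0; case/andP: (t01 i).
Qed.

Lemma has_radius_dist y s a : has_radius y s -> s <= dist_to y a.
Proof. by move=> /has_radius_spec[_ h _]; exact: h. Qed.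

Lemma has_radius_approx y s d : has_radius y s -> 0 < d ->
  exists2 a, nabs (cc_incl K a) <= 1 & dist_to y a < s + d.
Proof.
move=> /has_radius_spec[/andP[s0 _] _ h] d0; have [w w1 hw] := h _ d0.
have m0 : 0 < Num.min d 1 by rewrite lt_min d0 ltr01.
have [a ha] := cc_dense w m0; exists a.
  rewrite -(subKr w (cc_incl K a)) (le_trans (msB_le (nabs_ms K) _ _))// ge_max w1/=.
  by rewrite ltW// (lt_le_trans ha)// ge_min lexx orbT.
rewrite /dist_to.
have -> : tpoly ('X - (cc_incl K a)%:P) = tpoly ('X - w%:P) + tpoly (w - cc_incl K a)%:P :> tate_alg K.
  by rewrite -tpolyD polyCB addrA subrK.
apply: (le_lt_trans (berk_ultra _ _ _)); rewrite gt_max hw tpolyC berk_const.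
by rewrite (lt_le_trans ha)// ge_min ler_wpDl.
Qed.

(** By [flow_fixed_restr], having distance at least s1 to all centres can be read off the
    restriction to X, so it passes from y1 to y2. *)
Lemma radius_unique y1 y2 s1 s2 : restr y1 = restr y2 ->
  has_radius y1 s1 -> has_radius y2 s2 -> s1 <= s2.
Proof.
move=> e h1 h2; rewrite leNgt; apply/negP => lt1.
have [s01 _ _] := has_radius_spec h1.
have d0 : 0 < s1 - s2 by rewrite subr_gt0.
have [a _ ha] := has_radius_approx h2 d0.
have := (flow_fixed_restr y1 s01).2 (fun a => has_radius_dist a h1).
rewrite e => /(flow_fixed_restr y2 s01)/(_ a); move: ha; rewrite subrKC => + /le_lt_trans h.
by move=> /h; rewrite ltxx.
Qed.

Lemma radiusE y s : has_radius y s -> r (restr y) = s.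
Proof.
move=> h; rewrite /Defs.radius; case: xgetP => [s' -> [y' e h']|].
  by apply/le_anti; rewrite (radius_unique e h' h) (radius_unique (esym e) h h').
by move=> /(_ s) []; exists y.
Qed.

(** The default value of [xget] in [radius] is 0, so a positive radius comes from an actual lift. *)
Lemma radius_lift u : 0 < r u -> exists2 y : disc K, restr y = u & has_radius y (r u).
Proof. by rewrite /Defs.radius; case: xgetP => [s' -> //|_]; rewrite ltxx. Qed.

Lemma radius_itv u : 0 <= r u <= 1.
Proof.
rewrite /Defs.radius; case: xgetP => [s' -> [y _ /has_radius_spec[]//]|_].
by rewrite lexx ler01.
Qed.

(** The flow replaces each distance to a centre by its maximum with t, and r u is the infimum of
    these distances. *)
Lemma flow_fixed u t : 0 < r u -> 0 <= t <= 1 -> flow u t = u <-> t <= r u.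
Proof.
move=> u0 t01; have [y yu hy] := radius_lift u0.
rewrite -{1 2}yu (flow_fixed_restr _ t01); split=> [h|tr a].
  apply/ler_addgt0Pr => d d0; have [a _ ha] := has_radius_approx hy d0.
  exact: le_trans (h a) (ltW ha).
exact: le_trans tr (has_radius_dist a hy).
Qed.

(** Strictly above u, the path to the Gauss point consists of discs with a fixed centre, which by
    density can be taken in the algebraic closure. *)
Lemma flow_disc u t : 0 < r u -> r u < t -> t <= 1 ->
  exists (a : cc_alg K) (a1 : nabs (cc_incl K a) <= 1),
  forall s, t <= s <= 1 -> flow u s = restr (flow (ev_pt a1) s).
Proof.
move=> u0 ut t1; have [y yu hy] := radius_lift u0.
have d0 : 0 < t - r u by rewrite subr_gt0.
have [a a1 ha] := has_radius_approx hy d0.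
rewrite subrKC in ha; exists a, a1 => s /andP[ts s1].
have s01 : 0 <= s <= 1 by rewrite s1 (le_trans _ ts)// (le_trans _ (ltW ut))// ltW.
rewrite -yu -restr_flow; congr restr.
apply: (flow_centered (a := cc_incl K a)) => //; first exact: le_trans (ltW ha) ts.
by rewrite ev_pt_lin subrr nabs0; case/andP: s01.
Qed.

Lemma radius_disc (w : K) (w1 : nabs w <= 1) s : 0 <= s <= 1 ->
  r (restr (flow (ev_pt w1) s)) = s.
Proof.
move=> s01; apply: radiusE; left; exists w; split=> //.
exact/(is_disc_ptP _ w1 s01).
Qed.

Lemma radius_flow u t : 0 < r u -> 0 <= t <= 1 -> r (flow u t) = Num.max (r u) t.
Proof.
move=> u0 t01; have [tr|rt] := leP t (r u).
  by rewrite (flow_fixed u0 t01).2.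
have /andP[_ t1] := t01; have [a [a1 h]] := flow_disc u0 rt t1.
by rewrite h ?radius_disc// lexx.
Qed.

Lemma radius_gauss : r xG = 1.
Proof.
have w1 : nabs (0 : K) <= 1 by rewrite nabs0.
have i1 : 0 <= (1 : R) <= 1 by rewrite ler01 lexx.
by rewrite -(radius_disc w1 i1) restr_flow flow1.
Qed.

Lemma above_radius z u : 0 < r z -> disc_le z u -> r z <= r u /\ u = flow z (r u).
Proof.
move=> z0 /disc_above[t t01 ->]; rewrite radius_flow// le_max lexx; split=> //.
have [tr|rt//] := leP t (r z).
by rewrite !(flow_fixed z0 _).2// radius_itv.
Qed.

Lemma radius_pos_above z u : 0 < r z -> disc_le z u -> 0 < r u.
Proof. by move=> z0 /(above_radius z0)[h _]; exact: lt_le_trans h. Qed.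

Lemma above_radius_eq z u : 0 < r z -> disc_le z u -> r u <= r z -> u = z.
Proof.
move=> z0 zu ru; have [_ ->] := above_radius z0 zu.
by apply/(flow_fixed z0) => //; exact: radius_itv.
Qed.

Lemma above_le_radius z u v : 0 < r z -> disc_le z u -> disc_le z v ->
  r u <= r v -> disc_le u v.
Proof.
move=> z0 zu zv h.
have [_ ->] := above_radius z0 zu; have [_ ->] := above_radius z0 zv.
exact: flow_mono.
Qed.

Lemma rigid_killed e : rigid K e -> r e = 0 /\ exists p, min_killer e p.
Proof.
move=> [w [w1 [y yw ye]]].
have i0 : 0 <= (0 : R) <= 1 by rewrite ler01 lexx.
split; first by rewrite -ye; apply: radiusE; left; exists (cc_incl K w).
have [p p0 pw] := @cc_algebraic _ _ K w.
apply: (@min_killerP _ _ _ p) => //.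
move: yw => /(is_disc_ptP _ w1 i0); rewrite flow0 -ye => ->.
rewrite restrE ev_ptE; apply/eqP; rewrite nabs_eq0.
by rewrite /pincl horner_map/= fmorph_eq0; exact: pw.
Qed.

Lemma radius_pos_not_rigid u : 0 < r u -> ~ rigid K u.
Proof. by move=> u0 /rigid_killed[ru _]; rewrite ru ltxx in u0. Qed.

(** In the flow norm from e the term of index 0 vanishes and every other term carries a factor t;
    moreover t <= r u, as u is fixed by its flow up to t. *)
Lemma above_killed_value e u p : e $ p = 0 -> bnorm (tate_alg k) (tpoly p) <= 1 ->
  disc_le e u -> 0 < r u -> u $ p <= r u.
Proof.
move=> ep p1 eu u0; have [t t01 ue] := disc_above eu.
have tr : t <= r u.
  by apply/(flow_fixed u0 t01); rewrite ue flow_flow// maxxx.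
apply: le_trans tr; rewrite ue flowE//; have /andP[t0 t1] := t01.
apply: flow_le => // -[|i]; first by rewrite nderivn0/= ep mul0r.
rewrite -[leRHS]mul1r ler_pM ?exprn_ge0//=; first exact: berk_ge0.
  by apply: le_trans (berk_le _ _) _; apply: le_trans (nderivn_tnorm _ _) p1.
by rewrite exprS -[leRHS]mulr1 ler_wpM2l// exprn_ile1.
Qed.

End Radius.

Lemma seq_min (R : realType) (T : eqType) (f : T -> R) (x : T) (rs : seq T) : x \in rs ->
  exists2 b, b \in rs & forall c, c \in rs -> f b <= f c.
Proof.
elim: rs x => // y rs ih x _; case: rs ih => [|z rs] ih.
  by exists y => [|c]; rewrite inE // => /eqP ->.
have [b brs hb] := ih z (mem_head _ _).
have [yb|by_] := leP (f y) (f b).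
  exists y => [|c]; first exact: mem_head.
  by rewrite inE => /predU1P[->//|/hb]; exact: le_trans.
exists b => [|c]; first by rewrite inE brs orbT.
by rewrite inE => /predU1P[->|/hb//]; exact: ltW.
Qed.

Lemma counting_finite (R : realType) (T : choiceType) (A : set T) : finite_set A ->
  exists n : nat, counting A = (n%:R%:E : \bar R) /\ (A !=set0 -> (0 < n)%N).
Proof.
move=> fA; exists (size (enum_fset (fset_set A))); split.
  by rewrite /counting; case: asboolP.
move=> [x Ax]; have : x \in fset_set A by rewrite in_fset_set//; exact/mem_set.
by move=> xA; rewrite cardfs_gt0; apply/fset0Pn; exists x.
Qed.

Lemma counting_le_image (R : realType) (T U : choiceType) (A : set T) (B : set U) (f : U -> T) :
  finite_set B -> A `<=` f @` B -> (counting A <= counting B :> \bar R)%E.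
Proof.
move=> fB AB; have fI : finite_set (f @` B) by exact: finite_image.
have fA : finite_set A by exact: sub_finite_set AB fI.
rewrite /counting; case: asboolP => // _; case: asboolP => // _.
rewrite lee_fin ler_nat.
have h1 : fsubset (fset_set A) (fset_set (f @` B)) by rewrite -fset_set_sub.
apply: leq_trans (fsubset_leq_card h1) _.
by rewrite fset_set_image//; exact: leq_imfset_card.
Qed.

(** * Fibres of the restriction map and multiplicity *)

Section Multiplicity.
Variables (R : realType) (k : nafield R) (K : completed_closure k).
Implicit Types (y : disc K) (u z e : disc k) (p q : {poly k}) (a b : cc_alg K) (s t d : R).
Local Notation "u $ p" := (berk_val u (tpoly p)) (at level 11).
Local Notation r := (Defs.radius K).
Local Notation xG := (gauss_pt k).

Lemma tpoly_linB (w v : K) :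
  tpoly ('X - v%:P) - tpoly ('X - w%:P) = tpoly (w - v)%:P :> tate_alg K.
Proof. by rewrite -tpolyB polyCB opprB addrC addrA subrK. Qed.

Definition fiber u : set (disc K) := [set y | restr y = u].

(* The roots of the minimal polynomial of a are the candidate centres. *)
Lemma fiber_disc a (a1 : nabs (cc_incl K a) <= 1) :
  exists rs : seq (cc_alg K), forall s, 0 < s <= 1 -> forall y,
    restr y = restr (flow (ev_pt a1) s) <->
    exists b (b1 : nabs (cc_incl K b) <= 1),
      [/\ b \in rs, restr (ev_pt b1) = restr (ev_pt a1) & y = flow (ev_pt b1) s].
Proof.
set e := restr (ev_pt a1).
have [p0 p00 p0a] := @cc_algebraic _ _ K a.
have ek : e $ p0 = 0.
  rewrite restrE ev_ptE; apply/eqP; rewrite nabs_eq0.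
  by rewrite /pincl horner_map/= fmorph_eq0; exact: p0a.
have [p ep] := min_killerP p00 ek; have [pn0 ep0 _] := ep.
have qp0 : pemb K p != 0 by rewrite map_poly_eq0.
have [rs prs] := closed_split (@cc_closed _ _ K) qp0.
have rootE b : (b \in rs) = root (pemb K p) b.
  by rewrite -root_prod_XsubC prs rootZ// lead_coef_eq0.
exists rs => s /andP[s0 s1] y.
have s01 : 0 <= s <= 1 by rewrite ltW.
have conj b (b1 : nabs (cc_incl K b) <= 1) : b \in rs -> restr (ev_pt b1) = e.
  move=> brs; apply: (killer_unique ep).
  rewrite restrE ev_ptE /pincl horner_map/=.
  by move: brs; rewrite rootE => /rootP ->; rewrite rmorph0 nabs0.
split=> [yu|[b [b1 [_ be ->]]]]; last by rewrite !restr_flow be.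
have yfix b : s <= dist_to y b.
  by apply: (flow_fixed_restr y s01).1; rewrite yu restr_flow flow_flow// maxxx.
have ars : a \in rs.
  rewrite rootE; apply/rootP/eqP; rewrite -(fmorph_eq0 (cc_incl K)) -nabs_eq0.
  by rewrite -horner_map -ev_ptE -restrE -/e ep0.
(* The centre of y is a root b of p nearest to y. *)
have [b brs bmin] := seq_min (dist_to y) ars.
have b1 : nabs (cc_incl K b) <= 1.
  have -> : cc_incl K b = cc_incl K a - (cc_incl K a - cc_incl K b) by rewrite subKr.
  apply: (le_trans (msB_le (nabs_ms K) _ _)); rewrite ge_max a1 /=.
  have := berk_ultra y (tpoly ('X - (cc_incl K b)%:P)) (- tpoly ('X - (cc_incl K a)%:P)).
  have -> : tpoly ('X - (cc_incl K b)%:P) - tpoly ('X - (cc_incl K a)%:P) =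
      tpoly (cc_incl K a - cc_incl K b)%:P :> tate_alg K.
    exact: tpoly_linB.
  rewrite tpolyC berk_const (msN (berk_ms y)) => /le_trans; apply.
  have ya : dist_to y a <= 1.
    rewrite /dist_to tpolyB; apply: (le_trans (msB_le (berk_ms y) _ _)).
    by rewrite tpolyC berk_const ge_max a1 andbT; exact: (dsX (berk_ds y)).
  by rewrite ge_max ya andbT; apply: le_trans (bmin a ars) ya.
exists b, b1; split; [by []|exact: conj|].
have dE c : dist_to (flow (ev_pt b1) s) c = Num.max (nabs (cc_incl K b - cc_incl K c)) s.
  by rewrite dist_to_flow// /dist_to ev_pt_lin.
have diffE c : nabs (cc_incl K b - cc_incl K c) <= Num.max (dist_to y b) (dist_to y c).
  have -> : nabs (cc_incl K b - cc_incl K c) =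
      y (tpoly ('X - (cc_incl K c)%:P) - tpoly ('X - (cc_incl K b)%:P)).
    by rewrite tpoly_linB tpolyC berk_const.
  by rewrite maxC; exact: (msB_le (berk_ms y)).
have dist2 c : dist_to y c <= Num.max (dist_to y b) (nabs (cc_incl K b - cc_incl K c)).
  have -> : dist_to y c = y (tpoly ('X - (cc_incl K b)%:P) +
      tpoly (cc_incl K b - cc_incl K c)%:P).
    by rewrite -tpolyD polyCB addrA subrK.
  by rewrite -(berk_const y) -tpolyC; exact: berk_ultra.
have le c : c \in rs -> dist_to (flow (ev_pt b1) s) c <= dist_to y c.
  move=> crs; rewrite dE ge_max yfix andbT (le_trans (diffE c))//.
  by rewrite ge_max lexx andbT bmin.
(* If y were farther than s from b, the product of its distances to the roots would exceed that of
   the disc around b, while both products equal the value of p at the same point of X up to the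
   leading coefficient. *)
have yb : dist_to y b = s.
  apply/eqP; rewrite eq_le yfix andbT leNgt; apply/negP => lt1.
  have hprod : \prod_(c <- rs) dist_to y c = \prod_(c <- rs) dist_to (flow (ev_pt b1) s) c.
    have lc0 : nabs (cc_incl K (lead_coef (pemb K p))) != 0.
      by rewrite nabs_eq0 fmorph_eq0 lead_coef_eq0.
    apply: (mulfI lc0); rewrite -!(poly_value_roots _ prs) -!restrE yu.
    by rewrite !restr_flow (conj b b1 brs).
  have : \prod_(c <- rs) dist_to (flow (ev_pt b1) s) c < \prod_(c <- rs) dist_to y c.
    rewrite !(perm_big _ (perm_to_rem brs)) !big_cons.
    have pos c : 0 < dist_to (flow (ev_pt b1) s) c.
      by rewrite dE lt_max s0 orbT.
    apply: (@lt_le_trans _ _ (dist_to y b * \prod_(c <- rem b rs) dist_to (flow (ev_pt b1) s) c)).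
      rewrite ltr_pM2r; last by apply: prodr_gt0 => c _; exact: pos.
      rewrite dE subrr nabs0 gt_max lt1 andbT.
      exact: lt_trans s0 lt1.
    rewrite ler_wpM2l ?berk_ge0// big_seq [leRHS]big_seq; apply: ler_prod => c crs.
    by rewrite (ltW (pos c)) le// (mem_rem crs).
  by rewrite hprod ltxx.
apply: dist_to_eq => c; rewrite dE.
have h1 := diffE c; have h2 := dist2 c; rewrite yb in h1 h2.
rewrite maxC in h2; apply/le_anti/andP; split; first exact: h2.
rewrite ge_max yfix andbT.
by apply: (le_trans h1); rewrite ge_max lexx yfix.
Qed.

(** The list of candidate centres in [fiber_disc] does not depend on the height, so the fibre at
    height s is covered by the flow of the fibre at height t. *)
Lemma fiber_flow u t : 0 < r u -> r u < t -> t <= 1 ->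
  [/\ finite_set (fiber (flow u t)), fiber (flow u t) !=set0 &
     forall s, t <= s <= 1 -> fiber (flow u s) `<=` (fun y => flow y s) @` fiber (flow u t)].
Proof.
move=> u0 ut t1; have [a [a1 ha]] := flow_disc u0 ut t1.
have t0 : 0 < t by exact: lt_trans ut.
have tt : t <= t <= 1 by rewrite lexx.
have [rs hrs] := fiber_disc a1.
have t01 : 0 < t <= 1 by rewrite t0.
split.
- pose f b := if pselect (nabs (cc_incl K b) <= 1) is left h then flow (ev_pt h) t
              else gauss_pt K.
  apply: (@sub_finite_set _ _ (f @` [set` rs])); last exact: finite_image.
  move=> y; rewrite /fiber /mkset (ha t tt) => /(hrs t t01)[b [b1 [brs _ ->]]].
  exists b => //; rewrite /f; case: pselect => // b1'.
  by rewrite (Prop_irrelevance b1' b1).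
- by exists (flow (ev_pt a1) t); rewrite /fiber /mkset (ha t tt).
- move=> s ts; have s01 : 0 < s <= 1 by case/andP: ts => h ->; rewrite (lt_le_trans t0).
  move=> y; rewrite /fiber /mkset (ha s ts) => /(hrs s s01)[b [b1 [brs be ->]]].
  exists (flow (ev_pt b1) t).
    by rewrite (ha t tt) !restr_flow be.
  have /andP[ts1 s1] := ts.
  have s01' : 0 <= s <= 1 by rewrite s1 (le_trans (ltW t0)).
  have t01' : 0 <= t <= 1 by rewrite t1 ltW.
  by rewrite flow_flow// (max_idPr ts1).
Qed.

Definition inv_mult u : R := (fine (mult K u))^-1.

Arguments inv_mult : simpl never.

Lemma inv_mult_itv u : 0 < r u -> forall t, r u < t <= 1 -> 0 < inv_mult (flow u t) <= 1.
Proof.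
move=> u0 t /andP[ut t1]; have [fin ne _] := fiber_flow u0 ut t1.
have [n [hn n0]] := counting_finite R fin.
rewrite /inv_mult /mult -/(fiber _) hn /=.
have np : (0 < n)%N by exact: n0.
by rewrite invr_gt0 ltr0n np/= invf_le1 ?ltr0n// ler1n.
Qed.

Lemma inv_mult_ge0 u : 0 <= inv_mult u.
Proof.
rewrite /inv_mult invr_ge0 fine_ge0// /mult /counting.
by case: asboolP => _ //; rewrite lee_fin.
Qed.

Lemma inv_mult_le1 u : 0 < r u -> inv_mult u <= 1.
Proof.
move=> u0; have [y yu _] := radius_lift u0.
rewrite /inv_mult /mult -/(fiber _); have [fin|nfin] := pselect (finite_set (fiber u)).
  have [n [hn n0]] := counting_finite R fin; rewrite hn /=.
  have np : (0 < n)%N by apply: n0; exists y.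
  by rewrite invf_le1 ?ltr0n// ler1n.
by rewrite /counting; case: asboolP => // _; rewrite /= invr0.
Qed.

Lemma inv_mult_mono u t s : 0 < r u -> r u < t -> t <= s -> s <= 1 ->
  inv_mult (flow u t) <= inv_mult (flow u s).
Proof.
move=> u0 ut ts s1; have t1 := le_trans ts s1.
have us : r u < s by exact: lt_le_trans ts.
have [fin ne himg] := fiber_flow u0 ut t1; have [fins nes _] := fiber_flow u0 us s1.
have [n [hn n0]] := counting_finite R fin; have [m [hm m0]] := counting_finite R fins.
have mn : (counting (fiber (flow u s)) <= counting (fiber (flow u t)) :> \bar R)%E.
  by apply: (@counting_le_image _ _ _ _ _ (fun y => flow y s)) => //; apply: himg; rewrite ts.
move: mn; rewrite /inv_mult /mult -!/(fiber _) hn hm lee_fin ler_nat /= => mn.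
by rewrite lef_pV2 ?posrE ?ltr0n ?n0 ?m0// ler_nat.
Qed.

End Multiplicity.

Lemma ereal_increment_le (R : realType) (a b d : R) (I : \bar R) :
  (a%:E = b%:E + I -> 0 <= I -> I <= d%:E -> (b <= a /\ a - b <= d)%R)%E.
Proof. by case: I => [x||]//; rewrite -EFinD => -[->]; rewrite !lee_fin; lra. Qed.

Lemma ereal_increment_lt (R : realType) (a b d : R) (I : \bar R) :
  (a%:E = b%:E + I -> 0 < I -> I <= d%:E -> (b < a)%R)%E.
Proof. by case: I => [x||]//; rewrite -EFinD => -[->]; rewrite lte_fin ltrDl. Qed.

(* Locked, since a failed comparison of al x with al y by computation would
   unfold the Lebesgue integral. *)
HB.lock Definition al (R : realType) (k : nafield R) (K : completed_closure k)
  (z : disc k) : R := fine (alpha K z).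

(** * The function alpha as an integral along the path to the Gauss point *)

Section Alpha.
Variables (R : realType) (k : nafield R) (K : completed_closure k).
Implicit Types (u z : disc k) (s t d : R).
Local Notation r := (Defs.radius K).
Local Notation xG := (gauss_pt k).
Local Notation mu := (@lebesgue_measure R).
Local Notation al := (al K).

Definition lrad z : R := - ln (r z).

Lemma lrad_ge0 z : 0 <= lrad z.
Proof. by rewrite oppr_ge0 ln_le0//; case/andP: (radius_itv K z). Qed.

Lemma logradiusE z : 0 < r z -> logradius K z = (lrad z)%:E.
Proof. by move=> z0; rewrite /logradius /= leNgt z0. Qed.

Lemma logradius_inv u t : logradius K u = t%:E -> 0 < r u /\ r u = expR (- t).
Proof.
rewrite /logradius /=; case: ifPn => //; rewrite -ltNge => u0 [<-].
by rewrite opprK lnK.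
Qed.

Lemma expN_lrad z : 0 < r z -> expR (- lrad z) = r z.
Proof. by move=> z0; rewrite opprK lnK. Qed.

Lemma lrad_le z u : 0 < r z -> r z <= r u -> lrad u <= lrad z.
Proof. by move=> z0 zu; rewrite lerN2 ler_ln ?posrE// (lt_le_trans z0). Qed.

Lemma path_itv z t : 0 < r z -> 0 <= t <= lrad z ->
  0 <= expR (- t) <= 1 /\ r z <= expR (- t).
Proof.
move=> z0 /andP[t0 tl]; rewrite ltW ?expR_gt0//= -expR0 ler_expR oppr_le0 t0.
by split=> //; rewrite -(expN_lrad z0) ler_expR lerN2.
Qed.

Lemma path_to_gaussE z t : 0 < r z -> 0 <= t <= lrad z ->
  path_to_gauss K z t = flow z (expR (- t)).
Proof.
move=> z0 tl; have [e01 ze] := path_itv z0 tl.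
rewrite /path_to_gauss; case: xgetP => [u _ [zu /logradius_inv[_ ru]]|].
  by have [_ ->] := above_radius z0 zu; rewrite ru.
move=> /(_ (flow z (expR (- t)))) []; split; first exact: flow_ge.
have rf : r (flow z (expR (- t))) = expR (- t) by rewrite radius_flow// (max_idPr ze).
by rewrite logradiusE ?rf ?expR_gt0// /lrad rf expRK opprK.
Qed.

Definition dens z t : R := inv_mult K (path_to_gauss K z t).
Arguments dens : simpl never.

Lemma alphaE z : 0 < r z -> alpha K z = (\int[mu]_(t in `[0%R, lrad z]) (dens z t)%:E)%E.
Proof.
move=> z0; rewrite /alpha; congr (integral _ _ _).
by rewrite logradiusE//; apply/seteqP; split=> t /=; rewrite in_itv/= lee_fin => /andP.
Qed.

Lemma dens_ge0 z t : 0 <= dens z t. Proof. exact: inv_mult_ge0. Qed.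

Lemma dens_le1 z t : 0 < r z -> 0 <= t <= lrad z -> dens z t <= 1.
Proof.
move=> z0 tl; have [e01 ze] := path_itv z0 tl.
rewrite /dens path_to_gaussE// inv_mult_le1// radius_flow//.
by rewrite lt_max z0.
Qed.

Lemma dens_measurable z : 0 < r z -> measurable_fun `[0, lrad z] (dens z).
Proof.
move=> z0; have L0 := lrad_ge0 z.
(* A nonincreasing extension of the density to the whole line. The end t = lrad z, where the fibre
   over z itself enters, is split off because [inv_mult_mono] only applies strictly above z. *)
pose f t := if t < lrad z then inv_mult K (flow z (expR (- Num.max t 0))) else 0.
have tlt t : t < lrad z -> 0 < lrad z -> r z < expR (- Num.max t 0) <= 1.
  move=> tz lz; rewrite -(expN_lrad z0) ltr_expR ltrN2 gt_max tz lz/=.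
  by rewrite -expR0 ler_expR oppr_le0 le_max lexx orbT.
have [->|Ln] := eqVneq (lrad z) 0.
  by rewrite set_itv1; exact: measurable_fun_set1.
have Lp : 0 < lrad z by rewrite lt_def Ln.
have fmono : {homo f : m n /~ n <= m}.
  move=> s t st; rewrite /f; case: (ltP t (lrad z)) => [tz|_]; last first.
    by case: ifP => // _; exact: inv_mult_ge0.
  rewrite (le_lt_trans st tz).
  have /andP[h1 h2] := tlt _ tz Lp; have /andP[h3 h4] := tlt _ (le_lt_trans st tz) Lp.
  apply: inv_mult_mono => //.
  by rewrite ler_expR lerN2 ge_max !le_max st lexx !orbT.
have -> : `[0, lrad z]%classic = `[0, lrad z[%classic `|` [set lrad z].
  by rewrite setUitv1// bnd_simp.
apply/measurable_funU => //; split; last exact: measurable_fun_set1.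
apply: (eq_measurable_fun f); last exact: nonincreasing_measurable.
move=> t /set_mem/=; rewrite in_itv/= => /andP[t0 tz].
have tl : 0 <= t <= lrad z by rewrite t0 (ltW tz).
by rewrite /f tz /dens (path_to_gaussE z0 tl) (max_idPl t0).
Qed.

Lemma dens_flow z u t : 0 < r z -> disc_le z u -> 0 <= t <= lrad u -> dens u t = dens z t.
Proof.
move=> z0 zu tu; have [zur ue] := above_radius z0 zu.
have u0 : 0 < r u by exact: lt_le_trans zur.
have tz : 0 <= t <= lrad z by case/andP: tu => -> /le_trans; apply; exact: lrad_le.
have [et1 ut] := path_itv u0 tu.
rewrite /dens !path_to_gaussE// {1}ue flow_flow ?radius_itv//.
by rewrite (max_idPr ut).
Qed.

Lemma alpha_split z u : 0 < r z -> disc_le z u ->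
  alpha K z = (alpha K u + \int[mu]_(t in `]lrad u, lrad z]) (dens z t)%:E)%E.
Proof.
move=> z0 zu; have [zur ue] := above_radius z0 zu.
have u0 : 0 < r u by exact: lt_le_trans zur.
have lu := lrad_le z0 zur; have l0 := lrad_ge0 u.
have e : `[0, lrad z]%classic = `[0, lrad u]%classic `|` `]lrad u, lrad z]%classic.
  by rewrite -itv_bndbnd_setU ?bnd_simp.
have mz := dens_measurable z0.
have dj : [disjoint `[0, lrad u]%classic & `]lrad u, lrad z]%classic].
  rewrite disj_set2E; apply/eqP/seteqP; split=> t //= [].
  by rewrite !in_itv/= => /andP[_ h1] /andP[h2 _]; rewrite leNgt h2 in h1.
have ge0 t : (`[0, lrad u]%classic `|` `]lrad u, lrad z]%classic) t ->
    (0 <= (dens z t)%:E)%E by move=> _; rewrite lee_fin dens_ge0.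
have mf : measurable_fun (`[0, lrad u]%classic `|` `]lrad u, lrad z]%classic)
    (EFin \o dens z).
  by rewrite -e; apply/measurable_EFinP.
have eI : (\int[mu]_(t in `[0%R, lrad u]) (dens z t)%:E =
    \int[mu]_(t in `[0%R, lrad u]) (dens u t)%:E)%E.
  apply: eq_integral => t /set_mem tl; congr (_%:E).
  by apply/esym/(dens_flow z0 zu); move: tl; rewrite /mkset/= in_itv.
rewrite (alphaE z0) (alphaE u0) e.
by rewrite (ge0_integral_setU mu (measurable_itv _) (measurable_itv _) mf ge0 dj) eI.
Qed.

Lemma dens_integral_le z a b : 0 < r z -> 0 <= a -> a <= b -> b <= lrad z ->
  (\int[mu]_(t in `]a, b]) (dens z t)%:E <= (b - a)%:E)%E.
Proof.
move=> z0 a0 ab bz.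
have sub : `]a, b]%classic `<=` `[0, lrad z]%classic.
  move=> t; rewrite /= !in_itv/= => /andP[at_ tb].
  by rewrite (le_trans a0 (ltW at_)) (le_trans tb).
apply: (@le_trans _ _ (\int[mu]_(t in `]a, b]) cst 1%:E t)%E).
  apply: ge0_le_integral => //=.
  - by move=> t _; rewrite lee_fin dens_ge0.
  - apply/measurable_EFinP.
    by apply: measurable_funS (dens_measurable z0).
  - move=> t tab; rewrite lee_fin dens_le1//.
    by have := sub _ tab; rewrite /= in_itv.
rewrite integral_cst//= lebesgue_measure_itv/= lte_fin mul1e.
have [->|abn] := eqVneq a b; first by rewrite ltxx subrr.
by rewrite lt_neqAle abn ab EFinB.
Qed.

(** The density is positive strictly above z, where fibres are finite, and nonincreasing in t. On
    the first half of the interval it is bounded below by its value at the midpoint. *)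
Lemma dens_integral_gt0 z a b : 0 < r z -> 0 <= a -> a < b -> b <= lrad z ->
  (0 < \int[mu]_(t in `]a, b]) (dens z t)%:E)%E.
Proof.
move=> z0 a0 ab bz; pose c := (a + b) / 2.
have ac : a < c by rewrite /c; lra.
have cb : c < b by rewrite /c; lra.
have cz : 0 <= c <= lrad z by apply/andP; lra.
have sub : `]a, b]%classic `<=` `[0, lrad z]%classic.
  move=> t; rewrite /= !in_itv/= => /andP[at_ tb].
  by rewrite (le_trans a0 (ltW at_)) (le_trans tb).
have sub2 : `]a, c]%classic `<=` `]a, b]%classic.
  by move=> t; rewrite /= !in_itv/= => /andP[-> tc]/=; rewrite (le_trans tc)// ltW.
have mab : measurable_fun `]a, b] (EFin \o dens z).
  apply/measurable_EFinP.
  by apply: measurable_funS (dens_measurable z0).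
have [ec01 zc] := path_itv z0 cz; have /andP[ec0 ec1] := ec01.
have zc' : r z < expR (- c) by rewrite -(expN_lrad z0) ltr_expR ltrN2; lra.
have d0 : 0 < dens z c.
  rewrite /dens path_to_gaussE//.
  have ec : r z < expR (- c) <= 1 by rewrite zc' ec1.
  by case/andP: (inv_mult_itv z0 ec).
apply: (@lt_le_trans _ _ (\int[mu]_(t in `]a, c]) cst (dens z c)%:E t)%E).
  rewrite integral_cst//= lebesgue_measure_itv/= lte_fin ac -EFinB -EFinM lte_fin.
  by rewrite mulr_gt0// subr_gt0.
apply: (@le_trans _ _ (\int[mu]_(t in `]a, c]) (dens z t)%:E)%E).
  apply: ge0_le_integral => //=.
  - by move=> t _; rewrite lee_fin ltW.
  - exact: measurable_funS mab.
  - move=> t; rewrite in_itv/= => /andP[at_ tc].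
    have t0 : 0 <= t <= lrad z by apply/andP; split; move: cz => /andP[]; lra.
    have [et01 zt] := path_itv z0 t0.
    have zt' : r z < expR (- t) by rewrite -(expN_lrad z0) ltr_expR ltrN2; lra.
    rewrite lee_fin /dens !path_to_gaussE//; apply: inv_mult_mono => //.
      by rewrite ler_expR lerN2.
    by case/andP: et01.
by apply: ge0_subset_integral => //= t _; rewrite lee_fin dens_ge0.
Qed.

Lemma lrad_gauss : lrad xG = 0.
Proof. by rewrite /lrad radius_gauss ln1 oppr0. Qed.

Lemma alpha_gauss : alpha K xG = 0%E.
Proof.
by rewrite alphaE ?radius_gauss// lrad_gauss set_itv1 integral_set1.
Qed.

Lemma alpha_itv z : 0 < r z -> (0 <= alpha K z <= (lrad z)%:E)%E.
Proof.
move=> z0; rewrite (alpha_split z0 (disc_le_gauss z)) alpha_gauss add0e lrad_gauss.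
rewrite integral_ge0/=; last by move=> t _; rewrite lee_fin dens_ge0.
rewrite (le_trans (dens_integral_le z0 (lexx _) (lrad_ge0 z) (lexx _)))//.
by rewrite subr0.
Qed.

Lemma alphaE_fin z : 0 < r z -> alpha K z = (al z)%:E.
Proof.
move=> z0; rewrite al.unlock fineK// ge0_fin_numE; have /andP[a0 a1] := alpha_itv z0 => //.
by apply: le_lt_trans a1 _; rewrite ltry.
Qed.

Lemma al_ge0 z : 0 < r z -> 0 <= al z.
Proof. by move=> z0; have := alpha_itv z0; rewrite alphaE_fin// lee_fin => /andP[]. Qed.

Lemma al_le_lrad z : 0 < r z -> al z <= lrad z.
Proof. by move=> z0; have := alpha_itv z0; rewrite alphaE_fin// !lee_fin => /andP[]. Qed.

Lemma al_gauss : al xG = 0.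
Proof. by rewrite al.unlock alpha_gauss. Qed.

Lemma al_diff z u : 0 < r z -> disc_le z u ->
  al u <= al z /\ al z - al u <= lrad z - lrad u.
Proof.
move=> z0 zu; have [zur ue] := above_radius z0 zu.
have u0 : 0 < r u by exact: lt_le_trans zur.
have lu := lrad_le z0 zur; have l0 := lrad_ge0 u.
have h := alpha_split z0 zu.
have h1 := dens_integral_le z0 l0 lu (lexx _).
have h0 : (0 <= \int[mu]_(t in `]lrad u, lrad z]) (dens z t)%:E)%E.
  by apply: integral_ge0 => t _; rewrite lee_fin dens_ge0.
rewrite (alphaE_fin z0) (alphaE_fin u0) in h.
exact: ereal_increment_le h h0 h1.
Qed.

Lemma al_lt z u : 0 < r z -> disc_le z u -> z <> u -> al u < al z.
Proof.
move=> z0 zu ne; have [zur ue] := above_radius z0 zu.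
have u0 : 0 < r u by exact: lt_le_trans zur.
have rlt : r z < r u.
  rewrite ltNge; apply/negP => h; apply: ne; apply/esym.
  exact: (above_radius_eq z0 zu).
have lu : lrad u < lrad z by rewrite ltrN2 ltr_ln ?posrE.
have h := alpha_split z0 zu.
have h1 := dens_integral_le z0 (lrad_ge0 u) (ltW lu) (lexx _).
have h0 := dens_integral_gt0 z0 (lrad_ge0 u) lu (lexx _).
rewrite (alphaE_fin z0) (alphaE_fin u0) in h.
exact: ereal_increment_lt h h0 h1.
Qed.

End Alpha.

(** * Convexity and the Laplacian on the tree *)

Lemma ereal_dist_sum (R : realType) (a b : R) :
  (`|a%:E - b%:E| + `|b%:E - b%:E| = `|a - b|%:E :> \bar R)%E.
Proof. by rewrite -!EFinB /= subrr normr0 adde0. Qed.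

Section TreeGeometry.
Variables (R : realType) (k : nafield R) (K : completed_closure k).
Implicit Types (u v w x y z : disc k) (s t d : R) (S Y : set (disc k)).
Local Notation r := (Defs.radius K).
Local Notation xG := (gauss_pt k).
Local Notation al := (al K).

Definition disc_lt x y := disc_le x y /\ x <> y.

Lemma disc_lt_le x y : disc_lt x y -> disc_le x y. Proof. by case. Qed.

Lemma disc_le_lt_trans y x z : disc_le x y -> disc_lt y z -> disc_lt x z.
Proof.
move=> xy [yz ne]; split; first exact: disc_le_trans yz.
by move=> xz; apply: ne; apply: disc_le_anti => //; rewrite -xz.
Qed.

Lemma disc_lt_nle x y : disc_lt x y -> ~ disc_le y x.
Proof. by move=> [xy ne] yx; apply: ne; exact: disc_le_anti. Qed.

Lemma disc_lt_gauss x : x <> xG -> disc_lt x xG.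
Proof. by move=> h; split => //; exact: disc_le_gauss. Qed.

Lemma disc_join_le x y : disc_le x y -> disc_join x y = y /\ disc_join y x = y.
Proof.
move=> xy; rewrite /disc_join; split; case: xgetP => [z _ [h1 h2 h3]|/(_ y)[]];
  try by split.
- by apply: disc_le_anti => //; exact: h3.
- by apply: disc_le_anti => //; exact: h3.
Qed.

Lemma segment_le x y z : disc_le x y ->
  (segment x y z <-> disc_le x z /\ disc_le z y) /\
  (segment y x z <-> disc_le x z /\ disc_le z y).
Proof.
move=> xy; rewrite /segment /mkset; have [-> ->] := disc_join_le xy.
by split; split=> [[zy [h|h]]|[xz zy]]; split=> //; first [by left | by right |
  exact: disc_le_trans xy h].
Qed.

Lemma disc_lt_radius z x y : 0 < r z -> disc_le z x -> disc_lt x y -> r x < r y.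
Proof.
move=> z0 zx [xy ne]; have x0 := radius_pos_above z0 zx.
rewrite ltNge; apply/negP => h; apply: ne.
by apply/esym/(above_radius_eq x0 xy).
Qed.

Lemma al_lt_disc x y : 0 < r x -> disc_lt x y -> al y < al x.
Proof. by move=> x0 [xy ne]; exact: al_lt. Qed.

Lemma disc_dist_le x y : 0 < r x -> disc_le x y ->
  disc_dist K x y = (al x - al y)%:E /\ disc_dist K y x = (al x - al y)%:E.
Proof.
move=> x0 xy; have y0 := radius_pos_above x0 xy.
have [ayx _] := al_diff x0 xy.
rewrite /disc_dist; have [-> ->] := disc_join_le xy.
rewrite eq_sym; have [->|ne] := eqVneq y x; first by rewrite subrr.
rewrite (alphaE_fin x0) (alphaE_fin y0) ereal_dist_sum.
have h : `|al x - al y| = al x - al y by rewrite ger0_norm// subr_ge0.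
by rewrite h addeC ereal_dist_sum h.
Qed.

(** For S finite and non-empty, the subtree spanned by S and the Gauss point. Subharmonicity is
    tested on no other subtrees. *)
Definition upset S : set (disc k) := [set u | exists2 z, S z & disc_le z u].

Lemma upset_admissible S : finite_set S -> S !=set0 ->
  (forall u, upset S u -> ~ rigid K u) -> admissible_subtree K (upset S).
Proof.
move=> fS [z0 Sz0] nr; split; last by exists z0 => //; exact: disc_le_gauss.
  exists (S `|` [set xG]); first by rewrite finite_setU.
  apply/seteqP; split=> [u [z Sz zu] Y [cY SY]|].
    apply: (cY z xG); [by apply: SY; left|by apply: SY; right|].
    by apply/(segment_le _ (disc_le_gauss z)).1; split => //; exact: disc_le_gauss.
  apply: smallest_sub.
    move=> x y [a Sa ax] [b Sb by_] z [_ [xz|yz]].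
      by exists a => //; exact: disc_le_trans xz.
    by exists b => //; exact: disc_le_trans yz.
  move=> u [Su|->]; first by exists u.
  by exists z0 => //; exact: disc_le_gauss.
exact: nr.
Qed.

Lemma upset_pos_admissible S : finite_set S -> S !=set0 ->
  (forall z, S z -> 0 < r z) -> admissible_subtree K (upset S).
Proof.
move=> fS S0 pS; apply: upset_admissible => // u [z Sz zu].
exact: radius_pos_not_rigid (radius_pos_above (pS z Sz) zu).
Qed.

Lemma clip01_lip s t : `|clip01 s - clip01 t| <= `|s - t|.
Proof.
wlog st : s t / s <= t => [h|].
  by have [/h//|/ltW/h] := leP s t; rewrite distrC (distrC s).
have h := clip01_le st.
rewrite distrC (distrC s) !ger0_norm ?subr_ge0//.
rewrite /clip01 /Num.max /Num.min; repeat case: ifPn; rewrite -?leNgt; lra.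
Qed.

Lemma flow_continuous z : continuous (fun t => flow z t : disc k).
Proof.
move=> t0; apply: berk_cvg => f; apply/cvgrPdist_lt => e e0.
have [d d0 hd] := flow_unif z f e0.
suff : \forall t \near t0, `|flow z t0 f - flow z t f| < e by [].
near=> t; rewrite -(flow_clip z t0) -(flow_clip z t); apply: hd; rewrite ?clip01_itv//.
apply: le_lt_trans (clip01_lip _ _) _; near: t.
exact: (nbhsx_ballx t0 d d0).
Unshelve. all: by end_near. Qed.

(** alpha varies no more than - log r, and the logarithm has Lipschitz constant 1 / r z on the radii
    met along the path, all at least r z. *)
Lemma al_flow_lip z s t : 0 < r z -> 0 <= s -> s <= t -> t <= 1 ->
  0 <= al (flow z s) - al (flow z t) <= (t - s) / r z.
Proof.
move=> z0 s0 st t1.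
have s01 : 0 <= s <= 1 by rewrite s0 (le_trans st).
have t01 : 0 <= t <= 1 by rewrite t1 (le_trans s0).
have fs0 : 0 < r (flow z s) by rewrite radius_flow// lt_max z0.
have hst : disc_le (flow z s) (flow z t) by exact: flow_mono.
have [h1 h2] := al_diff fs0 hst.
rewrite subr_ge0 h1/=; apply: le_trans h2 _.
rewrite /lrad opprK addrC !radius_flow//.
set a := Num.max (r z) t; set b := Num.max (r z) s.
have b0 : 0 < b by rewrite lt_max z0.
have a0 : 0 < a by rewrite lt_max z0.
have zb : r z <= b by rewrite le_max lexx.
have ab : a - b <= t - s.
  by rewrite /a /b /Num.max; repeat case: ifPn; rewrite -?leNgt; lra.
have ba : b <= a by rewrite ge_max !le_max lexx st orbT.
rewrite -ln_div ?posrE//.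
have -> : a / b = 1 + (a - b) / b.
  by rewrite mulrBl divff ?gt_eqF// addrC subrK.
have ab0 : 0 <= (a - b) / b by rewrite divr_ge0 ?subr_ge0// ltW.
apply: le_trans (le_ln1Dx _) _; first by apply: lt_le_trans ab0; rewrite ltrN10.
apply: (@le_trans _ _ ((t - s) / b)); first by rewrite ler_wpM2r// invr_ge0 ltW.
by rewrite ler_wpM2l ?subr_ge0// lef_pV2.
Qed.

Lemma al_flow_continuous z : 0 < r z -> continuous (fun t => al (flow z t)).
Proof.
move=> z0 t0; apply/cvgrPdist_lt => e e0.
have key s t : 0 <= s -> t <= 1 -> s <= t -> `|al (flow z s) - al (flow z t)| <= `|s - t| / r z.
  move=> s0 t1 st; have /andP[h1 h2] := al_flow_lip z0 s0 st t1.
  by rewrite ger0_norm// distrC ger0_norm ?subr_ge0.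
have key2 s t : 0 <= s <= 1 -> 0 <= t <= 1 ->
    `|al (flow z s) - al (flow z t)| <= `|s - t| / r z.
  move=> /andP[s0 s1] /andP[t0' t1]; have [st|ts] := leP s t; first exact: key.
  by rewrite distrC (distrC s); apply: key => //; exact: ltW.
near=> t; rewrite -(flow_clip z t0) -(flow_clip z t).
apply: le_lt_trans (key2 _ _ (clip01_itv _) (clip01_itv _)) _.
rewrite ltr_pdivrMr//; apply: le_lt_trans (clip01_lip _ _) _; near: t.
exact: (nbhsx_ballx t0 _ (mulr_gt0 e0 z0)).
Unshelve. all: by end_near. Qed.

End TreeGeometry.

Section Slopes.
Variables (R : realType).
Implicit Types x f : R.

Lemma slope_convex x0 x1 x2 f0 f1 f2 : x0 < x1 -> x1 < x2 ->
  (x2 - x0) * f1 <= (x2 - x1) * f0 + (x1 - x0) * f2 ->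
  (f1 - f2) / (x2 - x1) <= (f0 - f2) / (x2 - x0) /\
  (f0 - f2) / (x2 - x0) <= (f0 - f1) / (x1 - x0).
Proof.
move=> h01 h12 h.
have d1 : 0 < x1 - x0 by rewrite subr_gt0.
have d2 : 0 < x2 - x1 by rewrite subr_gt0.
have d3 : 0 < x2 - x0 by rewrite subr_gt0 (lt_trans h01).
split; rewrite ler_pdivrMr// mulrAC ler_pdivlMr//; nra.
Qed.

End Slopes.

Section Convexity.
Variables (R : realType) (k : nafield R) (K : completed_closure k).
Variables (c : R) (phi : disc k -> \bar R).
Hypotheses (c0 : 0 < c) (sub : subharmonic K c phi).
Implicit Types (u v w x y z a b : disc k) (s t d : R) (S Y : set (disc k)).
Local Notation r := (Defs.radius K).
Local Notation xG := (gauss_pt k).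
Local Notation al := (al K).

Definition fphi z : R := fine (phi z).

Lemma sub_on Y : admissible_subtree K Y -> subharmonic_on K c phi Y.
Proof. by move: sub => [_ h _]; exact: h. Qed.

Lemma upset1_admissible z : 0 < r z -> admissible_subtree K (upset [set z]).
Proof.
move=> z0; apply: upset_pos_admissible; first exact: finite_set1.
  by exists z.
by move=> _ ->.
Qed.

Lemma upset1 z u : disc_le z u -> upset [set z] u.
Proof. by exists z. Qed.

Lemma phi_fin z : 0 < r z -> phi z \is a fin_num.
Proof.
move=> z0; have [h _ _ _] := sub_on (upset1_admissible z0).
by apply: h; exact: upset1.
Qed.

Lemma phiE z : 0 < r z -> phi z = (fphi z)%:E.
Proof. by move=> z0; rewrite /fphi fineK// phi_fin. Qed.

Lemma phi_path_continuous z : 0 < r z -> continuous (fun t => fphi (flow z t)).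
Proof.
move=> z0 t0; have [_ hc _ _] := sub_on (upset1_admissible z0).
have Yf t : upset [set z] (flow z t) by apply: upset1; exact: flow_ge.
have pf t : 0 < r (flow z t) by apply: (radius_pos_above z0); exact: flow_ge.
have h := (subspace_continuousP (upset [set z]) phi).1 hc _ (Yf t0).
rewrite (phiE (pf t0)) in h.
apply: (fine_cvg (f := fun t => phi (flow z t))).
move=> A /h hA; have hB : nbhs (flow z t0) [set x | upset [set z] x -> A (phi x)] by exact: hA.
have hC : \forall t \near t0, upset [set z] (flow z t) -> A (phi (flow z t)).
  exact: (@flow_continuous _ _ z t0 _ hB).
suff : \forall t \near t0, A (phi (flow z t)) by [].
by apply: filterS hC => t; apply; exact: Yf.
Qed.

Lemma convex_lt x b a : 0 < r x -> disc_le x b -> disc_le b a -> a <> xG ->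
  (al x - al a) * fphi b <= (al x - al b) * fphi a + (al b - al a) * fphi x.
Proof.
move=> x0 xb ba axG; have [_ _ hc _] := sub_on (upset1_admissible x0).
have b0 := radius_pos_above x0 xb.
have xa := disc_le_trans xb ba.
have [dxa dax] := disc_dist_le x0 xa.
have [dxb dbx] := disc_dist_le x0 xb.
have [dba dab] := disc_dist_le b0 ba.
have nG : ~ segment x a xG.
  move/(segment_le _ xa).1 => [_ h]; apply: axG.
  by apply: disc_le_anti => //; exact: disc_le_gauss.
have := hc x a (upset1 (disc_le_refl x)) (upset1 xa) nG.
rewrite /convex_on_segment dxa => /(_ (ltry _)) /(_ b).
move=> /(_ ((segment_le b xa).1.2 (conj xb ba))).
by move=> h; rewrite [leRHS]addrC; move: h; rewrite dba dxb.
Qed.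

(** Subharmonicity gives convexity only on segments that avoid the Gauss point. For a = xG the upper
    end is made to tend to xG along the path, where phi and alpha are continuous. *)
Lemma convex_path x b a : 0 < r x -> disc_le x b -> disc_le b a ->
  (al x - al a) * fphi b <= (al x - al b) * fphi a + (al b - al a) * fphi x.
Proof.
move=> x0 xb ba; have [axG|] := pselect (a = xG); last exact: convex_lt.
have [bxG|bxG] := pselect (b = xG); first by rewrite axG bxG subrr mul0r addr0.
pose G t := (al x - al b) * fphi (flow x t) + (al b - al (flow x t)) * fphi x
  - (al x - al (flow x t)) * fphi b.
have Gc : continuous G.
  move=> t; apply: cvgB; first apply: cvgD.
  - by apply: cvgMl_tmp; exact: (phi_path_continuous x0).
  - apply: cvgMr_tmp; apply: cvgB; first exact: cvg_cst.
    exact: (al_flow_continuous x0).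
  - apply: cvgMr_tmp; apply: cvgB; first exact: cvg_cst.
    exact: (al_flow_continuous x0).
have G1 : 0 <= G 1.
  have rb := disc_lt_radius x0 xb (disc_lt_gauss bxG); rewrite radius_gauss in rb.
  apply: (cvgr_to_ge (cvg_at_left_filter (Gc 1))).
  near=> t.
  have tb : r b <= t by near: t; exact: nbhs_left_ge.
  have t1 : t < 1 by near: t; exact: nbhs_left_lt.
  have t0 : 0 <= t by apply: le_trans tb; case/andP: (radius_itv K b).
  have t01 : 0 <= t <= 1 by rewrite t0 ltW.
  have bt : disc_le b (flow x t).
    by rewrite (above_radius x0 xb).2; exact: flow_mono.
  rewrite /G subr_ge0; apply: convex_lt => // ht.
  have := radius_flow x0 t01; rewrite ht radius_gauss => h1.
  have rx : r x < 1 := le_lt_trans (above_radius x0 xb).1 rb.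
  have : Num.max (r x) t < 1 by rewrite gt_max rx t1.
  by rewrite -h1 ltxx.
by move: G1; rewrite /G flow1 axG subr_ge0.
Unshelve. all: by end_near. Qed.

(** For a above b, the average growth of phi per unit of alpha on the way up from b to a; alpha
    decreases on that way, whence the order in the denominator. *)
Definition slope a b : R := (fphi a - fphi b) / (al b - al a).

Lemma slope_mono x b a : 0 < r x -> disc_lt x b -> disc_lt b a ->
  slope b x <= slope a x /\ slope a x <= slope a b.
Proof.
move=> x0 xb ba; have b0 := radius_pos_above x0 (disc_lt_le xb).
apply: slope_convex.
- exact: al_lt_disc.
- exact: al_lt_disc.
- by apply: convex_path => //; exact: disc_lt_le.
Qed.

End Convexity.

(** * From the Laplacian condition to slopes *)

Section Laplacian.
Variables (R : realType) (k : nafield R) (K : completed_closure k).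
Variables (c : R) (phi : disc k -> \bar R).
Hypotheses (c0 : 0 < c) (sub : subharmonic K c phi).
Implicit Types (u v w x y z a b : disc k) (s t d : R) (S Y : set (disc k)).
Local Notation r := (Defs.radius K).
Local Notation xG := (gauss_pt k).
Local Notation al := (al K).
Local Notation fphi := (fphi phi).
Local Notation slope := (slope K phi).

(* flux_ge y s: the slope of phi just above y, that is the mass of the
   Laplacian below and at y, is at least s. *)
Definition flux_ge y s : Prop :=
  (forall a, disc_lt y a -> s <= slope a y) /\ (y = xG -> s <= c).

Lemma derivative_le y (D : set (disc k)) (l M : R) :
  has_dir_derivative K phi y D l ->
  (forall U : set (disc k), nbhs y U -> exists z, [/\ D z, U z &
     (fphi z - fphi y) / fine (disc_dist K y z) <= M]) -> l <= M.
Proof.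
move=> hl hU; rewrite leNgt; apply/negP => Ml.
have hN : nbhs y [set z | D z -> M < (fphi z - fphi y) / fine (disc_dist K y z)].
  exact: (cvgr_gt l hl _ Ml).
have [z [Dz Uz hz]] := hU _ hN.
by have := lt_le_trans (Uz Dz) hz; rewrite ltxx.
Qed.

Section AtPoint.
Variables (I : choiceType) (P : set I) (p : I -> disc k) (y : disc k).
Hypotheses (finP : finite_set P) (p0 : forall i, P i -> 0 < r (p i))
  (py : forall i, P i -> disc_lt (p i) y) (y0 : 0 < r y)
  (sep : forall i j, P i -> P j -> i <> j ->
     forall u, disc_lt u y -> ~ (disc_le (p i) u /\ disc_le (p j) u)).

Let S : set (disc k) := p @` P `|` [set y].
Let Y := upset S.

Let Y_pos z : Y z -> 0 < r z.
Proof.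
move=> [x [[i Pi <-]|->] xz]; first exact: radius_pos_above (p0 Pi) xz.
exact: radius_pos_above xz.
Qed.

Let Y_adm : admissible_subtree K Y.
Proof.
apply: upset_pos_admissible.
- by rewrite finite_setU; split=> //; exact: finite_image.
- by exists y; right.
- by move=> z Sz; apply: Y_pos; exists z.
Qed.

Let Yy : Y y. Proof. by exists y => //; right. Qed.
Let Yp i : P i -> Y (p i). Proof. by move=> Pi; exists (p i) => //; left; exists i. Qed.

Let Y_up z w : Y z -> disc_le z w -> Y w.
Proof. by move=> [x Sx xz] zw; exists x => //; exact: disc_le_trans zw. Qed.

Let Y_cmp z : Y z -> z <> y -> disc_lt y z \/ exists2 i, P i & disc_le (p i) z /\ disc_lt z y.
Proof.
move=> [x [[i Pi <-]|->] xz] zy; last by left; split => // /esym.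
have [zley|ylez] := disc_le_total xz (disc_lt_le (py Pi)); last by left; split => // /esym.
by right; exists i => //; split.
Qed.

(** The tangent direction at y towards p i. The hypothesis [sep] keeps these directions distinct for
    distinct i. *)
Let down i : set (disc k) :=
  [set z | [/\ Y z, disc_lt z y & exists u, [/\ disc_lt u y, disc_le (p i) u & disc_le z u]]].

Let up : set (disc k) := [set z | Y z /\ disc_lt y z].

Let dir_up z : disc_lt y z -> direction Y y z = up.
Proof.
move=> yz; have yz' := disc_lt_le yz; apply/seteqP; split=> z' /=.
  move=> [Yz' z'y [u [uy yzu yz'u]]].
  have [yu uz] := (segment_le u yz').1.1 yzu.
  split=> //; have [//|[i Pi [_ z'lt]]] := Y_cmp Yz' z'y.
  have [_ uy'] := (segment_le u (disc_lt_le z'lt)).2.1 yz'u.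
  by case: uy; apply: disc_le_anti.
move=> [Yz' yz'']; have yz3 := disc_lt_le yz''.
have ne x : disc_lt y x -> x <> y by move=> [_ h] /esym.
split; [by []|exact: ne|].
have [h|h] := disc_le_total yz' yz3.
  exists z; split; [exact: ne| |].
    by apply: (segment_le z yz').1.2; split=> //; exact: disc_le_refl.
  by apply: (segment_le z yz3).1.2; split.
exists z'; split; [exact: ne| |].
  by apply: (segment_le z' yz').1.2; split.
by apply: (segment_le z' yz3).1.2; split=> //; exact: disc_le_refl.
Qed.

Let dir_down z i : P i -> disc_le (p i) z -> disc_lt z y -> direction Y y z = down i.
Proof.
move=> Pi piz zy; have zy' := disc_lt_le zy; apply/seteqP; split=> z' /=.
  move=> [Yz' z'y [u [uy yzu yz'u]]].
  have [zu uy'] := (segment_le u zy').2.1 yzu.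
  have ult : disc_lt u y by split.
  have [yz'|[j Pj [pjz' z'lt]]] := Y_cmp Yz' z'y.
    have [yu _] := (segment_le u (disc_lt_le yz')).1.1 yz'u.
    by case: (disc_lt_nle ult).
  have [z'u _] := (segment_le u (disc_lt_le z'lt)).2.1 yz'u.
  by split=> //; exists u; split=> //; exact: disc_le_trans zu.
move=> [Yz' z'lt [u [uy piu z'u]]]; split; [by []|by case: z'lt|].
have seg x : disc_le z x -> disc_le z' x -> disc_lt x y ->
    [/\ x <> y, segment y z x & segment y z' x].
  move=> zx z'x xy; split; first by case: xy.
    by apply: (segment_le x zy').2.2; split=> //; exact: disc_lt_le.
  by apply: (segment_le x (disc_lt_le z'lt)).2.2; split=> //; exact: disc_lt_le.
have [h|h] := disc_le_total piz piu.
  by exists u; exact: seg.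
by exists z; apply: seg => //; exact: disc_le_trans h.
Qed.

Let tangentE : tangent Y y = (down @` P) `|` (if y == xG then set0 else [set up]).
Proof.
apply/seteqP; split=> D /=.
  move=> [z [Yz zy] <-].
  have [yz|[i Pi [piz zlt]]] := Y_cmp Yz zy; last first.
    by left; exists i => //; rewrite (dir_down Pi piz zlt).
  right; case: eqP => [yG|_]; last by rewrite dir_up.
  by case: (disc_lt_nle yz); rewrite yG; exact: disc_le_gauss.
move=> [[i Pi <-]|].
  exists (p i); first by split; [exact: Yp|case: (py Pi)].
  by rewrite (dir_down Pi (disc_le_refl _) (py Pi)).
case: eqP => // yG ->; exists xG.
  by split; [exact: Y_up Yy (disc_le_gauss y)|move/esym].
by apply: dir_up; exact: disc_lt_gauss.
Qed.

Let down_inj : set_inj P down.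
Proof.
move=> i j /set_mem Pi /set_mem Pj e; apply: contrapT => ij.
have : down i (p i).
  by split; [exact: Yp|exact: py|exists (p i); split => //; exact: py].
rewrite e => -[_ _ [u [uy pju piu]]].
exact: (sep Pi Pj ij uy).
Qed.

Let near_flow z t0 (U : set (disc k)) : nbhs (flow z t0) U ->
  exists2 d, 0 < d & forall t, `|t0 - t| < d -> U (flow z t).
Proof. by move=> /(@flow_continuous _ _ z t0)[d d0 h]; exists d => // t; exact: h. Qed.

(** Test the derivative at points z just below y on the path from p i: by convexity the slope from z
    to y is at least the slope from p i to y. *)
Let deriv_down i l : P i -> has_dir_derivative K phi y (down i) l -> l <= - slope y (p i).
Proof.
move=> Pi /derivative_le; apply=> U.
have piy := disc_lt_le (py Pi).
have [_ ye] := above_radius (p0 Pi) piy; rewrite {1}ye => /near_flow[d d0 hd].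
have rp : r (p i) < r y := disc_lt_radius (p0 Pi) (disc_le_refl _) (py Pi).
(* Within d / 2 of r y, hence in the given neighbourhood, but not below p i. *)
pose t := Num.max (r (p i)) (r y - d / 2).
have td : r y - d / 2 <= t by rewrite le_max lexx orbT.
have ty : t < r y by rewrite gt_max rp/= gtrBl divr_gt0.
have pt : r (p i) <= t by rewrite le_max lexx.
have t0 : 0 <= t by apply: le_trans pt; case/andP: (radius_itv K (p i)).
have t01 : 0 <= t <= 1 by rewrite t0 (le_trans (ltW ty))//; case/andP: (radius_itv K y).
pose z := flow (p i) t.
have piz : disc_le (p i) z by exact: flow_ge.
have rz : r z = t by rewrite radius_flow ?p0// (max_idPr pt).
have zy : disc_lt z y.
  split; first by rewrite ye; apply: flow_mono => //; exact: ltW.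
  by move=> zy; move: ty; rewrite -rz zy ltxx.
have z0 : 0 < r z := radius_pos_above (p0 Pi) piz.
exists z; split.
- split=> //; first exact: Y_up (Yp Pi) piz.
  by exists z; split=> //; exact: disc_le_refl.
- by apply: hd; rewrite ger0_norm ?subr_ge0 ?ltW//; move: d0 td; lra.
- have [_ ->] := disc_dist_le z0 (disc_lt_le zy).
  have -> : (fphi z - fphi y) / fine (al z - al y)%:E = - slope y z.
    by rewrite /slope/= -mulNr opprB.
  rewrite lerN2; have [->//|ne] := pselect (p i = z).
  by have [] := slope_mono sub (p0 Pi) (conj piz ne) zy.
Qed.

Let deriv_up l a : disc_lt y a -> has_dir_derivative K phi y up l -> l <= slope a y.
Proof.
move=> ya /derivative_le; apply=> U.
have e0 := (above_radius y0 (disc_le_refl y)).2; rewrite {1}e0 => /near_flow[d d0 hd].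
have rya : r y < r a := disc_lt_radius y0 (disc_le_refl _) ya.
pose t := Num.min (r a) (r y + d / 2).
have td : t <= r y + d / 2 by rewrite ge_min lexx orbT.
have yt : r y < t by rewrite lt_min rya/= ltrDl divr_gt0.
have ta : t <= r a by rewrite ge_min lexx.
have t1 : t <= 1 by apply: le_trans ta _; case/andP: (radius_itv K a).
have t01 : 0 <= t <= 1 by rewrite t1 andbT ltW// (lt_trans y0).
pose z := flow y t.
have yz' : disc_le y z by exact: flow_ge.
have rz : r z = t by rewrite radius_flow// (max_idPr (ltW yt)).
have yz : disc_lt y z by split=> // e; move: yt; rewrite -rz -e ltxx.
have za : disc_le z a.
  by rewrite (above_radius y0 (disc_lt_le ya)).2; exact: flow_mono.
exists z; split.
- by split=> //; exact: Y_up Yy yz'.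
- by apply: hd; rewrite ltr0_norm ?subr_lt0// opprB; move: d0 td; lra.
- have [-> _] := disc_dist_le y0 yz'; rewrite /= -/(slope z y).
  have [->//|ne] := pselect (z = a).
  by have [] := slope_mono sub y0 yz (conj za ne).
Qed.

(** On the subtree spanned by y and the p i, the Laplacian condition bounds the upward derivative
    from below by minus the sum of the downward ones. Convexity turns derivatives into slopes. At
    the Gauss point there is no upward direction, and the mass c takes its place. *)
Lemma laplacian_flux : flux_ge y (\sum_(i \in P) slope y (p i)).
Proof.
have [_ _ _ /(_ y Yy)[l [hl]]] := sub_on sub Y_adm.
have fin1 : finite_set (down @` P) by exact: finite_image.
have fin2 : finite_set (if y == xG then set0 else [set up] : set (set (disc k))).
  by case: ifP => _; [exact: finite_set0|exact: finite_set1].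
rewrite tangentE fsbigU//=; last first.
  move=> D [[i Pi <-]]; case: eqP => // yG e.
  have : up xG by split; [exact: Y_up Yy (disc_le_gauss y)|exact: disc_lt_gauss].
  rewrite -e => -[_ h _]; case: (disc_lt_nle h); exact: disc_le_gauss.
rewrite fsbig_image//.
have hd : \sum_(i \in P) l (down i) <= - \sum_(i \in P) slope y (p i).
  rewrite !fsbig_finite//= -sumrN big_seq [leRHS]big_seq; apply: ler_sum => i.
  rewrite in_fset_set// => /set_mem Pi; apply: (deriv_down Pi); apply: hl.
  by rewrite tangentE; left; exists i.
move: hd; set A := \sum_(_ \in P) _; set B := \sum_(_ \in P) _ => hd h.
split=> [a ya|yG].
  move: h; case: eqP => [yG|yG].
    by case: (disc_lt_nle ya); rewrite yG; exact: disc_le_gauss.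
  have hu : l up <= slope a y.
    apply: deriv_up => //; apply: hl; rewrite tangentE; right.
    by case: eqP.
  by rewrite fsbig_set1; move: hd hu; lra.
by move: h; rewrite yG eqxx fsbig_set0; move: hd; lra.
Qed.

End AtPoint.

End Laplacian.

(** * Counting antichains of steep points *)

Section Antichains.
Variables (R : realType) (k : nafield R) (K : completed_closure k).
Variables (c : R) (phi : disc k -> \bar R).
Hypotheses (c0 : 0 < c) (sub : subharmonic K c phi).
Implicit Types (u v w x y z a b : disc k) (s t d : R).
Local Notation r := (Defs.radius K).
Local Notation xG := (gauss_pt k).
Local Notation al := (al K).
Local Notation fphi := (fphi phi).
Local Notation slope := (slope K phi).
Local Notation flux_ge := (flux_ge K c phi).

Definition steep u : Prop :=
  0 < r u /\ exists z, [/\ 0 < r z, disc_lt z u & 1 / 2 < slope u z].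

Lemma flux_ge_le y s s' : s' <= s -> flux_ge y s -> flux_ge y s'.
Proof.
move=> ss [h1 h2]; split=> [a /h1|/h2]; exact: le_trans.
Qed.

Lemma flux_single z y : 0 < r z -> disc_lt z y -> flux_ge y (slope y z).
Proof.
move=> z0 zy; have y0 := radius_pos_above z0 (disc_lt_le zy).
have := @laplacian_flux _ _ _ _ _ sub unit [set tt] (fun=> z) y (finite_set1 _)
  (fun _ _ => z0) (fun _ _ => zy) y0.
by rewrite fsbig_set1; apply; move=> [] [].
Qed.

Lemma slope_root z : 0 < r z -> disc_lt z xG -> slope xG z <= c.
Proof. by move=> z0 zG; have [_ h] := flux_single z0 zG; exact: h. Qed.

(** The flux at y is at most the slope from y up to the Gauss point, and that slope is part of the
    flux at the Gauss point, where c bounds it. *)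
Lemma flux_ge_bound y s : 0 < r y -> flux_ge y s -> s <= c.
Proof.
move=> y0 [h1 h2]; have [/h2//|yG] := pselect (y = xG).
have yG' := disc_lt_gauss yG.
exact: le_trans (h1 _ yG') (slope_root y0 yG').
Qed.

Lemma steep_flux u : steep u -> flux_ge u (1 / 2).
Proof.
move=> [u0 [z [z0 zu h]]]; apply: flux_ge_le (ltW h) _.
exact: flux_single.
Qed.

(** Everything above u i0 lies on one path, so the least upper bound sits at the infimum of the
    heights at which that path dominates all the u i. *)
Lemma finite_join (T : finType) (A : {set T}) (u : T -> disc k) i0 : i0 \in A ->
  exists y, (forall i, i \in A -> disc_le (u i) y) /\
    (forall w, (forall i, i \in A -> disc_le (u i) w) -> disc_le y w).
Proof.
move=> Ai0; pose Q := [set t : R | 0 <= t <= 1 /\ forall i, i \in A -> disc_le (u i) (flow (u i0) t)].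
have Q1 : Q 1.
  split; first by rewrite ler01 lexx.
  by move=> i _; rewrite flow1; exact: disc_le_gauss.
have infQ : has_inf Q by split; [exists 1|exists 0 => t [/andP[]]].
have t01 : 0 <= inf Q <= 1.
  apply/andP; split; first by apply: lb_le_inf; [exists 1|move=> t [/andP[]]].
  by apply: ge_inf => //; case: infQ.
exists (flow (u i0) (inf Q)); split.
  move=> i Ai; apply: flow_ge_closed => // d d0.
  have [t [tt1 Qt] td] := inf_adherent d0 infQ.
  exists t; split=> //; last exact: Qt.
  have it : inf Q <= t by apply: ge_inf => //; case: infQ.
  by rewrite ger0_norm ?subr_ge0//; lra.
move=> w hw; have [t tt1 wt] := disc_above (hw _ Ai0).
rewrite wt; apply: flow_mono => //.
apply: ge_inf; first by case: infQ.
by split=> // i Ai; rewrite -wt; exact: hw.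
Qed.

Section Induction.
Variables (T : finType) (u : T -> disc k).

Definition antichain (A : {set T}) :=
  forall i j, i \in A -> j \in A -> i <> j -> ~ disc_le (u i) (u j).

Lemma chain_upper_bound x y (s : seq T) : disc_lt x y ->
  (forall i, i \in s -> exists v, [/\ disc_lt v y, disc_le x v & disc_le (u i) v]) ->
  exists v, [/\ disc_lt v y, disc_le x v & forall i, i \in s -> disc_le (u i) v].
Proof.
move=> xy; elim: s => [|j s ih] h; first by exists x; split.
have [|v [vy xv hv]] := ih; first by move=> i si; apply: h; rewrite inE si orbT.
have [w [wy xw jw]] := h j (mem_head _ _).
have [vw|wv] := disc_le_total xv xw.
  exists w; split=> // i; rewrite inE => /predU1P[->//|/hv h2].
  exact: disc_le_trans h2 vw.
exists v; split=> // i; rewrite inE => /predU1P[->|/hv//].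
exact: disc_le_trans jw wv.
Qed.

(** Induction on the number of points. At their least upper bound y, group the points by branch
    below y. A branch has an upper bound strictly below y, so it cannot contain all of A and
    induction applies to it. The points found on the branches lie in distinct directions at y, and
    [laplacian_flux] adds up their fluxes. *)
Lemma antichain_flux (A : {set T}) : A != finset.set0 -> antichain A ->
  (forall i, i \in A -> steep (u i)) ->
  exists y, [/\ 0 < r y, forall i, i \in A -> disc_le (u i) y,
    (forall w, (forall i, i \in A -> disc_le (u i) w) -> disc_le y w) &
    flux_ge y (#|A|%:R / 2)].
Proof.
have [n] := ubnP #|A|; elim: n A => // n ih A; rewrite ltnS => An A0 anti st.
have /set0Pn[i0 Ai0] := A0.
have [y [yub ylub]] := finite_join u Ai0.
have y0 : 0 < r y := radius_pos_above (st _ Ai0).1 (yub _ Ai0).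
have [A1|A1] := leqP #|A| 1.
  have /cards1P[i Ai] : #|A| == 1%N by rewrite eqn_leq A1 card_gt0.
  have yi : y = u i.
    apply: disc_le_anti; last by apply: yub; rewrite Ai inE.
    by apply: ylub => j; rewrite Ai inE => /eqP ->; exact: disc_le_refl.
  exists y; split=> //; rewrite Ai cards1 yi; apply: steep_flux; apply: st.
  by rewrite Ai inE.
have ulty i : i \in A -> disc_lt (u i) y.
  move=> Ai; split; first exact: yub.
  move=> e; move: A1; rewrite (cardsD1 i) Ai ltnS card_gt0 => /set0Pn[j].
  rewrite !inE => /andP[ji Aj]; apply: (anti j i) => //; first exact/eqP.
  by rewrite e; exact: yub.
(* u i and u j lie on the same branch below y; transitivity is [disc_le_total]. *)
pose rel i j := `[< exists v, [/\ disc_lt v y, disc_le (u i) v & disc_le (u j) v] >].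
have eqR : {in A & &, equivalence_rel rel}.
  move=> i j l Ai Aj Al; split.
    by apply/asboolP; exists (u l); split=> //; exact: ulty.
  have tr (a b d : T) : rel a b -> rel b d -> rel a d.
    move=> /asboolP[v [vy av bv]] /asboolP[w [wy bw dw]]; apply/asboolP.
    have [vw|wv] := disc_le_total bv bw.
      by exists w; split=> //; exact: disc_le_trans vw.
    by exists v; split=> //; exact: disc_le_trans wv.
  have sy (a b : T) : rel a b -> rel b a.
    by move=> /asboolP[v [h1 h2 h3]]; apply/asboolP; exists v.
  move=> ij; apply/idP/idP => h; first exact: tr (sy _ _ ij) h.
  exact: tr ij h.
pose Part := equivalence_partition rel A.
have partP := equivalence_partitionP eqR.
have relC J i j : J \in Part -> i \in J -> j \in J -> rel i j.
  move=> /imsetP[x Ax ->]; rewrite !inE => /andP[Ai xi] /andP[Aj xj].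
  have [_ h] := eqR x i j Ax Ai Aj; by rewrite -(h xi).
have subA (J : {set T}) : J \in Part -> {subset J <= A}.
  by move=> /imsetP[x Ax ->] i; rewrite inE => /andP[].
have neJ (J : {set T}) : J \in Part -> exists i, i \in J.
  move=> /imsetP[x Ax ->]; exists x; rewrite inE Ax.
  by have [] := eqR x x x Ax Ax Ax.
have ubJ (J : {set T}) : J \in Part -> exists2 v, disc_lt v y & forall i, i \in J -> disc_le (u i) v.
  move=> PJ; have [x Jx] := neJ J PJ.
  have [|v [vy _ hv]] := @chain_upper_bound (u x) y (enum J) (ulty x (subA _ PJ x Jx)).
    by move=> i; rewrite mem_enum => Ji; apply/asboolP; exact: relC PJ Jx Ji.
  by exists v => // i Ji; apply: hv; rewrite mem_enum.
have /choice[p hp] : forall J : {set T}, exists yJ, J \in Part ->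
    [/\ 0 < r yJ, disc_lt yJ y, forall i, i \in J -> disc_le (u i) yJ &
        flux_ge yJ (#|J|%:R / 2)].
  move=> J; have [PJ|//] := boolP (J \in Part); last by exists y.
  have [v vy hv] := ubJ J PJ.
  have JA : (#|J| < #|A|)%N.
    rewrite proper_card// properE; apply/andP; split; first exact/fintype.subsetP/subA.
    apply/negP => /fintype.subsetP AJ; apply: (disc_lt_nle vy); apply: ylub => i Ai.
    by apply: hv; exact: AJ.
  have [||||yJ [h1 h2 h3 h4]] := ih J.
  - exact: leq_trans An.
  - by apply/set0Pn; exact: neJ.
  - by move=> i j Ji Jj; apply: anti; exact: (subA _ PJ).
  - by move=> i Ji; apply: st; exact: (subA _ PJ).
  exists yJ => _; split=> //; apply: disc_le_lt_trans vy; exact: h3.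
have hflux : flux_ge y (\sum_(J \in [set` enum Part]) slope y (p J)).
  apply: (laplacian_flux sub) => //.
  - by move=> J; rewrite /= mem_enum => /hp[].
  - by move=> J; rewrite /= mem_enum => /hp[].
  move=> J J'; rewrite /= !mem_enum => PJ PJ' JJ' w wy [h h'].
  have [i Ji] := neJ _ PJ; have [j Jj] := neJ _ PJ'.
  have ij : rel i j.
    apply/asboolP; exists w; split=> //.
      by apply: disc_le_trans h; have [_ _ h2 _] := hp _ PJ; exact: h2.
    by apply: disc_le_trans h'; have [_ _ h2 _] := hp _ PJ'; exact: h2.
  apply: JJ'; have Ai := subA _ PJ i Ji; have Aj := subA _ PJ' j Jj.
  apply/setP => l; have [Al|nAl] := boolP (l \in A); last first.
    by apply/idP/idP => /subA h2; rewrite h2 in nAl.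
  move: PJ PJ' Ji Jj => /imsetP[x Ax ->] /imsetP[x' Ax' ->].
  rewrite !inE Al Ai Aj /= => xi xj'.
  have [_ e1] := eqR x i l Ax Ai Al; have [_ e2] := eqR x' j l Ax' Aj Al.
  by have [_ e3] := eqR i j l Ai Aj Al; rewrite e1// e2// e3.
exists y; split=> //; apply: flux_ge_le hflux.
rewrite -fsbig_seq ?enum_uniq// big_enum/= (card_partition partP) natr_sum mulr_suml.
apply: ler_sum => J PJ; have [h1 h2 h3 [h4 _]] := hp J PJ; exact: h4.
Qed.

Lemma antichain_card (A : {set T}) : antichain A ->
  (forall i, i \in A -> steep (u i)) -> #|A|%:R <= 2 * c.
Proof.
move=> anti st; have [->|A0] := eqVneq A finset.set0.
  by rewrite cards0 mulr_ge0// ltW.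
have [y [y0 _ _ hf]] := antichain_flux A0 anti st.
by have := flux_ge_bound y0 hf; rewrite ler_pdivrMr// mulrC.
Qed.

End Induction.

End Antichains.

(** * Growth of phi *)

Section Ends.
Variables (R : realType) (k : nafield R) (K : completed_closure k).
Variables (c : R) (phi : disc k -> \bar R).
Hypotheses (c0 : 0 < c) (sub : subharmonic K c phi).
Implicit Types (u v w x y z a b e : disc k) (s t d : R).
Local Notation r := (Defs.radius K).
Local Notation xG := (gauss_pt k).
Local Notation al := (al K).
Local Notation fphi := (fphi phi).
Local Notation slope := (slope K phi).
Local Notation steep := (steep K phi).

(** Convexity propagates steepness upwards along a path. *)
Lemma steep_slope u v : steep u -> disc_lt u v -> 1 / 2 < slope v u.
Proof.
move=> [u0 [z [z0 zu h]]] uv.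
have [h1 h2] := slope_mono sub z0 zu uv.
exact: lt_le_trans h (le_trans h1 h2).
Qed.

Lemma not_steep z u : 0 < r z -> disc_le z u -> ~ steep u ->
  fphi u - fphi z <= (al z - al u) / 2.
Proof.
move=> z0 zu ns; have [<-|ne] := pselect (z = u); first by rewrite !subrr mul0r.
have zu' : disc_lt z u by [].
have d0 : 0 < al z - al u by rewrite subr_gt0; exact: al_lt_disc.
rewrite leNgt; apply/negP => lt1; apply: ns; split; first exact: radius_pos_above zu.
exists z; split=> //; rewrite /slope ltr_pdivlMr//; lra.
Qed.

Lemma root_bound z : 0 < r z -> fphi xG - fphi z <= c * al z.
Proof.
move=> z0; have [->|zG] := pselect (z = xG).
  by rewrite subrr mulr_ge0 ?(ltW c0)// al_ge0// radius_gauss.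
have zG' := disc_lt_gauss zG.
have := slope_root sub z0 zG'; rewrite /slope al_gauss subr0.
have a0 : 0 < al z by rewrite -(al_gauss K); exact: al_lt_disc.
by rewrite ler_pdivrMr.
Qed.

Definition incomparable n (u : 'I_n -> disc k) :=
  forall i j, i <> j -> ~ disc_le (u i) (u j).

Lemma max_steep_antichain : exists n (u : 'I_n -> disc k),
  [/\ forall i, steep (u i), incomparable u &
    forall (v : 'I_n.+1 -> disc k), (forall i, steep (v i)) -> ~ incomparable v].
Proof.
pose Q n := `[< exists u : 'I_n -> disc k, (forall i, steep (u i)) /\ incomparable u >].
have Q0 : exists n, Q n.
  by exists 0%N; apply/asboolP; exists (fun=> xG); split=> [[]|[]].
have Qb n : Q n -> (n <= Num.bound (2 * c))%N.
  move=> /asboolP[u [su iu]].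
  have := @antichain_card _ _ _ _ _ c0 sub _ u [set: 'I_n]%SET.
  rewrite cardsT card_ord => /(_ _ (fun i _ => su i)) h.
  rewrite -(ler_nat R) ltW// (le_lt_trans (h _))// ?archi_boundP ?mulr_ge0 ?ltW//.
  by move=> i j _ _; exact: iu.
have [n /asboolP[u [su iu]] nmax] := ex_maxnP Q0 Qb.
exists n, u; split=> // v sv iv.
have : Q n.+1 by apply/asboolP; exists v.
by move=> /nmax; rewrite ltnn.
Qed.

(** In an antichain of maximal size, a steep point incomparable with all the u i could be added, and
    two incomparable steep points below u i could replace it; either would give one point more. *)
Lemma steep_ends : exists n (u : 'I_n -> disc k),
  [/\ forall i, steep (u i),
    forall v, steep v -> exists i, disc_le v (u i) \/ disc_le (u i) v &
    forall i v w, steep v -> steep w -> disc_le v (u i) -> disc_le w (u i) ->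
      disc_le v w \/ disc_le w v].
Proof.
have [n [u [su iu umax]]] := max_steep_antichain.
exists n, u; split=> // [v sv|i v w sv sw vi wi]; apply: contrapT => h.
  have hl i : ~ disc_le v (u i) by move=> h1; apply: h; exists i; left.
  have hr i : ~ disc_le (u i) v by move=> h1; apply: h; exists i; right.
  pose f (j : 'I_n.+1) := if unlift ord0 j is Some i then u i else v.
  apply: (umax f); first by move=> j; rewrite /f; case: unliftP.
  move=> j l jl; rewrite /f; case: unliftP => [j' ej|ej]; case: unliftP => [l' el|el] //.
    by apply: iu => e; apply: jl; rewrite ej el e.
  by case: jl; rewrite ej el.
have hvw : ~ disc_le v w by move=> h1; apply: h; left.
have hwv : ~ disc_le w v by move=> h1; apply: h; right.
pose f (j : 'I_n.+1) := if unlift ord0 j is Some l then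
  (if l == i then w else u l) else v.
have key x l : disc_le x (u i) -> l != i -> ~ disc_le x (u l) /\ ~ disc_le (u l) x.
  move=> xi li; split=> h1; last first.
    by apply: (iu l i); [exact/eqP|exact: disc_le_trans xi].
  have [h2|h2] := disc_le_total h1 xi; first by apply: (iu l i) => //; exact/eqP.
  by apply: (iu i l) => //; apply/nesym/eqP.
apply: (umax f); first by move=> j; rewrite /f; case: unliftP => // l _; case: ifP.
move=> j l jl; rewrite /f; case: unliftP => [j' ej|ej]; case: unliftP => [l' el|el].
- have [ji|ji] := eqVneq j' i; have [li|li] := eqVneq l' i.
  + by case: jl; rewrite ej el ji li.
  + by have [] := key w l' wi li.
  + by have [] := key w j' wi ji.
  + by apply: iu => e; apply: jl; rewrite ej el e.
- by have [//|ji] := eqVneq j' i; have [] := key v j' vi ji.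
- by have [//|li] := eqVneq l' i; have [] := key v l' vi li.
- by case: jl; rewrite ej el.
Qed.

End Ends.

Section ProductBound.
Variable R : realType.

Lemma ler_mul_addgt0 (x a b : R) : 0 <= a -> 0 <= b ->
  (forall e, 0 < e -> x <= (a + e) * (b + e)) -> x <= a * b.
Proof.
move=> a0 b0 h; apply/ler_addgt0Pr => e e0.
have K0 : 0 < a + b + 1 by lra.
pose d := Num.min 1 (e / (a + b + 1)).
have d0 : 0 < d by rewrite lt_min ltr01 divr_gt0.
have d1 : d <= 1 by rewrite ge_min lexx.
have dK : d * (a + b + 1) <= e by rewrite -ler_pdivlMr// ge_min lexx orbT.
by apply: (le_trans (h d d0)); nra.
Qed.

End ProductBound.

Section ChainInf.
Variables (R : realType) (k : nafield R) (B : banachAlg k).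
Variables (C : set (berk B)) (x0 : berk B).
Hypotheses (Cx0 : C x0)
  (chain : forall x y, C x -> C y -> (forall f, x f <= y f) \/ (forall f, y f <= x f)).

Let N (f : B) : R := inf [set x f | x in C].

Let has_infN f : has_inf [set x f | x in C].
Proof.
split; first by exists (x0 f); exists x0.
by exists 0 => _ [x _ <-]; exact: berk_ge0.
Qed.

Let N_le f x : C x -> N f <= x f.
Proof. by move=> Cx; apply: ge_inf; [case: (has_infN f)|exists x]. Qed.

Let N_adh f e : 0 < e -> exists2 x, C x & x f < N f + e.
Proof. by move=> e0; have [_ [x Cx <-] h] := inf_adherent e0 (has_infN f); exists x. Qed.

Let N_ge f M : (forall x, C x -> M <= x f) -> M <= N f.
Proof.
move=> h; apply: lb_le_inf; first by have [] := has_infN f.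
by move=> _ [x Cx <-]; exact: h.
Qed.

Let N_adh2 f g e : 0 < e -> exists x, [/\ C x, x f < N f + e & x g < N g + e].
Proof.
move=> e0; have [x Cx hx] := N_adh f e0; have [y Cy hy] := N_adh g e0.
have [xy|yx] := chain Cx Cy.
  by exists x; split=> //; exact: le_lt_trans hy.
by exists y; split=> //; exact: le_lt_trans hx.
Qed.

Lemma chain_inf : exists e : berk B, (forall x f, C x -> e f <= x f) /\
  (forall f d, 0 < d -> exists2 x, C x & x f < e f + d).
Proof.
have N0 f : 0 <= N f by apply: N_ge => x _; exact: berk_ge0.
have N1 : N 1 = 1.
  apply/le_anti/andP; split; first by rewrite -(berk1 x0) N_le.
  by apply: N_ge => x _; rewrite berk1.
have ND f g : N (f + g) <= N f + N g.
  apply/ler_addgt0Pr => e e0; have e2 : 0 < e / 2 by rewrite divr_gt0.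
  have [x [Cx h1 h2]] := N_adh2 f g e2.
  apply: le_trans (N_le _ Cx) _; apply: le_trans (berkD _ _ _) _; lra.
have NM f g : N (f * g) = N f * N g.
  apply/le_anti/andP; split; last first.
    by apply: N_ge => x Cx; rewrite berkM ler_pM ?N_le.
  apply: ler_mul_addgt0 => // e e0; have [x [Cx h1 h2]] := N_adh2 f g e0.
  apply: le_trans (N_le _ Cx) _; rewrite berkM.
  by rewrite ler_pM ?berk_ge0 ?ltW.
have NC a : N (bconst B a) = nabs a.
  apply/le_anti/andP; split; first by rewrite -(berk_const x0) N_le.
  by apply: N_ge => x _; rewrite berk_const.
have Nle f : N f <= bnorm B f by apply: le_trans (N_le f Cx0) (berk_le _ _).
by exists (Berk N0 N1 NM ND NC Nle); split=> [x f Cx|f d d0]; [exact: N_le|exact: N_adh].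
Qed.

End ChainInf.

Section Poles.
Variables (R : realType) (k : nafield R) (K : completed_closure k).
Variables (c : R) (phi : disc k -> \bar R).
Hypotheses (c0 : 0 < c) (sub : subharmonic K c phi).
Implicit Types (u v w x y z a b e : disc k) (s t d : R).
Local Notation r := (Defs.radius K).
Local Notation xG := (gauss_pt k).
Local Notation al := (al K).
Local Notation fphi := (fphi phi).
Local Notation slope := (slope K phi).
Local Notation steep := (steep K phi).

(* A non-rigid limit e of steep points at infinite distance is impossible, since
   phi is finite and continuous at e but tends to -oo along the steep points. *)
Lemma steep_chain_end (C : set (disc k)) : (forall v, C v -> steep v) ->
  (forall v w, C v -> C w -> disc_le v w \/ disc_le w v) ->
  exists L e, (forall v, C v -> al v <= L) \/
    (rigid K e /\ forall v, C v -> disc_le e v).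
Proof.
move=> sC chC.
have [[L hL]|unb] := pselect (exists L, forall v, C v -> al v <= L).
  by exists L, xG; left.
have {}unb L : exists2 v, C v & L < al v.
  apply: contrapT => h; apply: unb; exists L => v Cv; rewrite leNgt; apply/negP => lt1.
  by apply: h; exists v.
have [v0 Cv0 _] := unb 0.
have [e [eC eadh]] := chain_inf Cv0 chC.
exists 0, e; have [re|nre] := pselect (rigid K e).
  by right; split=> // v Cv f; exact: eC.
exfalso.
have Yadm : admissible_subtree K (upset [set e]).
  apply: upset_admissible; [exact: finite_set1|by exists e|].
  move=> u [_ -> eu] ru; have [_ [p up]] := rigid_killed ru.
  (* A rigid point u above e is killed by a polynomial, which then kills e too; so e = u would be
     rigid. *)
  apply: nre; have -> : e = u; last by [].
  apply: (killer_unique up); have [_ up0 _] := up.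
  by apply/le_anti; rewrite berk_ge0 andbT -up0.
have [hfin hc _ _] := sub_on sub Yadm.
have ee : upset [set e] e by exists e.
have h := (subspace_continuousP (upset [set e]) phi).1 hc _ ee.
have phie : phi e = (fphi e)%:E by rewrite /fphi fineK// hfin.
rewrite phie in h; have h2 := fine_cvg h.
have near1 : nbhs e [set x | upset [set e] x -> fphi e - 1 < fphi x].
  have lt1 : fphi e - 1 < fphi e by rewrite ltrBlDr ltrDl.
  have h3 := cvgr_gt (fphi e) (h2 _) _ lt1.
  exact: h3.
have /choice[v hv] : forall n : nat, exists v, C v /\ n%:R < al v.
  by move=> n; have [v Cv hv] := unb n%:R; exists v.
(* As alpha (v n) tends to infinity, v n ends up below any given w in C, so its values are squeezed
   between those of e and w. *)
have ve : v @ \oo --> e.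
  apply: berk_cvg => f; apply/cvgrPdist_lt => d d0.
  have [w Cw hw] := eadh f d d0.
  have w0 := (sC w Cw).1.
  suff : \forall n \near \oo, `|e f - v n f| < d by [].
  exists (Num.bound (al w)) => // n /= wn.
  have vw : disc_le (v n) w.
    have [//|wv] := chC _ _ (hv n).1 Cw.
    have [h3 _] := al_diff w0 wv.
    have h4 : al w < n%:R.
      by rewrite (lt_le_trans (archi_boundP (al_ge0 w0)))// ler_nat.
    by have := lt_le_trans (lt_trans h4 (hv n).2) h3; rewrite ltxx.
  have h3 := eC (v n) f (hv n).1.
  rewrite ler0_norm ?subr_le0// opprB ltrBlDl.
  by apply: le_lt_trans hw; exact: vw.
have [n0 _ hn0] := ve _ near1.
have fin_big (M : R) : exists n, (n0 <= n)%N /\ M <= n%:R.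
  exists (maxn n0 (Num.bound `|M|)); rewrite leq_maxl; split=> //.
  apply: le_trans (ler_norm M) _; apply: ltW.
  by rewrite (lt_le_trans (archi_boundP (normr_ge0 M)))// ler_nat leq_maxr.
(* Once alpha (v n) exceeds M, a slope above 1/2 between v n and v0 pushes phi (v n) below phi e -
   1. *)
pose M := al v0 + 2 * (fphi v0 - fphi e + 1).
have [n [nn0 Mn]] := fin_big (Num.max M (al v0)).
have [Mn1 Mn2] : M <= n%:R /\ al v0 <= n%:R.
  by move: Mn; rewrite ge_max => /andP[].
have [Cvn avn] := hv n.
have ph : fphi e - 1 < fphi (v n).
  by apply: (hn0 n nn0); exists e => // f; exact: eC.
have st := sC _ Cvn; have vn0 := st.1; have v00 := (sC _ Cv0).1.
have vlt : disc_lt (v n) v0.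
  have [h3|h3] := chC _ _ Cvn Cv0.
    by split=> // e1; move: (le_lt_trans Mn2 avn); rewrite e1 ltxx.
  have [h4 _] := al_diff v00 h3.
  by move: (lt_le_trans avn h4); rewrite ltNge Mn2.
have := steep_slope sub st vlt; rewrite /slope ltr_pdivlMr; last first.
  by rewrite subr_gt0; exact: al_lt_disc.
move: Mn1; rewrite /M; move: ph avn; lra.
Qed.

(** Each steep point is above some u i, where alpha is at most alpha (u i), or below one, and the
    steep points below u i form a chain to which [steep_chain_end] applies. *)
Lemma steep_bound : exists L (E : seq (disc k)), (forall e, e \in E -> rigid K e) /\
  forall u, steep u -> al u <= L \/ exists2 e, e \in E & disc_le e u.
Proof.
have [n [u [su hcmp hch]]] := steep_ends c0 sub.
have /choice[Le hLe] : forall i : 'I_n, exists Le : R * disc k,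
    (forall v, steep v -> disc_le v (u i) -> al v <= Le.1) \/
    (rigid K Le.2 /\ forall v, steep v -> disc_le v (u i) -> disc_le Le.2 v).
  move=> i; have [||L [e h]] := @steep_chain_end [set v | steep v /\ disc_le v (u i)].
  - by move=> v [].
  - by move=> v w [sv vi] [sw wi]; exact: hch vi wi.
  exists (L, e); case: h => [h|[re h]]; [left|right]; first by move=> v sv vi; exact: h.
  by split=> // v sv vi; exact: h.
pose L := \sum_i (`|(Le i).1| + al (u i)).
have Li i : (Le i).1 <= L /\ al (u i) <= L.
  have pos j : 0 <= `|(Le j).1| + al (u j).
    by rewrite addr_ge0// al_ge0//; case: (su j).
  have h : `|(Le i).1| + al (u i) <= L.
    by rewrite /L (bigD1 i)//= lerDl sumr_ge0.
  have a0 : 0 <= al (u i) by rewrite al_ge0//; case: (su i).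
  have := ler_norm (Le i).1; have := normr_ge0 (Le i).1; lra.
exists L, [seq (Le i).2 | i <- enum 'I_n & `[< rigid K (Le i).2 >]]; split.
  by move=> e /mapP[i]; rewrite mem_filter => /andP[/asboolP re _] ->.
move=> v sv; have [i [vi|iv]] := hcmp v sv.
  have [h|[re h]] := hLe i; first by left; apply: le_trans (Li i).1; exact: h.
  right; exists (Le i).2; last exact: h.
  by apply/mapP; exists i => //; rewrite mem_filter mem_enum andbT; exact/asboolP.
left; apply: le_trans (Li i).2; have [//] := al_diff (su i).1 iv.
Qed.

Lemma al_le_radius z u : 0 < r z -> disc_le z u -> al z <= al u + (r u - r z) / r z.
Proof.
move=> z0 zu; have [zr ue] := above_radius z0 zu.
have [_ ze] := above_radius z0 (disc_le_refl z).
have /andP[z00 z01] := radius_itv K z; have /andP[_ u1] := radius_itv K u.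
have := al_flow_lip z0 z00 zr u1; rewrite -ue -ze => /andP[_]; lra.
Qed.

Lemma phi_lower_bound : exists C, forall z, 0 < r z ->
  - fphi z <= C + al z / 2 \/
  exists u, [/\ steep u, disc_le z u & - fphi z <= C + c * al u + al z / 2].
Proof.
exists (`|fphi xG| + 3 * c) => z z0.
have nG := ler_norm (- fphi xG); rewrite normrN in nG.
pose T := [set r u | u in [set u | steep u /\ disc_le z u]].
have [[u1 [su1 zu1]]|none] := pselect (exists u, steep u /\ disc_le z u); last first.
  left; have := not_steep z0 (disc_le_gauss z) (fun h => none (ex_intro _ _ (conj h (disc_le_gauss z)))).
  by rewrite al_gauss subr0; move: nG c0; lra.
right; have infT : has_inf T.
  split; first by exists (r u1); exists u1.
  by exists (r z) => _ [u [_ zu] <-]; have [] := above_radius z0 zu.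
have zT : r z <= inf T.
  apply: lb_le_inf; first by have [] := infT.
  by move=> _ [u [_ zu] <-]; have [] := above_radius z0 zu.
have T0 : 0 < inf T by exact: lt_le_trans zT.
have [_ [u [su zu] <-] hu] := inf_adherent T0 infT.
have u0 := su.1.
have Tu : inf T <= r u by apply: ge_inf; [case: infT|exists u].
exists u; split=> //.
have au0 := al_ge0 u0; have az0 := al_ge0 z0.
have [h|h] := leP (inf T / 2) (r z).
  have h1 := al_le_radius z0 zu.
  have h2 : (r u - r z) / r z <= 3 by rewrite ler_pdivrMr//; lra.
  have h3 := root_bound c0 sub z0.
  have h4 : c * al z <= c * (al u + 3) by rewrite ler_wpM2l ?(ltW c0)//; lra.
  by move: h3 h4; rewrite mulrDr; lra.
pose t := inf T / 2.
have t01 : 0 <= t <= 1.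
  by have /andP[_ u1'] := radius_itv K u; rewrite /t; apply/andP; split; lra.
pose w := flow z t.
have rw : r w = t by rewrite radius_flow// (max_idPr (ltW h)).
have zw : disc_le z w by exact: flow_ge.
have w0 := radius_pos_above z0 zw.
have wu : disc_le w u.
  by apply: (above_le_radius z0) => //; rewrite rw /t; lra.
have nsw : ~ steep w.
  move=> sw; have : inf T <= r w by apply: ge_inf; [case: infT|exists w].
  by rewrite rw /t; lra.
have h1 := not_steep z0 zw nsw.
have h2 := root_bound c0 sub w0.
have h3 := al_le_radius w0 wu.
have h4 : (r u - r w) / r w <= 3 by rewrite rw ler_pdivrMr /t; lra.
have aw0 := al_ge0 w0.
have h5 : c * al w <= c * (al u + 3) by rewrite ler_wpM2l ?(ltW c0)//; lra.
by move: h1 h2 h5; rewrite mulrDr; lra.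
Qed.

End Poles.

(** * Division in an affinoid domain *)

Section Series.
Variables (R : realType) (k : nafield R) (B : banachAlg k).

Lemma geometric_small (C t e : R) : 0 <= t < 1 -> 0 < e ->
  exists n0, forall n, (n0 <= n)%N -> C * t ^+ n < e.
Proof.
move=> /andP[t0 t1] e0.
have : (fun n => t ^+ n) @ \oo --> (0 : R) by apply: cvg_expr; rewrite ger0_norm.
have d0 : 0 < e / (`|C| + 1) by rewrite divr_gt0// ltr_wpDl.
move=> /cvgrPdist_lt /(_ _ d0)[n0 _ hn]; exists n0 => n /hn /=.
rewrite sub0r normrN ger0_norm ?exprn_ge0// ltr_pdivlMr ?ltr_wpDl// => h.
apply: le_lt_trans h; rewrite mulrC ler_wpM2l ?exprn_ge0//.
by rewrite (le_trans (ler_norm C))// lerDl.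
Qed.

Lemma geometric_series (x : nat -> B) (C t : R) : 0 <= t < 1 ->
  (forall n, bnorm B (x n) <= C * t ^+ n) ->
  exists s, forall n, bnorm B (s - \sum_(i < n) x i) <= C * t ^+ n.
Proof.
move=> ht hx; have /andP[t0 t1] := ht.
have C0 : 0 <= C by have := le_trans (bnorm_ge0 _) (hx 0%N); rewrite mulr1.
have mono m n : (m <= n)%N -> C * t ^+ n <= C * t ^+ m.
  by move=> mn; rewrite ler_wpM2l// ler_wiXn2l// ltW.
pose S n := \sum_(i < n) x i.
have hS m d : bnorm B (S (m + d)%N - S m) <= C * t ^+ m.
  elim: d => [|d ih]; first by rewrite addn0 subrr bnorm0 mulr_ge0 ?exprn_ge0.
  rewrite addnS {1}/S big_ord_recr /= addrAC.
  apply: (le_trans (bnormD _ _)); rewrite ge_max ih (le_trans (hx _))// mono//.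
  exact: leq_addr.
have hS' m n : (m <= n)%N -> bnorm B (S n - S m) <= C * t ^+ m.
  by move=> mn; rewrite -(subnKC mn).
have [s hs] : exists s, forall e, 0 < e -> exists n0, forall n,
    (n0 <= n)%N -> bnorm B (S n - s) < e.
  apply: bnorm_complete => e e0; have [n0 hn] := geometric_small C ht e0.
  exists n0 => m n hm hm'; have -> : S m - S n = (S m - S n0) - (S n - S n0).
    by rewrite opprB addrA subrK.
  apply: (le_lt_trans (bnormD _ _)); rewrite bnormN gt_max.
  by rewrite !(le_lt_trans (hS' _ _ _)) ?hn.
exists s => n; apply/ler_addgt0Pr => e e0; have [n0 hn] := hs e e0.
have -> : s - \sum_(i < n) x i = (s - S (maxn n n0)) + (S (maxn n n0) - S n).
  by rewrite addrA subrK.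
apply: (le_trans (bnormD _ _)); rewrite ge_max bnorm_distC.
have h0 : 0 <= C * t ^+ n by rewrite mulr_ge0 ?exprn_ge0.
rewrite (@le_trans _ _ e) ?lerDr//; last by rewrite ltW// hn// leq_maxr.
by rewrite (le_trans (hS' _ _ (leq_maxl _ _)))// lerDl ltW.
Qed.

End Series.

(* The quotient of B by the closure of the ideal generated by P. *)
Section PrincipalQuotient.
Variables (R : realType) (k : nafield R) (B : banachAlg k) (P : B).
Implicit Types (f g : B).

Definition residue_norm f : R := inf [set bnorm B (f - P * g) | g in setT].
Local Notation rn := residue_norm.

Let has_inf_rn f : has_inf [set bnorm B (f - P * g) | g in setT].
Proof.
split; first by exists (bnorm B (f - P * 0)), 0.
by exists 0 => _ [g _ <-]; exact: bnorm_ge0.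
Qed.

Lemma rn_le f g : rn f <= bnorm B (f - P * g).
Proof. by apply: ge_inf; [case: (has_inf_rn f)|exists g]. Qed.

Lemma rn_adh f (M : R) : rn f < M -> exists g, bnorm B (f - P * g) < M.
Proof. by move=> h; have [_ [g _ <-] h1] := inf_lt (has_inf_rn f).1 h; exists g. Qed.

Lemma rn_ge0 f : 0 <= rn f.
Proof.
apply: lb_le_inf; first by have [] := has_inf_rn f.
by move=> _ [g _ <-]; exact: bnorm_ge0.
Qed.

Lemma rn_le_norm f : rn f <= bnorm B f.
Proof. by apply: le_trans (rn_le f 0) _; rewrite mulr0 subr0. Qed.

Lemma rn_ideal g : rn (P * g) = 0.
Proof.
by apply/le_anti; rewrite rn_ge0 andbT (le_trans (rn_le _ g))// subrr bnorm0.
Qed.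

Lemma rn0 : rn 0 = 0.
Proof. by rewrite -(mulr0 P) rn_ideal. Qed.

Lemma rnD f g : rn (f + g) <= Num.max (rn f) (rn g).
Proof.
apply/ler_addgt0Pr => e e0.
have [f' hf] := rn_adh (ltr_pwDr e0 (lexx _) : rn f < rn f + e).
have [g' hg] := rn_adh (ltr_pwDr e0 (lexx _) : rn g < rn g + e).
apply: le_trans (rn_le _ (f' + g')) _; rewrite mulrDr opprD addrACA.
apply: le_trans (bnormD _ _) _; rewrite ge_max.
apply/andP; split; [apply: (le_trans (ltW hf))|apply: (le_trans (ltW hg))].
  by rewrite lerD2r le_max lexx.
by rewrite lerD2r le_max lexx orbT.
Qed.

Lemma rnM f g : rn (f * g) <= rn f * rn g.
Proof.
apply: ler_mul_addgt0 (rn_ge0 f) (rn_ge0 g) _ => e e0.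
have [f' hf] := rn_adh (ltr_pwDr e0 (lexx _) : rn f < rn f + e).
have [g' hg] := rn_adh (ltr_pwDr e0 (lexx _) : rn g < rn g + e).
apply: le_trans (rn_le _ (f * g' + f' * (g - P * g'))) _.
have -> : f * g - P * (f * g' + f' * (g - P * g')) = (f - P * f') * (g - P * g').
  by ring.
by apply: le_trans (bnormM _ _) _; rewrite ler_pM ?bnorm_ge0 ?ltW.
Qed.

Lemma rnN f : rn (- f) = rn f.
Proof.
have h g : rn (- g) <= rn g.
  apply/ler_addgt0Pr => e e0; have [g' hg] := rn_adh (ltr_pwDr e0 (lexx _) : rn g < rn g + e).
  by rewrite (le_trans (rn_le _ (- g')))// mulrN -opprD bnormN ltW.
by apply/le_anti; rewrite h /= -{1}(opprK f) h.
Qed.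

Definition quot_rel : rel B := fun f g => rn (f - g) == 0.

Lemma rn0_trans f g h : rn (f - g) = 0 -> rn (g - h) = 0 -> rn (f - h) = 0.
Proof.
move=> h1 h2; apply/le_anti; rewrite rn_ge0 andbT.
by rewrite -(subrK g f) -addrA (le_trans (rnD _ _))// h1 h2 maxxx.
Qed.

Lemma rn0_sym f g : rn (f - g) = 0 -> rn (g - f) = 0.
Proof. by move=> h; rewrite -opprB rnN. Qed.

Lemma quot_rel_refl : reflexive quot_rel.
Proof. by move=> f; rewrite /quot_rel subrr rn0. Qed.
Lemma quot_rel_sym : symmetric quot_rel.
Proof. by move=> f g; rewrite /quot_rel -opprB rnN. Qed.
Lemma quot_rel_trans : transitive quot_rel.
Proof.
by move=> g f h /eqP h1 /eqP h2; apply/eqP; exact: rn0_trans h1 h2.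
Qed.

Canonical quot_equiv := EquivRel quot_rel quot_rel_refl quot_rel_sym quot_rel_trans.

Definition quot := {eq_quot quot_equiv}%qT.
HB.instance Definition _ := Choice.on quot.
HB.instance Definition _ := EqQuotient.on quot.

Definition quot_pi f : quot := (\pi_quot f)%qT.

Lemma quot_piP f g : quot_pi f = quot_pi g <-> rn (f - g) = 0.
Proof.
rewrite /quot_pi; split=> [/eqmodP/eqP//|h]; by apply/eqmodP/eqP.
Qed.

Lemma repr_piP f : rn (repr (quot_pi f) - f) = 0.
Proof. by apply/quot_piP; rewrite /quot_pi reprK. Qed.

Lemma quot_pi_repr (x : quot) : quot_pi (repr x) = x.
Proof. exact: reprK. Qed.

Definition quot_add (x y : quot) : quot := quot_pi (repr x + repr y).
Definition quot_mul (x y : quot) : quot := quot_pi (repr x * repr y).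
Definition quot_opp (x : quot) : quot := quot_pi (- repr x).

Lemma quot_addE f g : quot_add (quot_pi f) (quot_pi g) = quot_pi (f + g).
Proof.
apply/quot_piP; rewrite opprD addrACA; apply/le_anti; rewrite rn_ge0 andbT.
by rewrite (le_trans (rnD _ _))// !repr_piP maxxx.
Qed.

Lemma quot_oppE f : quot_opp (quot_pi f) = quot_pi (- f).
Proof. by apply/quot_piP; rewrite -opprD rnN repr_piP. Qed.

Lemma quot_mulE f g : quot_mul (quot_pi f) (quot_pi g) = quot_pi (f * g).
Proof.
apply/quot_piP; set f' := repr _; set g' := repr _.
have -> : f' * g' - f * g = (f' - f) * g' + f * (g' - g).
  by rewrite mulrBl mulrBr addrA subrK.
apply/le_anti; rewrite rn_ge0 andbT (le_trans (rnD _ _))// ge_max.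
rewrite (le_trans (rnM _ _)) ?repr_piP ?mul0r//.
by rewrite (le_trans (rnM _ _)) ?repr_piP ?mulr0.
Qed.

Lemma quot_addA : associative quot_add.
Proof.
by move=> x y z; rewrite -(quot_pi_repr x) -(quot_pi_repr y) -(quot_pi_repr z) !quot_addE addrA.
Qed.
Lemma quot_addC : commutative quot_add.
Proof. by move=> x y; rewrite /quot_add addrC. Qed.
Lemma quot_add0 : left_id (quot_pi 0) quot_add.
Proof. by move=> x; rewrite -(quot_pi_repr x) quot_addE add0r. Qed.
Lemma quot_addN : left_inverse (quot_pi 0) quot_opp quot_add.
Proof. by move=> x; rewrite -(quot_pi_repr x) quot_oppE quot_addE addNr. Qed.

HB.instance Definition _ :=
  GRing.isZmodule.Build quot quot_addA quot_addC quot_add0 quot_addN.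

Lemma quot_mulA : associative quot_mul.
Proof.
by move=> x y z; rewrite -(quot_pi_repr x) -(quot_pi_repr y) -(quot_pi_repr z) !quot_mulE mulrA.
Qed.
Lemma quot_mulC : commutative quot_mul.
Proof. by move=> x y; rewrite /quot_mul mulrC. Qed.
Lemma quot_mul1 : left_id (quot_pi 1) quot_mul.
Proof. by move=> x; rewrite -(quot_pi_repr x) quot_mulE mul1r. Qed.
Lemma quot_mulD : left_distributive quot_mul quot_add.
Proof.
move=> x y z; rewrite -(quot_pi_repr x) -(quot_pi_repr y) -(quot_pi_repr z).
by rewrite quot_addE !quot_mulE quot_addE mulrDl.
Qed.

HB.instance Definition _ :=
  GRing.Zmodule_isComPzRing.Build quot quot_mulA quot_mulC quot_mul1 quot_mulD.

Lemma quot_pi_zmod : zmod_morphism quot_pi.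
Proof. by move=> f g; rewrite -quot_addE -quot_oppE. Qed.
Lemma quot_pi_monoid : monoid_morphism quot_pi.
Proof. by split=> // f g; rewrite -quot_mulE. Qed.
HB.instance Definition _ := GRing.isZmodMorphism.Build B quot quot_pi quot_pi_zmod.
HB.instance Definition _ := GRing.isMonoidMorphism.Build B quot quot_pi quot_pi_monoid.

Lemma quot_piD f g : quot_pi (f + g) = quot_pi f + quot_pi g. Proof. by rewrite rmorphD. Qed.
Lemma quot_piB f g : quot_pi (f - g) = quot_pi f - quot_pi g. Proof. by rewrite rmorphB. Qed.

Definition quot_norm (x : quot) : R := rn (repr x).

Lemma quot_normE f : quot_norm (quot_pi f) = rn f.
Proof.
apply/le_anti/andP; split; rewrite /quot_norm.
  rewrite -[X in rn X](subrK f) (le_trans (rnD _ _))// repr_piP.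
  by rewrite ge_max rn_ge0 lexx.
rewrite -[X in rn X](subrK (repr (quot_pi f))) (le_trans (rnD _ _))//.
by rewrite (rn0_sym (repr_piP f)) ge_max rn_ge0 lexx.
Qed.

Lemma quot_lift (x : quot) (M : R) : quot_norm x < M ->
  exists2 f, quot_pi f = x & bnorm B f < M.
Proof.
move=> /rn_adh[g hg]; exists (repr x - P * g) => //.
by rewrite -{2}(quot_pi_repr x); apply/quot_piP; rewrite addrAC subrr add0r rnN rn_ideal.
Qed.

Lemma quot_norm_ge0 x : 0 <= quot_norm x.
Proof. exact: rn_ge0. Qed.
Lemma quot_norm_eq0 x : (quot_norm x == 0) = (x == 0).
Proof.
rewrite -{2}(quot_pi_repr x); apply/eqP/eqP => [h|/quot_piP]; last by rewrite subr0.
by apply/quot_piP; rewrite subr0.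
Qed.
Lemma quot_normM x y : quot_norm (x * y) <= quot_norm x * quot_norm y.
Proof. by rewrite -(quot_pi_repr x) -(quot_pi_repr y) -rmorphM !quot_normE rnM. Qed.
Lemma quot_normD x y : quot_norm (x + y) <= Num.max (quot_norm x) (quot_norm y).
Proof. by rewrite -(quot_pi_repr x) -(quot_pi_repr y) -rmorphD !quot_normE rnD. Qed.
Lemma quot_norm_const a : quot_norm (quot_pi (bconst B a)) <= nabs a.
Proof. by rewrite quot_normE (le_trans (rn_le_norm _))// bnorm_const. Qed.

(** A subsequence with geometrically small increments lifts to a convergent series in B. *)
Lemma quot_norm_complete : norm_complete quot_norm.
Proof.
move=> u hu; pose t : R := 2^-1.
have t01 : 0 <= t < 1 by rewrite /t; lra.
have tn n : 0 < t ^+ n by rewrite exprn_gt0// /t; lra.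
have /choice[n0 hn0] : forall j, exists n0, forall m n,
    (n0 <= m)%N -> (n0 <= n)%N -> quot_norm (u m - u n) < t ^+ j.
  by move=> j; exact: hu.
pose n j := (\sum_(i < j.+1) n0 i)%N.
have nn0 j : (n0 j <= n j)%N by rewrite /n big_ord_recr leq_addl.
have nS j : (n j <= n j.+1)%N by rewrite {2}/n big_ord_recr leq_addr.
have /choice[d hd] : forall j, exists f, quot_pi f = u (n j.+1) - u (n j) /\
    bnorm B f < t ^+ j.
  move=> j; have [|f h1 h2] := @quot_lift (u (n j.+1) - u (n j)) (t ^+ j).
    by apply: hn0; rewrite ?nn0// (leq_trans (nn0 j)).
  by exists f.
have [s hs] : exists s, forall n, bnorm B (s - \sum_(i < n) d i) <= 1 * t ^+ n.
  by apply: geometric_series => // j; rewrite mul1r ltW//; have [] := hd j.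
have sumE j : quot_pi (\sum_(i < j) d i) = u (n j) - u (n 0%N).
  elim: j => [|j ih]; first by rewrite big_ord0 subrr rmorph0.
  by rewrite big_ord_recr quot_piD ih (hd j).1; ring.
exists (u (n 0%N) + quot_pi s) => e e0.
have [j hj] := geometric_small 1 t01 e0.
have tj : t ^+ j < e by have := hj j (leqnn j); rewrite mul1r.
exists (n j) => m hm.
have -> : u m - (u (n 0%N) + quot_pi s) = (u m - u (n j)) + quot_pi (\sum_(i < j) d i - s).
  by rewrite quot_piB sumE; ring.
apply: (le_lt_trans (quot_normD _ _)); rewrite gt_max quot_normE.
rewrite (lt_trans _ tj) ?hn0// ?(leq_trans (nn0 j))//.
by rewrite (le_lt_trans (rn_le_norm _))// bnorm_distC (le_lt_trans (hs j))// mul1r.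
Qed.

Definition quot_banach : banachAlg k :=
  @BanachAlg R k quot (quot_pi \o bconst B) quot_norm quot_norm_ge0 quot_norm_eq0
    quot_normM quot_normD quot_norm_const quot_norm_complete.

Lemma quot_pi_bounded : exists M, forall f, bnorm quot_banach (quot_pi f) <= M * bnorm B f.
Proof. by exists 1 => f; rewrite mul1r /= quot_normE rn_le_norm. Qed.

Definition quot_proj : bhom B quot_banach :=
  @BHom R k B quot_banach quot_pi (fun=> erefl) quot_pi_bounded.

Lemma quot_proj_ideal g : quot_proj (P * g) = 0.
Proof. by apply/eqP; rewrite -bnorm_eq0 /= quot_normE rn_ideal. Qed.

Lemma quot_proj_eq0 f : quot_proj f = 0 -> forall e : R, 0 < e ->
  exists g, bnorm B (f - P * g) < e.
Proof.
move=> h e e0; apply: rn_adh; rewrite -quot_normE.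
have : bnorm quot_banach (quot_proj f) = 0 by rewrite h bnorm0.
by move=> /= ->.
Qed.

(** The residue norm is an infimum that need not be attained, whence the factor 2. *)
Lemma quot_proj_lift (x : quot_banach) : exists2 f, quot_proj f = x &
  bnorm B f <= 2 * bnorm quot_banach x.
Proof.
have := bnorm_ge0 x; rewrite le_eqVlt => /predU1P[/esym/eqP|x0].
  by rewrite bnorm_eq0 => /eqP ->; exists 0; rewrite ?rmorph0// !bnorm0 mulr0.
have [|f h1 h2] := @quot_lift x (2 * bnorm quot_banach x).
  by rewrite /= ltr_pMl// ltr1n.
by exists f => //; exact: ltW.
Qed.

End PrincipalQuotient.

Section QuotientAffinoid.
Variables (R : realType) (k : nafield R).

Definition bhom_comp (B C D : banachAlg k) (g : bhom C D) (f : bhom B C) : bhom B D.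
Proof.
refine (@BHom R k B D (g \o f) _ _) => /=.
- abstract by move=> a; rewrite !bhom_const.
- abstract (have [M hM] := bhom_bounded f; have [L hL] := bhom_bounded g;
  exists (`|L| * M) => b; apply: (le_trans (hL _));
  apply: (@le_trans _ _ (`|L| * bnorm C (f b)));
    [by rewrite ler_wpM2r ?bnorm_ge0 ?ler_norm|by rewrite -mulrA ler_wpM2l]).
Defined.

Lemma quot_affinoid (B : banachAlg k) (P : B) : is_affinoid B ->
  is_affinoid (quot_banach P).
Proof.
move=> [rs [h [M hM]]]; exists rs, (bhom_comp (quot_proj P) h), (`|M| * 2) => x.
have [b bx bn] := quot_proj_lift x; have [f fb fn] := hM b.
exists f; first by rewrite /= fb.
apply: (le_trans fn); apply: (@le_trans _ _ (`|M| * bnorm B b)).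
  by rewrite ler_wpM2r ?bnorm_ge0 ?ler_norm.
by rewrite -mulrA ler_wpM2l.
Qed.

Lemma bhom_pos_bound (B C : banachAlg k) (h : bhom B C) :
  exists2 M, 1 <= M & forall f, bnorm C (h f) <= M * bnorm B f.
Proof.
have [M hM] := bhom_bounded h; exists (`|M| + 1); first by rewrite lerDr.
move=> f; apply: (le_trans (hM f)); rewrite ler_wpM2r ?bnorm_ge0//.
by rewrite (le_trans (ler_norm M))// lerDl.
Qed.

End QuotientAffinoid.

(** * Division with bounds, through a presentation of the affinoid algebra *)

Section TateInduction.
Variables (R : realType) (k : nafield R).

Fixpoint tvars (rs : seq {posnum R}) : seq (tate_iter k rs * R) :=
  if rs is r :: rs' then
    (tvar (tate_iter k rs') r, r%:num) ::
      [seq (tconst r v.1, v.2) | v <- tvars rs']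
  else [::].

Lemma tnorm_const_le (B : banachAlg k) (r : {posnum R}) (b : B) :
  tnorm (tconst r b) <= bnorm B b.
Proof.
by apply: tnorm_le => -[|i] /=; rewrite ?mulr1// bnorm0 mul0r bnorm_ge0.
Qed.

Lemma tnorm_var_le (B : banachAlg k) (r : {posnum R}) : tnorm (tvar B r) <= r%:num.
Proof.
apply: tnorm_le => -[|[|i]] /=; rewrite ?bnorm0 ?mul0r ?expr1//.
by rewrite -[leRHS]mul1r ler_wpM2r// bnorm1_le.
Qed.

Lemma tvars_norm rs v : List.In v (tvars rs) -> bnorm _ v.1 <= v.2 /\ 0 < v.2.
Proof.
elim: rs v => [//|r rs ih] v /= [<-|]; first by split=> /=; [exact: tnorm_var_le|exact: gt0].
move=> /List.in_map_iff[w [<- /ih[h1 h2]]]; split=> //=.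
exact: le_trans (tnorm_const_le r _) h1.
Qed.

Lemma tate_truncate (B : banachAlg k) (r : {posnum R}) (F : tate B r) (e : R) :
  0 < e -> exists n, tnorm (F - \sum_(i < n) tconst r (F i) * tvar B r ^+ i) < e.
Proof.
move=> e0; have e2 : 0 < e / 2 by rewrite divr_gt0.
have /is_tateP/(_ _ e2)[n hn] := tcoef_cvg F; exists n.
apply: (@le_lt_trans _ _ (e / 2)); last by rewrite ltr_pdivrMr// ltr_pMr// ltr1n.
have tcX i j : tcoef (tvar B r ^+ i : tate B r) j = (j == i)%:R.
  elim: i j => [|i ih] j.
    by rewrite expr0; case: j => [|j].
  rewrite exprS mulrC tcoefM; case: j => [|j].
    by rewrite big_ord_recl big_ord0 /= mulr0 addr0.
  rewrite (bigD1 (inord j)) //= big1 => [|l].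
    by rewrite inordK // subSnn eqxx mulr1 addr0 ih eqSS.
  rewrite -val_eqE /= inordK // => lj.
  have : (j.+1 - l == 1)%N = false by have := ltn_ord l; move: lj; lia.
  by move=> ->; rewrite mulr0.
have sumc (I : finType) (G : I -> tate B r) j :
    tcoef (\sum_i G i) j = \sum_i tcoef (G i) j.
  by apply: (big_morph (fun H : tate B r => H j)) => //; rewrite tcoef0.
have cM b (G : tate B r) j : tcoef (tconst r b * G) j = b * G j.
  exact: tconst_coefM.
apply: tnorm_le => j; rewrite tcoefB sumc.
under eq_bigr do rewrite cM tcX.
have [nj|jn] := leqP n j.
  rewrite big1 ?subr0; first by rewrite ltW// hn.
  move=> i _; have -> : (j == i) = false by have := ltn_ord i; lia.
  by rewrite mulr0.
rewrite (bigD1 (Ordinal jn))//= big1 => [|i].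
  by rewrite eqxx mulr1 addr0 subrr bnorm0 mul0r ltW.
by rewrite -val_eqE eq_sym => /negPf ->; rewrite mulr0.
Qed.

(** Z F l is to be thought of as a property of F at scale l. The norm is ultrametric, so a finite
    sum of monomials of size at most l remains at scale l, and the truncated tail falls under the
    clause for small F. *)
Lemma tate_iter_ind rs (Z : tate_iter k rs -> R -> Prop) (d : R) : 0 < d ->
  (forall a l, nabs a <= l -> Z (bconst _ a) l) ->
  (forall F G l, Z F l -> Z G l -> Z (F + G) l) ->
  (forall v F l, List.In v (tvars rs) -> Z F l -> Z (v.1 * F) (v.2 * l)) ->
  (forall F l, bnorm _ F <= d * l -> Z F l) ->
  forall F l, 0 < l -> bnorm _ F <= l -> Z F l.
Proof.
move=> d0; elim: rs Z => [|r rs ih] Z hc hD hv hs F l l0 hF; first exact: hc.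
have hX F' l' j : Z F' l' -> Z (F' * tvar _ r ^+ j) (l' * r%:num ^+ j).
  move=> h; elim: j => [|j ihj]; first by rewrite !expr0 !mulr1.
  rewrite exprS [F' * _]mulrCA exprS [l' * _]mulrCA.
  exact: (hv (tvar (tate_iter k rs) r, r%:num) _ _ (or_introl erefl) ihj).
have key b l' j : 0 < l' -> bnorm _ b <= l' ->
    Z (tconst r b * tvar _ r ^+ j) (l' * r%:num ^+ j).
  move=> l'0 hb; apply: hX; move: b l' l'0 hb {j}.
  apply: (ih (fun b l' => Z (tconst r b) l')).
  - by move=> a l'; exact: hc.
  - by move=> b b' l' h1 h2; rewrite rmorphD; exact: hD.
  - move=> v b l' hvs h; rewrite rmorphM.
    apply: (hv (tconst r v.1, v.2)) => //; right.
    by apply/List.in_map_iff; exists v.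
  - by move=> b l' h; apply: hs; apply: le_trans (tnorm_const_le r b) h.
have [n hn] := tate_truncate F (mulr_gt0 d0 l0).
rewrite -[F](subrK (\sum_(i < n) tconst r (F i) * tvar _ r ^+ i)).
apply: (hD); first by apply: (hs); exact: ltW.
elim/big_ind: _ => [|x y|i _]; first 1 last.
- exact: hD.
- have ri : 0 < r%:num ^+ i by rewrite exprn_gt0.
  rewrite -(divfK (lt0r_neq0 ri) l); apply: key; first exact: divr_gt0.
  by rewrite ler_pdivlMr//; apply: le_trans (tnorm_ub F i) hF.
by apply: hs; rewrite bnorm0 mulr_ge0 ?ltW.
Qed.

End TateInduction.

Section QuotientMap.
Variables (R : realType) (k : nafield R) (B D : banachAlg k) (P : B).
Variables (h : bhom B D).

(** Being bounded, h kills the closure of the ideal of P as soon as it kills P. *)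
Lemma bhom_quot_eq f g : h P = 0 -> quot_pi P f = quot_pi P g -> h f = h g.
Proof.
move=> hP /quot_piP h0; have [M M1 hM] := bhom_pos_bound h.
apply/eqP; rewrite -subr_eq0 -rmorphB -bnorm_eq0 eq_le bnorm_ge0 andbT.
apply/ler_addgt0Pr => e e0; rewrite add0r.
have M0 : 0 < M by lra.
have [g' hg] : exists g', bnorm B (f - g - P * g') < e / M.
  by apply: rn_adh; rewrite h0 divr_gt0.
have -> : h (f - g) = h (f - g - P * g') by rewrite [RHS]rmorphB rmorphM hP mul0r subr0.
by rewrite (le_trans (hM _))// mulrC -ler_pdivlMr// ltW.
Qed.

Definition quot_map (_ : h P = 0) (x : quot P) : D := h (repr x).

Hypothesis hP : h P = 0.

Lemma quot_mapE f : quot_map hP (quot_pi P f) = h f.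
Proof. by apply: bhom_quot_eq => //; exact: quot_pi_repr. Qed.

Lemma quot_map_zmod : zmod_morphism (quot_map hP).
Proof.
move=> x y; rewrite -(quot_pi_repr x) -(quot_pi_repr y) -quot_piB !quot_mapE.
exact: rmorphB.
Qed.
Lemma quot_map_monoid : monoid_morphism (quot_map hP).
Proof.
split=> [|x y]; first by rewrite -(rmorph1 (quot_pi P)) quot_mapE rmorph1.
by rewrite -(quot_pi_repr x) -(quot_pi_repr y) -rmorphM !quot_mapE rmorphM.
Qed.
HB.instance Definition _ := GRing.isZmodMorphism.Build (quot P) D (quot_map hP) quot_map_zmod.
HB.instance Definition _ := GRing.isMonoidMorphism.Build (quot P) D (quot_map hP) quot_map_monoid.

Lemma quot_bhom : exists w : bhom (quot_banach P) D,
  forall f, w (quot_proj P f) = h f.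
Proof.
have [M M1 hM] := bhom_pos_bound h.
have hc a : quot_map hP (bconst (quot_banach P) a) = bconst D a.
  by rewrite quot_mapE bhom_const.
have hb : exists M, forall x, bnorm D (quot_map hP x) <= M * bnorm (quot_banach P) x.
  exists (M * 2) => x; have [f <- hf] := quot_proj_lift x.
  rewrite quot_mapE (le_trans (hM f))// -mulrA ler_wpM2l//; lra.
by exists (@BHom R k (quot_banach P) D (quot_map hP) hc hb) => f; exact: quot_mapE.
Qed.

End QuotientMap.

Section Division.
Variables (R : realType) (k : nafield R).
Variables (V : affinoid_domain (tate_alg k)) (P : tate_alg k).
Hypotheses (P0 : P != 0) (PV : forall z : disc k, z P = 0 -> ad_set V z).
Local Notation A := (tate_alg k).
Local Notation res := (ad_res V).
Local Notation C := (quot_banach P).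

(* u comes from the existence part of the universal property, tested on
   A / cl(PA); the approximation comes from the uniqueness part, tested on
   V / cl(PV). *)
Lemma domain_quotient : exists u : bhom V C,
  (forall a, u (res a) = quot_proj P a) /\
  forall f a, u f = quot_proj P a -> forall e : R, 0 < e ->
    exists g, bnorm V (f - res a - res P * g) < e.
Proof.
have projP (B : banachAlg k) (Q : B) : quot_proj Q Q = 0.
  by have := quot_proj_ideal Q 1; rewrite mulr1.
have [|u uE _] := @ad_univ _ _ _ V C (quot_proj P) (quot_affinoid P (tate_alg_affinoid k)).
  move=> z; apply: PV.
  have -> : berk_pull (quot_proj P) z P = z (quot_proj P P) by [].
  by rewrite projP berk0.
exists u; split=> // f a ufa e e0.
pose D := quot_banach (res P : V); pose pD := quot_proj (res P : V).
have hP : bhom_comp pD res P = 0 by rewrite -(projP V (res P)).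
have [w wE] := quot_bhom hP.
have [|u0 _ uniq] := @ad_univ _ _ _ V D (bhom_comp pD res) (quot_affinoid (res P : V) (ad_affinoid V)).
  move=> z; have := @ad_image _ _ _ V (berk_pull pD z).
  by congr (ad_set V _); exact: berkP.
have e1 := uniq pD (fun=> erefl).
have e2 : bhom_comp w u =1 u0 by apply: uniq => b; rewrite -wE -uE.
have pDf : pD f = pD (res a).
  have -> : pD (res a) = w (quot_proj P a) by rewrite wE.
  by rewrite -ufa e1 -e2.
by apply: quot_proj_eq0 => //; rewrite rmorphB /= -/pD; apply/eqP; rewrite subr_eq0; apply/eqP.
Qed.

End Division.

Section ApproximateDivision.
Variables (R : realType) (k : nafield R).
Variables (V : affinoid_domain (tate_alg k)) (P : tate_alg k).
Hypothesis P0 : P != 0.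
Local Notation A := (tate_alg k).
Local Notation res := (ad_res V).
Local Notation C := (quot_banach P).
Variable u : bhom V C.
Hypotheses (uE : forall a, u (res a) = quot_proj P a)
  (uV : forall f a, u f = quot_proj P a -> forall e : R, 0 < e ->
    exists g, bnorm V (f - res a - res P * g) < e).
Variables (rs : seq {posnum R}) (h : bhom (tate_iter k rs) V).
Local Notation B := (tate_iter k rs).
Variables (L M : R).
Hypotheses (L1 : 1 <= L) (M1 : 1 <= M)
  (hL : forall f : V, exists2 F : B, h F = f & bnorm B F <= L * bnorm V f)
  (resL : forall a : A, exists2 F : B, h F = res a & bnorm B F <= L * bnorm A a)
  (uhM : forall F : B, exists2 a : A, quot_proj P a = u (h F) &
    bnorm A a <= M * bnorm B F).

Let t : R := 2^-1.
Let uP : u (res P) = 0.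
Proof. by rewrite uE; have := quot_proj_ideal P 1; rewrite mulr1. Qed.

Let L0 : 0 < L. Proof. exact: lt_le_trans ltr01 L1. Qed.
Let M0 : 0 < M. Proof. exact: lt_le_trans ltr01 M1. Qed.
Let LM0 : 0 < L * M. Proof. exact: mulr_gt0. Qed.
Let t0 : 0 < t. Proof. by rewrite invr_gt0. Qed.

Let Pn0 : 0 < bnorm A P.
Proof. by rewrite lt_def bnorm_ge0 bnorm_eq0 P0. Qed.

(* One step of the division, with error N of at most half the size of F. *)
Definition approx_div (N0 : R) (F : B) (l : R) : Prop := 0 < l ->
  bnorm B F <= l /\ exists a G N,
    [/\ h F = res a + res P * h G + h N, u (h N) = 0, bnorm A a <= M * l,
        bnorm B G <= N0 * l & bnorm B N <= t * l].

Lemma approx_div_const N0 a l : 0 <= N0 -> nabs a <= l -> approx_div N0 (bconst B a) l.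
Proof.
move=> N00 al l0; split; first exact: le_trans (bnorm_const _ _) al.
exists (bconst A a), 0, 0; rewrite !rmorph0 mulr0 !addr0 !bnorm0.
split=> //; rewrite ?mulr_ge0 ?(ltW l0)// ?(ltW t0)//; first by rewrite !bhom_const.
apply: le_trans (bnorm_const _ _) _; apply: (le_trans al); rewrite ler_peMl// ltW//.
Qed.

Lemma approx_div_add N0 F G l : approx_div N0 F l -> approx_div N0 G l ->
  approx_div N0 (F + G) l.
Proof.
move=> hF hG l0; have [F0 [a [F1 [F2 [eF uF aF bF cF]]]]] := hF l0.
have [G0 [b [G1 [G2 [eG uG aG bG cG]]]]] := hG l0.
split; first by rewrite (le_trans (bnormD _ _))// ge_max F0.
exists (a + b), (F1 + G1), (F2 + G2); split.
- rewrite !rmorphD/= eF eG; ring.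
- by rewrite !rmorphD /= uF uG addr0.
- by rewrite (le_trans (bnormD _ _))// ge_max aF.
- by rewrite (le_trans (bnormD _ _))// ge_max bF.
- by rewrite (le_trans (bnormD _ _))// ge_max cF.
Qed.

(** F itself serves as the error, once a lift of some a with the same image in A / cl(PA) is
    subtracted. The threshold t / (L M) keeps that lift below t l. *)
Lemma approx_div_small N0 F l : 0 <= N0 -> bnorm B F <= t / (L * M) * l ->
  approx_div N0 F l.
Proof.
move=> N00 hF l0; have LM1 : 1 <= L * M by rewrite -[1]mulr1 ler_pM.
have d0 : 0 < t / (L * M) by rewrite divr_gt0.
have d1 : t / (L * M) <= t by rewrite ler_pdivrMr// ler_peMr// ltW.
have t1 : t <= 1 by rewrite invf_le1// ler1n.
have Ftl : bnorm B F <= t * l by apply: (le_trans hF); rewrite ler_wpM2r// ltW.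
have Fl : bnorm B F <= l by apply: (le_trans Ftl); rewrite ler_piMl// ltW.
split=> //; have [a aE an] := uhM F; have [G GE Gn] := resL a.
exists a, 0, (F - G); split.
- by rewrite rmorph0 mulr0 addr0 rmorphB GE addrC subrK.
- by rewrite !rmorphB GE uE -aE subrr.
- by rewrite (le_trans an)// ler_wpM2l// ltW.
- by rewrite bnorm0 mulr_ge0// ltW.
- apply: (le_trans (bnormD _ _)); rewrite bnormN ge_max Ftl (le_trans Gn)//.
  apply: (@le_trans _ _ (L * M * bnorm B F)); first by rewrite -mulrA ler_wpM2l// ltW.
  by rewrite -ler_pdivlMl// mulrA [_^-1 * t]mulrC.
Qed.

(** The variable T is divided once, as a0 + P g0 + n0 with n0 small, and multiplied with the
    division of F. The product a0 a may be too large, so it is replaced by a representative a' of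
    its class with norm at most M (r l): otherwise the bound on a would deteriorate with every
    variable. The difference is P b + y with y small, and b is bounded because the Gauss norm is
    multiplicative. The constant depends on T only. *)
Lemma approx_div_var v : bnorm B v.1 <= v.2 -> 0 < v.2 ->
  exists K : R, forall N0 F l, K <= N0 -> approx_div N0 F l ->
    approx_div N0 (v.1 * F) (v.2 * l).
Proof.
case: v => T r /= Tr r0; have [a0 a0E a0n] := uhM T.
have e1 : 0 < t * r / (L * M) / L by rewrite !divr_gt0// mulr_gt0.
have [g0 hg0] := uV (esym a0E) e1.
have [G0 G0E _] := hL g0.
have [n0 n0E n0n] := hL (h T - res a0 - res P * g0).
have {}n0n : bnorm B n0 <= t * r / (L * M).
  apply: (le_trans n0n); rewrite mulrC -ler_pdivlMr//; exact: ltW.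
have un0 : u (h n0) = 0 by rewrite n0E !rmorphB rmorphM uP mul0r subr0 uE a0E subrr.
(* K1 and K2 are the bounds found below for [G0 * al] and [be], divided by the scale r l. *)
pose K1 := bnorm B G0 * (L * M) / r.
pose K2 := L * (bnorm A a0 * M + M * r + t * r) / bnorm A P / r.
have K1r : K1 * r = bnorm B G0 * (L * M) by apply: divfK; rewrite gt_eqF.
have K2r : K2 * r = L * (bnorm A a0 * M + M * r + t * r) / bnorm A P.
  by apply: divfK; rewrite gt_eqF.
have K20 : 0 <= K2.
  by rewrite /K2 !mulr_ge0 ?invr_ge0 ?addr_ge0 ?mulr_ge0 ?bnorm_ge0 // ltW.
have K10 : 0 <= K1 by rewrite /K1 !mulr_ge0 ?invr_ge0 ?bnorm_ge0 // ltW.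
exists (K1 + K2) => N0 F l KN hF rl0.
have l0 : 0 < l by rewrite -(pmulr_rgt0 _ r0).
have [Fl [a [G [N [FE uN an Gn Nn]]]]] := hF l0.
have TFn : bnorm B (T * F) <= r * l.
  by rewrite (le_trans (bnormM _ _))// ler_pM ?bnorm_ge0.
split=> //; have [a' a'E a'n] := uhM (T * F).
have {}a'n : bnorm A a' <= M * (r * l) by rewrite (le_trans a'n)// ler_wpM2l// ltW.
pose x := a0 * a - a'.
have px : quot_proj P x = 0.
  rewrite rmorphB rmorphM a0E a'E rmorphM rmorphM -mulrBr FE.
  have -> : quot_proj P a = u (res a + res P * h G + h N).
    by rewrite !rmorphD rmorphM uP mul0r uN !addr0 uE.
  by rewrite subrr mulr0.
have e20 : 0 < t * (r * l) / L by rewrite divr_gt0// mulr_gt0.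
have [b hb] := quot_proj_eq0 px e20.
pose y := x - P * b.
have py : quot_proj P y = 0 by rewrite rmorphB px quot_proj_ideal subrr.
have xn : bnorm A x <= (bnorm A a0 * M + M * r) * l.
  apply: (le_trans (bnormD _ _)); rewrite bnormN ge_max mulrDl.
  have h1 : bnorm A (a0 * a) <= bnorm A a0 * M * l.
    by rewrite (le_trans (bnormM _ _))// -mulrA ler_wpM2l ?bnorm_ge0.
  apply/andP; split; first by rewrite (le_trans h1)// lerDl -mulrA mulr_ge0 ?ltW.
  by rewrite (le_trans a'n)// mulrA lerDr !mulr_ge0 ?bnorm_ge0// ltW.
have bn : bnorm A b <= (bnorm A a0 * M + M * r + t * r) * l / bnorm A P.
  rewrite ler_pdivlMr// mulrC -gaussM.
  have -> : P * b = x - y by rewrite /y opprB addrCA subrr addr0.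
  apply: (le_trans (bnormD _ _)); rewrite bnormN ge_max mulrDl.
  have tr0 : 0 <= t * r * l by rewrite !mulr_ge0// ltW.
  rewrite (le_trans xn) ?lerDl// andTb (le_trans (ltW hb))//.
  apply: (@le_trans _ _ (t * (r * l))).
    by rewrite ler_pdivrMr// ler_peMr// mulr_ge0 ?ltW.
  rewrite mulrA lerDr; apply: mulr_ge0; last exact: ltW.
  by apply: addr_ge0; apply: mulr_ge0; rewrite ?bnorm_ge0 ?ltW.
have [al alE aln] := resL a; have [be beE ben] := resL b; have [ga gaE gan] := resL y.
exists a', (G0 * al + T * G + be), (n0 * al + T * N + ga).
have aln' : bnorm B al <= L * M * l.
  by rewrite (le_trans aln)// -mulrA ler_wpM2l// ltW.
split=> //.
- rewrite !rmorphD /= !rmorphM /= alE beE gaE G0E n0E /y /x !rmorphB /= !rmorphM /=.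
  by rewrite FE; ring.
- rewrite !rmorphD /= !rmorphM /= un0 uN mul0r mulr0 !add0r gaE uE; exact: py.
- have N00 : 0 <= N0 by apply: le_trans KN; rewrite addr_ge0.
  rewrite (le_trans (bnormD _ _))// ge_max (le_trans (bnormD _ _))/= ?ge_max.
    apply: (le_trans ben); apply: (@le_trans _ _ (K2 * (r * l))); last first.
      by rewrite ler_wpM2r ?(ltW rl0)// (le_trans _ KN)// lerDr.
    rewrite mulrA K2r -!mulrA ler_wpM2l ?(ltW L0)//.
    by rewrite [_^-1 * l]mulrC mulrA.
  apply/andP; split.
    apply: (le_trans (bnormM _ _)); apply: (@le_trans _ _ (K1 * (r * l))).
      by rewrite mulrA K1r -mulrA ler_wpM2l ?bnorm_ge0.
    by rewrite ler_wpM2r ?(ltW rl0)// (le_trans _ KN)// lerDl.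
  by rewrite (le_trans (bnormM _ _))// mulrCA ler_pM ?bnorm_ge0.
- rewrite (le_trans (bnormD _ _))// ge_max (le_trans (bnormD _ _))/= ?ge_max.
    rewrite (le_trans gan)// mulrC -ler_pdivlMr//; exact: ltW.
  apply/andP; split.
    apply: (le_trans (bnormM _ _)).
    apply: (@le_trans _ _ (t * r / (L * M) * (L * M * l))).
      by rewrite ler_pM ?bnorm_ge0.
    by rewrite mulrA (divfK (lt0r_neq0 LM0)) mulrA.
  by rewrite (le_trans (bnormM _ _))// mulrCA ler_pM ?bnorm_ge0.
Qed.

Lemma uniform_bound (T : Type) (s : seq T) (Q : T -> R -> Prop) :
  (forall x, List.In x s -> exists K : R, forall N0, K <= N0 -> Q x N0) ->
  exists2 K, 0 <= K & forall x, List.In x s -> Q x K.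
Proof.
move=> hQ.
suff [K hK] : exists K : R, forall x, List.In x s -> forall N0, K <= N0 -> Q x N0.
  by exists (`|K|); rewrite ?normr_ge0// => x xs; apply: hK => //; exact: ler_norm.
elim: s hQ => [|x s ih] hQ; first by exists 0.
have [|K hK] := ih; first by move=> y ys; apply: hQ; right.
have [K' hK'] := hQ x (or_introl erefl).
exists (Num.max K K') => y [<-|ys] N0; rewrite ge_max => /andP[h1 h2].
  exact: hK'.
exact: hK.
Qed.

Lemma approximate_division : exists2 N0 : R, 0 <= N0 & forall F : B, exists (a : A) (G N : B),
  [/\ h F = res a + res P * h G + h N, bnorm A a <= M * bnorm B F,
      bnorm B G <= N0 * bnorm B F & bnorm B N <= t * bnorm B F].
Proof.
have [|N0 N00 hN0] := @uniform_bound _ (tvars k rs) (fun v N0 => forall F l,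
  approx_div N0 F l -> approx_div N0 (v.1 * F) (v.2 * l)).
  move=> v vs; have [h1 h2] := tvars_norm vs.
  have [K hK] := approx_div_var h1 h2.
  by exists K => N0 KN F l; exact: hK.
exists N0 => // F.
have := bnorm_ge0 F; rewrite le_eqVlt => /predU1P[/esym/eqP|F0].
  rewrite bnorm_eq0 => /eqP ->; exists 0, 0, 0.
  by rewrite !rmorph0 mulr0 !addr0 !bnorm0 !mulr0.
have d0 : 0 < t / (L * M) by rewrite divr_gt0.
have [_ [a [G [N [h1 _ h2 h3 h4]]]]] := @tate_iter_ind R k rs (approx_div N0) _ d0
  (fun a l => approx_div_const N00) (@approx_div_add N0) (fun v F l vs => hN0 v vs F l)
  (fun F l => approx_div_small N00) F _ F0 (lexx _) F0.
by exists a, G, N.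
Qed.

End ApproximateDivision.

Section ExactDivision.
Variables (R : realType) (k : nafield R).
Variables (V : affinoid_domain (tate_alg k)) (P : tate_alg k).
Hypotheses (P1 : bnorm (tate_alg k) P = 1)
  (PV : forall z : disc k, z P = 0 -> ad_set V z).
Local Notation A := (tate_alg k).
Local Notation res := (ad_res V).

Let P0 : P != 0.
Proof. by rewrite -bnorm_eq0 P1 oner_eq0. Qed.

(** Applying u shows that b lies in the closure of PA, so b is close to some P c; since |P| = 1 and
    the Gauss norm is multiplicative, c is hardly larger than b. The bound holds at every point z of
    the disc, whether or not z lies in V. *)
Lemma domain_ideal_bound (b : A) (g : V) (z : disc k) : res b = res P * g ->
  z b <= bnorm A b * z P.
Proof.
move=> bg; have [u [uE _]] := domain_quotient PV.
have pb : quot_proj P b = 0.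
  rewrite -uE bg rmorphM uE; have := quot_proj_ideal P 1; rewrite mulr1 => ->.
  by rewrite mul0r.
apply/ler_addgt0Pr => e e0; have e2 : 0 < e / 2 by rewrite divr_gt0.
have [c hc] := quot_proj_eq0 pb e2.
have cn : bnorm A c <= bnorm A b + e / 2.
  have -> : bnorm A c = bnorm A (P * c) by rewrite gaussM P1 mul1r.
  have -> : P * c = b - (b - P * c) by rewrite opprB addrCA subrr addr0.
  rewrite (le_trans (bnormD _ _))// bnormN ge_max.
  have b0 := bnorm_ge0 b; apply/andP; split; first by lra.
  by apply: (le_trans (ltW hc)); lra.
have zP : z P <= 1 by rewrite -P1 berk_le.
have zP0 := berk_ge0 z P.
have h1 : z b <= z (P * c) + z (b - P * c).
  by rewrite -{1}[b](subrK (P * c)) addrC berkD.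
have h2 : z (b - P * c) <= e / 2 by rewrite (le_trans (berk_le _ _))// ltW.
have h3 : z (P * c) <= z P * (bnorm A b + e / 2).
  by rewrite berkM ler_wpM2l// (le_trans (berk_le _ _)).
by apply: (le_trans h1); nra.
Qed.

(** Approximate division is repeated on its own error, which is halved each time. The quotients and
    remainders form geometric series, summed in the Tate algebra of the presentation and in A. *)
Lemma domain_division : exists2 M : R, 1 <= M & forall f : V, exists (a : A) (g : V),
  [/\ f = res a + res P * g, bnorm A a <= M * bnorm V f & bnorm V g <= M * bnorm V f].
Proof.
have [u [uE uV]] := domain_quotient PV.
have [rs [h [L0 hL0]]] := ad_affinoid V.
have [Mr Mr1 hr] := bhom_pos_bound res.
have [Mh Mh1 hh] := bhom_pos_bound h.
have [Mu Mu1 hu] := bhom_pos_bound u.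
pose L1 := `|L0| + 1; have L11 : 1 <= L1 by rewrite lerDr.
have Mr0 : 0 <= Mr by apply: le_trans ler01 Mr1.
have Mh0 : 0 <= Mh by apply: le_trans ler01 Mh1.
have Mu0 : 0 <= Mu by apply: le_trans ler01 Mu1.
have L10 : 0 <= L1 by apply: le_trans ler01 L11.
have hL1 (f : V) : exists2 F, h F = f & bnorm _ F <= L1 * bnorm V f.
  have [F <- Fn] := hL0 f; exists F => //; apply: (le_trans Fn).
  by rewrite ler_wpM2r ?bnorm_ge0// (le_trans (ler_norm L0))// lerDl.
pose L := L1 * Mr.
have L1' : 1 <= L by rewrite -[1]mulr1 ler_pM.
have hL (f : V) : exists2 F, h F = f & bnorm _ F <= L * bnorm V f.
  have [F <- Fn] := hL1 f; exists F => //; apply: (le_trans Fn).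
  by rewrite ler_wpM2r ?bnorm_ge0// ler_peMr.
have resL (a : A) : exists2 F, h F = res a & bnorm _ F <= L * bnorm A a.
  have [F FE Fn] := hL1 (res a); exists F => //; apply: (le_trans Fn).
  by rewrite -mulrA ler_wpM2l.
pose M := 2 * (Mu * Mh).
have M1 : 1 <= M.
  have : 1 <= Mu * Mh by rewrite -[1]mulr1 ler_pM.
  by rewrite /M; lra.
have uhM F : exists2 a : A, quot_proj P a = u (h F) & bnorm A a <= M * bnorm _ F.
  have [a aE an] := quot_proj_lift (u (h F)); exists a => //.
  apply: (le_trans an); rewrite -!mulrA ler_wpM2l// (le_trans (hu _))// ler_wpM2l//.
have [N0 N00 /choice[sa /choice[sG /choice[sN hs]]]] :=
  approximate_division P0 uE uV L1' M1 hL resL uhM.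
pose t : R := 2^-1; have t01 : 0 <= t < 1 by rewrite /t; lra.
have t0 : 0 <= t by case/andP: t01.
exists (L * (M + Mh * N0)).
  have : 0 <= Mh * N0 by rewrite mulr_ge0.
  by move=> MN; rewrite -[1]mulr1 ler_pM// (le_trans M1)// lerDl.
move=> f; have [F0 F0E F0n] := hL f.
(* F n lifts the error left after n divisions. *)
pose F n := iter n sN F0; pose nF := bnorm _ F0.
have nF0 : 0 <= nF by exact: bnorm_ge0.
have Fn n : bnorm _ (F n) <= nF * t ^+ n.
  elim: n => [|n ih]; first by rewrite mulr1.
  have [_ _ _ h4] := hs (F n); apply: (le_trans h4).
  by rewrite exprS mulrCA ler_wpM2l.
have [a ha] : exists a, forall n, bnorm A (a - \sum_(i < n) sa (F i)) <= (M * nF) * t ^+ n.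
  apply: (@geometric_series _ _ A (fun i => sa (F i))) => // n; have [_ h2 _ _] := hs (F n).
  by rewrite (le_trans h2)// -[M * nF * _]mulrA ler_wpM2l// (le_trans ler01).
have [G hG] : exists G, forall n,
    bnorm _ (G - \sum_(i < n) sG (F i)) <= (N0 * nF) * t ^+ n.
  apply: (@geometric_series _ _ _ (fun i => sG (F i))) => // n; have [_ _ h3 _] := hs (F n).
  by rewrite (le_trans h3)// -mulrA ler_wpM2l.
have sumE n : f = res (\sum_(i < n) sa (F i)) + res P * h (\sum_(i < n) sG (F i)) + h (F n).
  elim: n => [|n ih]; first by rewrite !big_ord0 !rmorph0 mulr0 !add0r F0E.
  have [h1 _ _ _] := hs (F n); rewrite {1}ih {1}h1 !big_ord_recr !rmorphD /=; ring.
exists a, (h G); split.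
- pose K := Mr * (M * nF) + Mh * (N0 * nF) * bnorm V (res P) + Mh * nF.
  apply/eqP; rewrite -subr_eq0 -bnorm_eq0 eq_le bnorm_ge0 andbT.
  apply/ler_addgt0Pr => e e0; rewrite add0r.
  have [n hn] := geometric_small K t01 e0; apply: le_trans (ltW (hn n (leqnn n))).
  rewrite (sumE n).
  set Sa := \sum_(i < n) sa _ in ha *; set SG := \sum_(i < n) sG _ in hG *.
  have -> : res Sa + res P * h SG + h (F n) - (res a + res P * h G) =
      res (Sa - a) + res P * h (SG - G) + h (F n).
    by rewrite !rmorphB; ring.
  have b1 : bnorm V (res (Sa - a)) <= Mr * (M * nF) * t ^+ n.
    by rewrite (le_trans (hr _))// bnorm_distC -mulrA ler_wpM2l// ha.
  have b2 : bnorm V (res P * h (SG - G)) <= Mh * (N0 * nF) * bnorm V (res P) * t ^+ n.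
    rewrite (le_trans (bnormM _ _))// mulrC mulrAC ler_wpM2r ?bnorm_ge0//.
    by rewrite (le_trans (hh _))// bnorm_distC -mulrA ler_wpM2l// hG.
  have b3 : bnorm V (h (F n)) <= Mh * nF * t ^+ n.
    by rewrite (le_trans (hh _))// -mulrA ler_wpM2l.
  have p1 := le_trans (bnorm_ge0 _) b1; have p2 := le_trans (bnorm_ge0 _) b2.
  have p3 := le_trans (bnorm_ge0 _) b3.
  rewrite /K !mulrDl (le_trans (bnormD _ _))// ge_max (le_trans (bnormD _ _)) ?ge_max.
    by rewrite (le_trans b3)// lerDr addr_ge0.
  by rewrite (le_trans b1) ?(le_trans b2)//; lra.
- have := ha 0%N; rewrite big_ord0 subr0 mulr1 => /le_trans; apply.
  have MN : M <= M + Mh * N0 by rewrite lerDl mulr_ge0.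
  have M0 : 0 <= M by exact: le_trans ler01 M1.
  have -> : L * (M + Mh * N0) * bnorm V f = (M + Mh * N0) * (L * bnorm V f) by ring.
  by apply: ler_pM.
- apply: (le_trans (hh _)); have := hG 0%N; rewrite big_ord0 subr0 mulr1 => hG0.
  apply: (@le_trans _ _ (Mh * (N0 * nF))); first by rewrite ler_wpM2l.
  have -> : L * (M + Mh * N0) * bnorm V f = (M + Mh * N0) * (L * bnorm V f) by ring.
  rewrite mulrA; apply: ler_pM => //; first exact: mulr_ge0.
  by rewrite lerDr; exact: le_trans ler01 M1.
Qed.

End ExactDivision.

(** * Invertibility *)

(* Berkovich's theorem that spectra of non-zero Banach algebras are non-empty: a
   minimal submultiplicative seminorm is multiplicative. *)
Section Spectrum.
Variables (R : realType) (k : nafield R) (B : banachAlg k) (q : B).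
Implicit Types (f g : B) (N : B -> R).

Record sub_seminorm N : Prop := SubSeminorm {
  sn_ge0 : forall f, 0 <= N f;
  sn1 : N 1 = 1;
  snM : forall f g, N (f * g) <= N f * N g;
  snD : forall f g, N (f + g) <= Num.max (N f) (N g);
  sn_le : forall f, N f <= bnorm B f;
  sn_root : N q = 0
}.

Definition minimal_seminorm N := sub_seminorm N /\
  forall N', sub_seminorm N' -> (forall f, N' f <= N f) -> forall f, N f <= N' f.

Lemma inf_seminorm (C : set (B -> R)) (N0 : B -> R) : C N0 ->
  (forall N, C N -> sub_seminorm N) ->
  (forall N N', C N -> C N' -> (forall f, N f <= N' f) \/ (forall f, N' f <= N f)) ->
  exists2 M, sub_seminorm M & forall N f, C N -> M f <= N f.
Proof.
move=> CN0 hC chain; pose M f := inf [set N f | N in C].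
have hinf f : has_inf [set N f | N in C].
  split; first by exists (N0 f), N0.
  by exists 0 => _ [N CN <-]; exact: sn_ge0 (hC _ CN) f.
have Mle N f : C N -> M f <= N f.
  by move=> CN; apply: ge_inf; [case: (hinf f)|exists N].
have Mge f (x : R) : (forall N, C N -> x <= N f) -> x <= M f.
  move=> h; apply: lb_le_inf; first by have [] := hinf f.
  by move=> _ [N CN <-]; exact: h.
have adh f (e : R) : 0 < e -> exists2 N, C N & N f < M f + e.
  by move=> e0; have [_ [N CN <-] h] := inf_adherent e0 (hinf f); exists N.
have adh2 f g (e : R) : 0 < e -> exists N, [/\ C N, N f < M f + e & N g < M g + e].
  move=> e0; have [N CN hN] := adh f e e0; have [N' CN' hN'] := adh g e e0.
  have [h|h] := chain _ _ CN CN'; [exists N|exists N']; split=> //.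
    exact: le_lt_trans (h g) hN'.
  exact: le_lt_trans (h f) hN.
exists M => //; have M0 f : 0 <= M f by apply: Mge => N CN; exact: sn_ge0 (hC _ CN) f.
split=> //.
- apply/le_anti/andP; split; first by rewrite -(sn1 (hC _ CN0)) Mle.
  by apply: Mge => N CN; rewrite (sn1 (hC _ CN)).
- move=> f g; apply: ler_mul_addgt0 => // e e0; have [N [CN h1 h2]] := adh2 f g e e0.
  apply: (le_trans (Mle _ _ CN)); apply: (le_trans (snM (hC _ CN) _ _)).
  by rewrite ler_pM ?(sn_ge0 (hC _ CN))// ltW.
- move=> f g; apply/ler_addgt0Pr => e e0; have [N [CN h1 h2]] := adh2 f g e e0.
  apply: (le_trans (Mle _ _ CN)); apply: (le_trans (snD (hC _ CN) _ _)).
  rewrite ge_max; apply/andP; split; [apply: (le_trans (ltW h1))|apply: (le_trans (ltW h2))].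
    by rewrite lerD2r le_max lexx.
  by rewrite lerD2r le_max lexx orbT.
- by move=> f; apply: (le_trans (Mle _ _ CN0)); exact: sn_le (hC _ CN0) f.
- by apply/le_anti; rewrite M0 andbT -(sn_root (hC _ CN0)) Mle.
Qed.

Lemma exists_minimal_seminorm N0 : sub_seminorm N0 -> exists N, minimal_seminorm N.
Proof.
move=> hN0; pose T := {N : B -> R | sub_seminorm N}.
pose below (s s' : T) := `[< forall f, sval s' f <= sval s f >].
have [|||C hC|[N hN] hmin] := @Zorn T below.
- by move=> s; apply/asboolP.
- by move=> s1 s2 s3 /asboolP h1 /asboolP h2; apply/asboolP => f; exact: le_trans (h1 f).
- move=> [s1 p1] [s2 p2] /asboolP h1 /asboolP h2; apply/eq_exist/funext => f.
  by apply/le_anti; rewrite h1 h2.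
- have [[[N1 p1] CN1]|none] := pselect (exists s, C s); last first.
    by exists (exist _ N0 hN0) => s Cs; case: none; exists s.
  have [|||M hM Mle] := @inf_seminorm [set sval s | s in C] N1.
  - by exists (exist _ N1 p1).
  - by move=> _ [[N pN] _ <-].
  - move=> _ _ [s1 C1 <-] [s2 C2 <-].
    by have [/asboolP h|/asboolP h] := hC _ _ C1 C2; [right|left].
  by exists (exist _ M hM) => s Cs; apply/asboolP => f; apply: Mle; exists s.
exists N; split=> // N' hN' le f.
have := hmin (exist _ N' hN') => /(_ (introT (asboolP _) le))[e].
by rewrite e.
Qed.

Section Minimal.
Variables (N : B -> R) (mN : minimal_seminorm N).
Let hN := mN.1.

Let N0 : N 0 = 0.
Proof. by apply/le_anti; rewrite (sn_ge0 hN) andbT -(bnorm0 B) (sn_le hN). Qed.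

Let N_mulrn f n : N (f *+ n) <= N f.
Proof.
elim: n => [|n ih]; first by rewrite mulr0n N0 (sn_ge0 hN).
by rewrite mulrS (le_trans (snD hN _ _))// ge_max lexx ih.
Qed.

Let N_sum (I : Type) (s : seq I) (F : I -> B) (M : R) : 0 <= M ->
  (forall i, N (F i) <= M) -> N (\sum_(i <- s) F i) <= M.
Proof.
move=> M0 h; elim/big_ind: _ => [|x y hx hy|//]; first by rewrite N0.
by rewrite (le_trans (snD hN _ _))// ge_max hx hy.
Qed.

Lemma snX f n : N (f ^+ n) <= N f ^+ n.
Proof.
elim: n => [|n ih]; first by rewrite !expr0 (sn1 hN).
by rewrite !exprS (le_trans (snM hN _ _))// ler_wpM2l// (sn_ge0 hN).
Qed.

(** Its infimum is the spectral radius of f with respect to N. *)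
Let growth f : set R := [set s | 0 <= s /\ exists K : R, forall n, N (f ^+ n) <= K * s ^+ n].

Let growthN f : growth f (N f).
Proof. by split; [exact: sn_ge0 hN _|exists 1 => n; rewrite mul1r snX]. Qed.

Let growth_inf f : has_inf (growth f).
Proof. by split; [exists (N f)|exists 0 => s []]. Qed.

Let growth_const f s : growth f s -> exists2 K : R, 0 <= K & forall n, N (f ^+ n) <= K * s ^+ n.
Proof.
move=> [s0 [K hK]]; exists K => //; have := hK 0%N.
by rewrite !expr0 mulr1 (sn1 hN); exact: le_trans.
Qed.

Let growthM f g s s' : growth f s -> growth g s' -> growth (f * g) (s * s').
Proof.
move=> hs hs'; split; first by rewrite mulr_ge0//; case: hs; case: hs'.
have [K K0 hK] := growth_const hs; have [L L0 hL] := growth_const hs'.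
exists (K * L) => n; rewrite !exprMn mulrACA (le_trans (snM hN _ _))//.
by rewrite ler_pM ?(sn_ge0 hN).
Qed.

Let growthD f g s s' : growth f s -> growth g s' -> growth (f + g) (Num.max s s').
Proof.
move=> hs hs'; have [s0 _] := hs; have [s'0 _] := hs'.
set m := Num.max s s'; have m0 : 0 <= m by rewrite le_max s0.
split=> //; have [K K0 hK] := growth_const hs; have [L L0 hL] := growth_const hs'.
exists (K * L) => n; rewrite exprDn; apply: N_sum => [|i].
  by rewrite mulr_ge0 ?exprn_ge0// mulr_ge0.
apply: (le_trans (N_mulrn _ _)); apply: (le_trans (snM hN _ _)).
have -> : m ^+ n = m ^+ (n - i) * m ^+ i by rewrite -exprD subnK ?leq_ord.
rewrite mulrACA ler_pM ?(sn_ge0 hN)//.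
  by rewrite (le_trans (hK _))// ler_wpM2l// lerXn2r ?nnegrE// le_max lexx.
by rewrite (le_trans (hL _))// ler_wpM2l// lerXn2r ?nnegrE// le_max lexx orbT.
Qed.

(** The spectral radius is again a seminorm of the same kind and lies below N, so by minimality it
    is N. *)
Lemma minimal_growth f s : growth f s -> N f <= s.
Proof.
pose N' f := inf (growth f).
have N'le g s' : growth g s' -> N' g <= s'.
  by move=> h; apply: ge_inf => //; case: (growth_inf g).
have N'ge g (x : R) : (forall s, growth g s -> x <= s) -> x <= N' g.
  by move=> h; apply: lb_le_inf => //; case: (growth_inf g).
have adh g (e : R) : 0 < e -> exists2 s, growth g s & s < N' g + e.
  by move=> e0; have [s' gs h] := inf_adherent e0 (growth_inf g); exists s'.
have N'0 g : 0 <= N' g by apply: N'ge => s' [].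
suff hN' : sub_seminorm N'.
  move=> fs; apply: le_trans (N'le _ _ fs); apply: (mN.2 _ hN') => g; exact: N'le.
split=> //.
- apply/le_anti/andP; split; first by rewrite -(sn1 hN) N'le.
  apply: N'ge => s' hs'; have [K K0 hK] := growth_const hs'.
  apply: (ltr_power_bounded (C := K)) => //; first by case: hs'.
  by move=> n; rewrite expr1n (le_trans _ (hK n))// expr1n (sn1 hN).
- move=> f' g; apply: ler_mul_addgt0 => // e e0.
  have [s1 h1 l1] := adh f' e e0; have [s2 h2 l2] := adh g e e0.
  apply: (le_trans (N'le _ _ (growthM h1 h2))).
  by have [s10 _] := h1; have [s20 _] := h2; rewrite ler_pM// ltW.
- move=> f' g; apply/ler_addgt0Pr => e e0.
  have [s1 h1 l1] := adh f' e e0; have [s2 h2 l2] := adh g e e0.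
  apply: (le_trans (N'le _ _ (growthD h1 h2))); rewrite ge_max.
  apply/andP; split; [apply: (le_trans (ltW l1))|apply: (le_trans (ltW l2))].
    by rewrite lerD2r le_max lexx.
  by rewrite lerD2r le_max lexx orbT.
- by move=> g; apply: (le_trans (N'le _ _ (growthN g))); exact: sn_le hN g.
- by apply/le_anti; rewrite N'0 andbT -(sn_root hN) N'le.
Qed.

(** If N (f ^+ 2) were smaller than N f ^+ 2, the powers of f would grow at a rate t < N f, against
    [minimal_growth]. *)
Lemma minimal_sqr f : N (f ^+ 2) = N f ^+ 2.
Proof.
apply/le_anti; rewrite snX andTb leNgt; apply/negP => lt1.
set s := N (f ^+ 2) in lt1; have s0 : 0 <= s by exact: sn_ge0 hN _.
have r0 : 0 < N f.
  rewrite lt_neqAle (sn_ge0 hN) andbT; apply/eqP => h.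
  by move: lt1; rewrite -h expr0n/= ltNge s0.
(* The term N f / 2 only keeps t positive when s = 0. *)
pose t := Num.max (Num.sqrt s) (N f / 2).
have t0 : 0 < t by rewrite lt_max divr_gt0 ?orbT.
have tN : t < N f.
  rewrite gt_max; apply/andP; split; last by lra.
  by rewrite -[ltRHS](ger0_norm (ltW r0)) -sqrtr_sqr ltr_sqrt ?exprn_gt0.
have ts : s <= t ^+ 2.
  by rewrite -{1}(sqr_sqrtr s0) lerXn2r ?nnegrE ?sqrtr_ge0 ?(ltW t0)// le_max lexx.
have : N f <= t; last by rewrite leNgt tN.
apply: minimal_growth; split; first exact: ltW.
(* This constant absorbs the extra factor f of an odd power. *)
exists (N f / t) => n.
have K1 : 1 <= N f / t by rewrite ler_pdivlMr// mul1r ltW.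
have even m : N (f ^+ (m.*2)) <= t ^+ (m.*2).
  rewrite -mul2n !exprM (le_trans (snX _ _))// lerXn2r ?nnegrE ?exprn_ge0 ?(ltW t0)//.
rewrite -(odd_double_half n); case: (odd n); rewrite ?add0n ?add1n; last first.
  by rewrite (le_trans (even _))// ler_peMl// exprn_ge0// ltW.
rewrite !exprS mulrA divfK ?gt_eqF// (le_trans (snM hN _ _))//.
by rewrite ler_wpM2l ?even// ltW.
Qed.

(** Powers of two follow by squaring; any other exponent n is completed to 2 ^ n, and
    submultiplicativity leaves no room for a loss. *)
Lemma minimal_pow f n : N (f ^+ n) = N f ^+ n.
Proof.
apply/le_anti; rewrite snX andTb.
have p2 j : N (f ^+ (2 ^ j)) = N f ^+ (2 ^ j).
  by elim: j => [|j ih]; rewrite ?expn0 ?expr1// expnSr !exprM minimal_sqr ih.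
have [r0|r0] := ltP 0 (N f); last first.
  have -> : N f = 0 by apply/le_anti; rewrite r0 (sn_ge0 hN).
  by case: n => [|n]; rewrite ?expr0 ?(sn1 hN)// expr0n (sn_ge0 hN).
have n2 : (n <= 2 ^ n)%N by rewrite ltnW// ltn_expl.
rewrite -(ler_pM2r (exprn_gt0 (2 ^ n - n) r0)) -exprD subnKC// -p2 -{1}(subnKC n2) exprD.
by rewrite (le_trans (snM hN _ _))// ler_wpM2l ?snX// (sn_ge0 hN).
Qed.

(** The quotients N (f ^+ n * g) / N f ^+ n decrease with n, and their limit is a seminorm in g of
    the same kind below N. By minimality it equals N, so N g is at most the quotient for n = 1. *)
Lemma minimalM f g : N (f * g) = N f * N g.
Proof.
apply/le_anti; rewrite (snM hN) andTb.
have [r0|r0] := ltP 0 (N f); last first.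
  have -> : N f = 0 by apply/le_anti; rewrite r0 (sn_ge0 hN).
  by rewrite mul0r (sn_ge0 hN).
pose a g n := N (f ^+ n * g) / N f ^+ n.
have rn n : 0 < N f ^+ n by rewrite exprn_gt0.
have a0 g' n : 0 <= a g' n by rewrite divr_ge0 ?(sn_ge0 hN)// ltW.
have aS g' n : a g' n.+1 <= a g' n.
  rewrite /a ler_pdivrMr// exprS -mulrA (le_trans (snM hN _ _))//.
  by rewrite exprS mulrCA divfK ?gt_eqF.
have amono g' m n : (m <= n)%N -> a g' n <= a g' m.
  move=> /subnKC <-; elim: (n - m)%N => [|d ih]; first by rewrite addn0.
  by rewrite addnS (le_trans (aS _ _)).
pose N' g := inf (range (a g)).
have hinf g' : has_inf (range (a g')).
  by split; [exists (a g' 0%N), 0%N|exists 0 => _ [n _ <-]].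
have N'le g' n : N' g' <= a g' n by apply: ge_inf; [case: (hinf g')|exists n].
have N'ge g' (x : R) : (forall n, x <= a g' n) -> x <= N' g'.
  move=> h; apply: lb_le_inf; first by have [] := hinf g'.
  by move=> _ [n _ <-].
have adh g' (e : R) : 0 < e -> exists n, a g' n < N' g' + e.
  by move=> e0; have [_ [n _ <-] h] := inf_adherent e0 (hinf g'); exists n.
have adh2 g1 g2 (e : R) : 0 < e -> exists n, a g1 n < N' g1 + e /\ a g2 n < N' g2 + e.
  move=> e0; have [n1 h1] := adh g1 e e0; have [n2 h2] := adh g2 e e0.
  exists (maxn n1 n2); split.
    by rewrite (le_lt_trans (amono _ _ _ (leq_maxl _ _))).
  by rewrite (le_lt_trans (amono _ _ _ (leq_maxr _ _))).
have aN g' : a g' 0%N = N g' by rewrite /a !expr0 mul1r divr1.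
have N'0 g' : 0 <= N' g' by exact: N'ge.
have hN' : sub_seminorm N'.
  split=> //.
  - apply/le_anti/andP; split; first by rewrite -(sn1 hN) -aN N'le.
    by apply: N'ge => n; rewrite /a mulr1 minimal_pow divff// gt_eqF.
  - move=> g1 g2; apply: ler_mul_addgt0 => // e e0.
    have [n [h1 h2]] := adh2 g1 g2 e e0.
    apply: (le_trans (N'le _ (n + n)%N)); apply: (@le_trans _ _ (a g1 n * a g2 n)).
      have -> : a g1 n * a g2 n = N (f ^+ n * g1) * N (f ^+ n * g2) / N f ^+ (n + n).
        by rewrite /a exprD invfM mulrACA.
      rewrite /a ler_wpM2r ?invr_ge0 ?(ltW (rn _))// exprD mulrACA.
      exact: snM hN _ _.
    by rewrite ler_pM// ltW.
  - move=> g1 g2; apply/ler_addgt0Pr => e e0; have [n [h1 h2]] := adh2 g1 g2 e e0.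
    apply: (le_trans (N'le _ n)); apply: (@le_trans _ _ (Num.max (a g1 n) (a g2 n))).
      rewrite {1}/a ler_pdivrMr// maxr_pMl ?(ltW (rn n))// /a !divfK ?gt_eqF// mulrDr.
      exact: snD hN _ _.
    rewrite ge_max; apply/andP; split; [apply: (le_trans (ltW h1))|apply: (le_trans (ltW h2))].
      by rewrite lerD2r le_max lexx.
    by rewrite lerD2r le_max lexx orbT.
  - by move=> g'; rewrite (le_trans (N'le _ 0%N))// aN (sn_le hN).
  - by apply/le_anti; rewrite N'0 andbT -(sn_root hN) -aN N'le.
have h : N g <= a g 1%N.
  apply: le_trans (N'le g 1%N); apply: (mN.2 _ hN') => g'; rewrite -aN; exact: N'le.
by move: h; rewrite /a !expr1 ler_pdivlMr// mulrC.
Qed.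

Lemma minimal_const a : N (bconst B a) = nabs a.
Proof.
have le1 b : N (bconst B b) <= nabs b by rewrite (le_trans (sn_le hN _))// bnorm_const.
apply/le_anti; rewrite le1 andTb.
have [->|a0] := eqVneq a 0; first by rewrite nabs0 (sn_ge0 hN).
have p0 : 0 < nabs a^-1 by rewrite lt_def nabs_ge0 nabs_eq0 invr_eq0 a0.
rewrite -(ler_pM2r p0) -nabsM divff// nabs1 -(sn1 hN) -(rmorph1 (bconst B)) -(divff a0).
rewrite rmorphM (le_trans (snM hN _ _))// ler_wpM2l ?(sn_ge0 hN)//.
Qed.

End Minimal.

Lemma exists_berk N0 : sub_seminorm N0 -> exists y : berk B, y q = 0.
Proof.
move=> /exists_minimal_seminorm[N mN]; have hN := mN.1.
have ND f g : N (f + g) <= N f + N g.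
  by rewrite (le_trans (snD hN _ _))// ge_max lerDl lerDr !(sn_ge0 hN).
exists (Berk (sn_ge0 hN) (sn1 hN) (minimalM mN) ND (minimal_const mN) (sn_le hN)).
exact: sn_root hN.
Qed.

(* Otherwise the residue seminorm modulo q sends 1 to 1. *)
Lemma berk_invertible : (forall y : berk B, y q != 0) -> exists g, q * g = 1.
Proof.
move=> hq; have rn1 : residue_norm q 1 < 1.
  rewrite ltNge; apply/negP => h.
  have [|y yq] := @exists_berk (residue_norm q); last by move: (hq y); rewrite yq eqxx.
  split.
  - exact: rn_ge0.
  - by apply/le_anti; rewrite h andbT (le_trans (rn_le_norm _ _))// bnorm1_le.
  - exact: rnM.
  - exact: rnD.
  - exact: rn_le_norm.
  - by have := rn_ideal q 1; rewrite mulr1.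
have [g hg] := rn_adh rn1; pose x := 1 - q * g.
have hx : 0 <= bnorm B x < 1 by rewrite bnorm_ge0.
have [s hs] : exists s, forall n, bnorm B (s - \sum_(i < n) x ^+ i) <= 1 * bnorm B x ^+ n.
  by apply: geometric_series => // n; rewrite mul1r bnormX.
exists (g * s); apply/eqP; rewrite -subr_eq0 -bnorm_eq0 eq_le bnorm_ge0 andbT.
apply/ler_addgt0Pr => e e0; rewrite add0r.
pose K := bnorm B (q * g) + 1.
have [n hn] := geometric_small K hx e0; apply: le_trans (ltW (hn n (leqnn n))).
have e1 : q * g * \sum_(i < n) x ^+ i = 1 - x ^+ n.
  have -> : q * g = 1 - x by rewrite /x subKr.
  elim: n {hn} => [|n ih]; first by rewrite big_ord0 mulr0 expr0 subrr.
  by rewrite big_ord_recr /= mulrDr ih exprS; ring.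
have -> : q * (g * s) - 1 = q * g * (s - \sum_(i < n) x ^+ i) - x ^+ n.
  by rewrite mulrBr e1; ring.
have xn := bnormX x n; have x0 : 0 <= bnorm B x ^+ n by rewrite exprn_ge0 ?bnorm_ge0.
rewrite (le_trans (bnormD _ _))// bnormN ge_max /K mulrDl mul1r.
have p1 : 0 <= bnorm B (q * g) * bnorm B x ^+ n by rewrite mulr_ge0 ?bnorm_ge0.
apply/andP; split; last by rewrite (le_trans xn)// lerDr.
rewrite (le_trans (bnormM _ _))//; apply: (@le_trans _ _ (bnorm B (q * g) * bnorm B x ^+ n)).
  by rewrite ler_wpM2l ?bnorm_ge0// -[leRHS]mul1r hs.
by rewrite lerDl.
Qed.

End Spectrum.

(** * Lifting points *)

Section BerkDist.
Variables (R : realType) (k : nafield R) (B : banachAlg k) (x : berk B).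

Lemma berk_dist f g : `|x f - x g| <= x (f - g).
Proof.
have h f' g' : x f' <= x g' + x (f' - g').
  by rewrite -{1}[f'](subrK g') addrC; exact: berkD.
rewrite ler_norml; apply/andP; split; last by rewrite lerBlDl.
by have := h g f; rewrite (ms_distC (berk_ms x)); lra.
Qed.

End BerkDist.

Section Lifting.
Variables (R : realType) (k : nafield R).
Variables (V : affinoid_domain (tate_alg k)) (P : tate_alg k).
Hypotheses (P1 : bnorm (tate_alg k) P = 1)
  (PV : forall z : disc k, z P = 0 -> ad_set V z).
Local Notation A := (tate_alg k).
Local Notation res := (ad_res V).

Lemma bnorm_geometric_limit (s : nat -> R) (D t : R) : 0 <= t <= 1 ->
  (forall n d, `|s (n + d)%N - s n| <= D * t ^+ n) ->
  exists y, forall n, `|y - s n| <= D * t ^+ n.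
Proof.
move=> t01 h.
have D0 : 0 <= D by have := le_trans (normr_ge0 _) (h 0%N 0%N); rewrite mulr1.
pose S := range (fun n => s n + D * t ^+ n).
have cmp m n : s m - D * t ^+ m <= s n + D * t ^+ n.
  have p i : 0 <= D * t ^+ i by rewrite mulr_ge0// exprn_ge0//; case/andP: t01.
  have [mn|/ltnW nm] := leqP m n.
    have := h m (n - m)%N; rewrite subnKC// ler_norml => /andP[h1 h2].
    have := p n; lra.
  have := h n (m - n)%N; rewrite subnKC// ler_norml => /andP[h1 h2].
  have := p m; lra.
have hS : has_inf S.
  by split; [exists (s 0%N + D * t ^+ 0), 0%N|exists (s 0%N - D * t ^+ 0) => _ [n _ <-]].
exists (inf S) => n; rewrite ler_norml; apply/andP; split.
  rewrite lerBrDr addrC; apply: lb_le_inf; first by case: hS.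
  by move=> _ [m _ <-].
by rewrite lerBlDr addrC; apply: ge_inf; [case: hS|exists n].
Qed.

Let bnormP n : bnorm A (P ^+ n) = 1.
Proof. by elim: n => [|n ih]; rewrite ?expr0 ?exprS ?gaussM ?P1 ?ih ?mulr1//; exact: (berk1 (gauss_pt k)). Qed.

Let res_bound (z : disc k) n (b : A) (g : V) : res b = res P ^+ n * g ->
  z b <= bnorm A b * z P ^+ n.
Proof.
move=> h; rewrite -berkX; apply: (domain_ideal_bound (bnormP n) _ (g := g)).
  move=> z'; rewrite berkX => /eqP; rewrite expf_eq0 => /andP[_ /eqP]; exact: PV.
by rewrite h rmorphXn.
Qed.

(** Iterated division by P. The coefficients of the expansion of f in powers of P grow at most like
    M ^+ n. *)
Let expansion : exists2 M : R, 1 <= M & forall (f : V) n, exists (b : A) (g : V),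
  [/\ f = res b + res P ^+ n * g, bnorm A b <= M ^+ n * bnorm V f &
      bnorm V g <= M ^+ n * bnorm V f].
Proof.
have [M M1 hM] := domain_division P1 PV; exists M => // f n.
have M0 : 0 <= M by exact: le_trans ler01 M1.
elim: n => [|n [b [g [fE bn gn]]]].
  by exists 0, f; rewrite !expr0 !mul1r rmorph0 add0r bnorm0 bnorm_ge0.
have [a [g' [gE an g'n]]] := hM g.
have Mg : M * bnorm V g <= M ^+ n.+1 * bnorm V f by rewrite exprS -mulrA ler_wpM2l.
exists (b + a * P ^+ n), g'; split.
- by rewrite {1}fE {1}gE rmorphD rmorphM rmorphXn exprS; ring.
- rewrite (le_trans (bnormD _ _))// ge_max; apply/andP; split.
    by rewrite (le_trans bn)// ler_wpM2r ?bnorm_ge0// exprS ler_peMl// exprn_ge0.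
  by rewrite (le_trans (bnormM _ _))// bnormP mulr1 (le_trans an).
- exact: le_trans g'n Mg.
Qed.

(** The lift of z takes at f the limit of z (b n), where f = b n + P ^+ n g n. Two such expansions
    differ by an element of A whose restriction to V is a multiple of P ^+ n; by [res_bound] its
    value at z is at most its norm times z P ^+ n, which tends to 0. *)
Lemma domain_lift : exists2 eta : R, 0 < eta & forall z : disc k, z P < eta ->
  exists y : berk V, berk_pull res y = z.
Proof.
have [M M1 hexp] := expansion.
have M0 : 0 < M by exact: lt_le_trans ltr01 M1.
have M20 : 0 < M ^+ 2 by rewrite exprn_gt0.
(* M ^+ 2 and not M, because a product of two expansions of order n is only bounded by a multiple of
   (M ^+ 2) ^+ n, and it must still compute the value at the product. *)
exists (M ^+ 2)^-1 => [|z zP]; first by rewrite invr_gt0.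
pose t := M ^+ 2 * z P.
have t0 : 0 <= t by rewrite mulr_ge0 ?berk_ge0// ltW.
have t1 : t < 1 by rewrite /t -ltr_pdivlMl// mulr1.
have t01 : 0 <= t < 1 by rewrite t0.
have tn0 n : 0 <= t ^+ n by rewrite exprn_ge0.
have tn1 n : t ^+ n <= 1 by rewrite exprn_ile1// ltW.
have /choice[c hc] : forall f : V, exists c : nat -> A, forall n, exists g : V,
    [/\ f = res (c n) + res P ^+ n * g, bnorm A (c n) <= M ^+ n * bnorm V f &
        bnorm V g <= M ^+ n * bnorm V f].
  by move=> f; have /choice[c hc] := hexp f; exists c.
have Mn n : M ^+ n <= (M ^+ 2) ^+ n.
  by rewrite lerXn2r ?nnegrE ?(ltW M0) ?(ltW M20)// expr2 ler_peMl// ltW.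
have near f n b g K : f = res b + res P ^+ n * g ->
    bnorm A b <= K * (M ^+ 2) ^+ n -> z (b - c f n) <= (K + bnorm V f) * t ^+ n.
  move=> fE bn; have [g' [fE' cn _]] := hc f n.
  have h : res (b - c f n) = res P ^+ n * (g' - g).
    rewrite rmorphB mulrBr; apply/eqP; rewrite subr_eq addrAC -subr_eq opprK -fE.
    by rewrite addrC -fE'.
  apply: (le_trans (res_bound z h)).
  rewrite /t exprMn mulrA ler_wpM2r ?exprn_ge0 ?berk_ge0// mulrDl.
  have K0 := le_trans (bnorm_ge0 _) bn.
  have f0 : 0 <= bnorm V f * (M ^+ 2) ^+ n by rewrite mulr_ge0 ?bnorm_ge0// exprn_ge0// ltW.
  apply: (le_trans (bnormD _ _)); rewrite bnormN ge_max; apply/andP; split.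
    by apply: (le_trans bn); rewrite lerDl.
  apply: (le_trans cn); apply: (@le_trans _ _ (bnorm V f * (M ^+ 2) ^+ n)).
    by rewrite mulrC ler_wpM2l ?bnorm_ge0.
  by rewrite lerDr.
pose D f := (M + 1) * bnorm V f.
have D0 f : 0 <= D f by rewrite mulr_ge0 ?bnorm_ge0// addr_ge0// ltW.
have step f n d : z (c f (n + d)%N - c f n) <= D f * t ^+ n.
  elim: d => [|d ih]; first by rewrite addn0 subrr berk0 mulr_ge0.
  have -> : c f (n + d.+1)%N - c f n =
      (c f (n + d).+1 - c f (n + d)%N) + (c f (n + d)%N - c f n).
    by rewrite addnS addrA subrK.
  apply: (le_trans (berk_ultra _ _ _)); rewrite ge_max ih andbT.
  have [g [fE cn _]] := hc f (n + d).+1.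
  have h := @near f (n + d)%N (c f (n + d).+1) (res P * g) (M * bnorm V f).
  rewrite mulrA -exprSr -fE in h.
  have {}h := h erefl; apply: (@le_trans _ _ ((M * bnorm V f + bnorm V f) * t ^+ (n + d))).
    apply: h; apply: (le_trans cn); rewrite exprS -[leLHS]mulrA -[leRHS]mulrA ler_wpM2l ?(ltW M0)//.
    by rewrite mulrC ler_wpM2l ?bnorm_ge0.
  rewrite -{2}[bnorm V f]mul1r -mulrDl -/(D f) ler_wpM2l// exprD ler_piMr//.
have /choice[y hy] : forall f, exists y, forall n, `|y - z (c f n)| <= D f * t ^+ n.
  move=> f; apply: bnorm_geometric_limit; first by rewrite t0 ltW.
  move=> n d; apply: le_trans (step f n d).
  exact: berk_dist.
(* y is computed on any sequence of expansions of f of controlled size. *)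
have yE f K K' w : (forall n, exists b g, [/\ f = res b + res P ^+ n * g,
      bnorm A b <= K * (M ^+ 2) ^+ n & `|w - z b| <= K' * t ^+ n]) -> y f = w.
  move=> hw; apply/eqP; rewrite -subr_eq0 -normr_eq0 eq_le normr_ge0 andbT.
  apply/ler_addgt0Pr => e e0; rewrite add0r.
  have [n hn] := geometric_small (D f + (K + bnorm V f) + K') t01 e0.
  apply: le_trans (ltW (hn n (leqnn n))); rewrite !mulrDl.
  have [b [g [fE bn wb]]] := hw n; have h1 := near f n b g K fE bn.
  have h2 := le_trans (berk_dist z b (c f n)) h1; have h3 := hy f n.
  have -> : y f - w = (y f - z (c f n)) - (z b - z (c f n)) - (w - z b) by ring.
  rewrite (le_trans (ler_normB _ _))// lerD// (le_trans (ler_normB _ _))// lerD//.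
  by move: h2; rewrite mulrDl.
have yle f K K' w : (forall n, exists b g, [/\ f = res b + res P ^+ n * g,
      bnorm A b <= K * (M ^+ 2) ^+ n & z b <= w + K' * t ^+ n]) -> y f <= w.
  move=> hw; apply/ler_addgt0Pr => e e0.
  have [n hn] := geometric_small (D f + (K + bnorm V f) + K') t01 e0.
  have {}hn := hn n (leqnn n); rewrite !mulrDl in hn.
  have [b [g [fE bn wb]]] := hw n; have h1 := near f n b g K fE bn.
  have h2 := le_trans (berk_dist z b (c f n)) h1; have h3 := hy f n.
  rewrite mulrDl in h2; move: h2 h3; rewrite !ler_norml => /andP[h4 h5] /andP[h6 h7].
  lra.
have sy f n : z (c f n) <= y f + D f * t ^+ n.
  by have := hy f n; rewrite ler_norml => /andP[h _]; lra.
have y0 f : 0 <= y f.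
  apply/ler_addgt0Pr => e e0; have [n hn] := geometric_small (D f) t01 e0.
  have := hn n (leqnn n); have := sy f n; have := berk_ge0 z (c f n); lra.
have yres a : y (res a) = z a.
  apply: (yE _ (bnorm A a) 0) => n; exists a, 0; rewrite mulr0 addr0 subrr normr0 mul0r.
  split=> //; rewrite ler_peMr ?bnorm_ge0// exprn_ege1// exprn_ege1//.
have cK f n : bnorm A (c f n) <= bnorm V f * (M ^+ 2) ^+ n.
  have [g [_ cn _]] := hc f n; rewrite (le_trans cn)// mulrC ler_wpM2l ?bnorm_ge0//.
have cK1 f n : bnorm A (c f n) <= M ^+ n * bnorm V f by have [g []] := hc f n.
have yM f f' : y (f * f') = y f * y f'.
  apply: (yE _ (bnorm V f * bnorm V f') (D f * (y f' + D f') + y f * D f')) => n.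
  have [g [fE _ _]] := hc f n; have [g' [f'E _ _]] := hc f' n.
  exists (c f n * c f' n), (res (c f n) * g' + g * f'); split.
  - rewrite rmorphM; move: fE f'E; set a := res (c f n); set a' := res (c f' n); set Q := _ ^+ n.
    by move=> fE f'E; rewrite [in LHS]fE [in LHS]f'E [in RHS]f'E; ring.
  - rewrite (le_trans (bnormM _ _))// -exprM mulnC exprM expr2 mulrACA.
    by rewrite ler_pM ?bnorm_ge0// mulrC.
  - rewrite berkM; have h1 := hy f n; have h2 := hy f' n.
    have s'b : `|z (c f' n)| <= y f' + D f'.
      rewrite ger0_norm ?berk_ge0// (le_trans (sy f' n))// lerD2l.
      by rewrite ler_piMr.
    have -> : y f * y f' - z (c f n) * z (c f' n) =
        (y f - z (c f n)) * z (c f' n) + y f * (y f' - z (c f' n)) by ring.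
    rewrite (le_trans (ler_normD _ _))// [leRHS]mulrDl lerD//.
      by rewrite normrM mulrAC ler_pM.
    by rewrite normrM (ger0_norm (y0 f)) -mulrA ler_wpM2l.
have yD f f' : y (f + f') <= y f + y f'.
  apply: (yle _ (bnorm V f + bnorm V f') (D f + D f')) => n.
  have [g [fE _ _]] := hc f n; have [g' [f'E _ _]] := hc f' n.
  exists (c f n + c f' n), (g + g'); split.
  - by rewrite {1}fE {1}f'E rmorphD; ring.
  - have p f1 : 0 <= bnorm V f1 * (M ^+ 2) ^+ n.
      by rewrite mulr_ge0 ?bnorm_ge0// exprn_ge0// ltW.
    rewrite mulrDl (le_trans (bnormD _ _))// ge_max.
    by rewrite (le_trans (cK f n)) ?lerDl// (le_trans (cK f' n)) ?lerDr.
  - by rewrite (le_trans (berkD _ _ _))// mulrDl addrACA lerD.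
have y1 : y 1 = 1 by rewrite -(rmorph1 res) yres berk1.
have yC a : y (bconst V a) = nabs a by rewrite -(bhom_const res) yres berk_const.
have yle1 f : y f <= (M + 2) * bnorm V f.
  have h1 := hy f 0%N; have h2 := cK1 f 0%N; have h3 := berk_le z (c f 0%N).
  move: h1 h2; rewrite !expr0 mulr1 mul1r ler_norml => /andP[_ h1] h2.
  have -> : (M + 2) * bnorm V f = D f + bnorm V f by rewrite /D; ring.
  by move: h1 h2 h3; lra.
have yX f n : y (f ^+ n) = y f ^+ n.
  by elim: n => [|n ih]; rewrite ?expr0// !exprS yM ih.
(* The constant M + 2 is removed by applying the bound to the powers of f. *)
have yb f : y f <= bnorm V f.
  apply: (ltr_power_bounded (C := M + 2)); rewrite ?y0 ?bnorm_ge0//.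
    by rewrite addr_ge0// ltW.
  move=> n; rewrite -yX (le_trans (yle1 _))// ler_wpM2l ?bnormX//.
  by rewrite addr_ge0// ltW.
exists (Berk y0 y1 yM yD yC yb); apply: berkP => a; exact: yres.
Qed.

End Lifting.

(** * Multiplier ideals *)

Section Weights.
Variables (R : realType) (k : nafield R) (K : completed_closure k).
Variables (c : R) (phi : disc k -> \bar R).
Hypotheses (c0 : 0 < c) (sub : subharmonic K c phi).
Hypothesis phi_le0 : forall z, (phi z <= 0)%E.
Implicit Types (z : disc k) (e : R).
Local Notation r := (Defs.radius K).
Local Notation lrad := (lrad K).

Definition eweight e z : \bar R := expeR (- ((1 + e)%:E * phi z) - logradius K z).
Definition weight e z : R := expR (- ((1 + e) * fphi phi z) - lrad z).

Lemma eweightE e z : 0 < r z -> eweight e z = (weight e z)%:E.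
Proof. by move=> z0; rewrite /eweight (phiE sub z0) (logradiusE z0). Qed.

(** At radius 0, - log r = +oo makes the weight vanish unless phi is -oo, so only points of positive
    radius count in the suprema. *)
Lemma eweight0 e z : r z = 0 -> phi z <> -oo%E -> eweight e z = 0%E.
Proof.
move=> z0 zp; have [h _ _] := sub; rewrite /eweight /logradius z0 /= lexx.
have := h z; move: zp; case: (phi z) => [t _ _||] //.
Qed.

Lemma fphi_le0 z : fphi phi z <= 0.
Proof. by rewrite /fphi fine_le0. Qed.

Lemma weight_mono e e' z : e <= e' -> weight e z <= weight e' z.
Proof.
move=> ee; rewrite ler_expR lerD2r lerN2.
by rewrite ler_wnM2r ?lerD2l ?fphi_le0.
Qed.

Lemma weight_ge0 e z : 0 <= weight e z.
Proof. exact: expR_ge0. Qed.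

Lemma poles_scale e : 0 < e -> poles (fun z => (1 + e)%:E * phi z)%E = poles phi.
Proof.
move=> e0; have e1 : 0 < 1 + e by lra.
apply/seteqP; split=> z; rewrite /poles /=; case: (phi z) => [t||] //.
  by rewrite gt0_muley ?lte_fin.
by rewrite gt0_muleNy ?lte_fin.
Qed.

Lemma ler_bound_EFin (T : Type) (S : set T) (F : T -> \bar R) (G : T -> R) (Q : T -> Prop) :
  (forall y, S y -> Q y -> F y = (G y)%:E) -> (forall y, S y -> ~ Q y -> F y = 0%E) ->
  (forall y, Q y -> S y) ->
  (ereal_sup [set F y | y in S] < +oo)%E <-> exists C : R, forall y, Q y -> G y <= C.
Proof.
move=> FQ FnQ QS; split=> [h|[C hC]]; last first.
  apply: (@le_lt_trans _ _ (Num.max C 0)%:E); last exact: ltry.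
  apply: ge_ereal_sup => _ [y Sy <-]; have [Qy|nQ] := pselect (Q y).
    by rewrite FQ// lee_fin le_max hC.
  by rewrite FnQ// lee_fin le_max lexx orbT.
exists (fine (ereal_sup [set F y | y in S])) => y Qy.
have hy : ((G y)%:E <= ereal_sup [set F y | y in S])%E.
  by rewrite -FQ//; [apply: ereal_sup_ubound; exists y => //|]; exact: QS.
rewrite -lee_fin fineK// fin_numE; apply/andP; split; last by rewrite lt_eqF.
by apply/eqP => e; move: hy; rewrite e leNgt ltNyr.
Qed.

Lemma norm_phiP e (f : tate_alg k) : 0 < e ->
  (norm_phi K (fun z => (1 + e)%:E * phi z)%E f < +oo)%E <->
  exists C : R, forall z, 0 < r z -> z f * weight e z <= C.
Proof.
move=> e0; rewrite /norm_phi poles_scale//; apply: ler_bound_EFin.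
- by move=> z _ z0; have := eweightE e z0; rewrite /eweight => ->.
- move=> z zp z0; have rz : r z = 0.
    by apply/le_anti; rewrite leNgt (introN idP z0) andTb; case/andP: (radius_itv K z).
  by have := eweight0 e rz zp; rewrite /eweight => ->; rewrite mule0.
- by move=> z z0; rewrite /poles /= (phiE sub z0).
Qed.

(** As phi <= 0, the norm increases with epsilon; the limit at 0 from the right is therefore an
    infimum, which is finite as soon as one of the norms is. *)
Lemma HphiP (f : tate_alg k) : Hphi K phi f <->
  exists2 e, 0 < e & exists C : R, forall z, 0 < r z -> z f * weight e z <= C.
Proof.
pose F e := norm_phi K (fun z => (1 + e)%:E * phi z)%E f.
have ndF : {in Interval (BRight 0) (BInfty R false) &, nondecreasing_fun F}.
  move=> e e'; rewrite !in_itv /= !andbT => e0 e'0 ee.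
  rewrite /F /norm_phi !poles_scale//; apply: ge_ereal_sup => _ [z zp <-].
  apply: (@le_trans _ _ ((z f)%:E *
    expeR (- ((1 + e')%:E * phi z) - logradius K z))%E); last first.
    by apply: ereal_sup_ubound; exists z.
  rewrite lee_wpmul2l ?lee_fin ?berk_ge0// lee_expeR leeD2r// leeN2.
  rewrite -[phi z]oppeK; have p0 : (0 <= - phi z)%E by rewrite oppe_ge0.
  by move: (- phi z)%E p0 => p p0; rewrite !muleN leeN2 lee_wpmul2r// lee_fin lerD2l.
have lt : (BRight (0 : R) < BInfty R false)%O by [].
have /cvg_lim limF := nondecreasing_at_right_cvge _ lt ndF.
rewrite /Hphi /= /norm_phi_plus -/F limF//; split.
  move=> /ereal_inf_lt[_ [e he <-] h].
  have e0 : 0 < e by move: he; rewrite /= in_itv /= andbT.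
  by exists e => //; exact/(norm_phiP _ e0).
move=> [e e0 /(norm_phiP _ e0) h]; apply: le_lt_trans h.
by apply: ereal_inf_lbound; exists e => //=; rewrite in_itv /= e0.
Qed.

Lemma local_multiplier_idealP (x : disc k) (O : stalk x) (g : O) :
  local_multiplier_ideal K phi O g <->
  exists e (V : affinoid_nbhd x) (f : V), [/\ 0 < e, germ O V f = g &
    exists C : R, forall y : berk V, 0 < r (berk_pull (ad_res V) y) ->
      y f * weight e (berk_pull (ad_res V) y) <= C].
Proof.
have key e (V : affinoid_nbhd x) (f : V) :
    (ereal_sup [set (y f)%:E * eweight e (berk_pull (ad_res V) y)
      | y in [set y : berk V | ~ poles phi (berk_pull (ad_res V) y)]] < +oo)%E <->
    exists C : R, forall y : berk V, 0 < r (berk_pull (ad_res V) y) ->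
      y f * weight e (berk_pull (ad_res V) y) <= C.
  apply: ler_bound_EFin.
  - by move=> y _ y0; rewrite (eweightE e y0).
  - move=> y yp y0; rewrite eweight0 ?mule0//; apply/le_anti.
    by rewrite leNgt (introN idP y0) andTb; case/andP: (radius_itv K (berk_pull (ad_res V) y)).
  - by move=> y y0; rewrite /poles /= (phiE sub y0).
by split=> -[e [V [f [e0 <- h]]]]; exists e, V, f; split=> //; apply/key.
Qed.

End Weights.

Section Germs.
Variables (R : realType) (k : nafield R) (x : disc k) (O : stalk x).
Local Notation A := (tate_alg k).

Lemma germ_map (V W : affinoid_nbhd x) (u : bhom V W) (f : V) :
  (forall b, u (ad_res V b) = ad_res W b) -> germ O V f = germ O W (u f).
Proof. by move=> ures; apply/germ_eq; exists W, u, (bhom_id W); split. Qed.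

Lemma germ_whole (V : affinoid_nbhd x) (a : A) :
  germ O (whole_disc x) a = germ O V (ad_res V a).
Proof. exact: (@germ_map (whole_disc x) V (ad_res V)). Qed.

(** A common refinement is extracted from [germ_eq], applied to the unit sections of V and V'. *)
Lemma germ_refine (V V' : affinoid_nbhd x) : exists (W : affinoid_nbhd x)
  (u : bhom V W) (u' : bhom V' W), (forall b, u (ad_res V b) = ad_res W b) /\
    forall b, u' (ad_res V' b) = ad_res W b.
Proof.
have /germ_eq[W [u [u' [h h' _]]]] : germ O V 1 = germ O V' 1 by rewrite !rmorph1.
by exists W, u, u'.
Qed.

End Germs.

(** * The two inclusions *)

Section ExtendedIdealIncluded.
Variables (R : realType) (k : nafield R) (K : completed_closure k).
Variables (c : R) (phi : disc k -> \bar R).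
Hypotheses (c0 : 0 < c) (sub : subharmonic K c phi).
Hypothesis phi_le0 : forall z, (phi z <= 0)%E.
Variables (x : disc k) (O : stalk x).
Local Notation r := (Defs.radius K).
Local Notation J := (local_multiplier_ideal K phi O).

Lemma local_multiplier_ideal_add g g' : J g -> J g' -> J (g + g').
Proof.
move=> /(local_multiplier_idealP sub _)[e [V [f [e0 <- [C hC]]]]].
move=> /(local_multiplier_idealP sub _)[e' [V' [f' [e'0 <- [C' hC']]]]].
have [W [u [u' [hu hu']]]] := germ_refine O V V'.
apply/(local_multiplier_idealP sub _).
exists (Num.min e e'), W, (u f + u' f'); split.
- by rewrite lt_min e0.
- by rewrite rmorphD -!germ_map.
exists (C + C') => y y0; have w0 := weight_ge0.
have yu : berk_pull (ad_res V) (berk_pull u y) = berk_pull (ad_res W) y.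
  by apply: berkP => b /=; rewrite hu.
have yu' : berk_pull (ad_res V') (berk_pull u' y) = berk_pull (ad_res W) y.
  by apply: berkP => b /=; rewrite hu'.
set z := berk_pull (ad_res W) y in y0 yu yu' *.
have h := hC (berk_pull u y); have h' := hC' (berk_pull u' y).
rewrite yu yu' in h h'; have {}h := h y0; have {}h' := h' y0.
have m : weight K phi (Num.min e e') z <= weight K phi e z.
  by apply: weight_mono => //; rewrite ge_min lexx.
have m' : weight K phi (Num.min e e') z <= weight K phi e' z.
  by apply: weight_mono => //; rewrite ge_min lexx orbT.
apply: (@le_trans _ _ ((y (u f) + y (u' f')) * weight K phi (Num.min e e') z)).
  by rewrite ler_wpM2r ?w0// berkD.
rewrite mulrDl lerD//; [apply: le_trans h|apply: le_trans h'].
  by rewrite ler_wpM2l ?berk_ge0.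
by rewrite ler_wpM2l ?berk_ge0.
Qed.

Lemma local_multiplier_ideal_Hphi (b : tate_alg k) (g : O) : Hphi K phi b ->
  J (germ O (whole_disc x) b * g).
Proof.
move=> /(HphiP sub phi_le0)[e e0 [C hC]]; have [V [f <-]] := germ_surj g.
apply/(local_multiplier_idealP sub _).
exists e, V, (ad_res V b * f); split=> //; first by rewrite rmorphM -germ_whole.
exists (C * bnorm V f) => y y0; rewrite berkM mulrAC.
have h := hC _ y0; rewrite ler_pM ?berk_ge0 ?berk_le//.
by rewrite mulr_ge0 ?berk_ge0 ?weight_ge0.
Qed.

Lemma extended_ideal_included : extended_ideal O (Hphi K phi) `<=` J.
Proof.
move=> g [n [h [a [hH ->]]]]; elim/big_ind: _ => [|g1 g2|i _].
- rewrite -(mulr0 (germ O (whole_disc x) 0)); apply: local_multiplier_ideal_Hphi.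
  by apply/(HphiP sub phi_le0); exists 1 => //; exists 0 => z _; rewrite berk0 mul0r.
- exact: local_multiplier_ideal_add.
- exact: local_multiplier_ideal_Hphi.
Qed.

End ExtendedIdealIncluded.

Section Generators.
Variables (R : realType) (k : nafield R) (K : completed_closure k).
Local Notation A := (tate_alg k).
Local Notation r := (Defs.radius K).

Lemma rigid_generator (e : disc k) : rigid K e -> exists P : A,
  [/\ bnorm A P = 1, e P = 0, forall z : disc k, z P = 0 -> z = e &
      forall u, disc_le e u -> 0 < r u -> u P <= r u].
Proof.
move=> /rigid_killed[_ [p pk]]; have [p0 ep _] := pk.
have tp0 : tpoly p != 0.
  apply: contra_neq p0 => h; apply/polyP => i; rewrite coef0.
  have -> : p`_i = tcoef (tpoly p) i by [].
  by rewrite h tcoef0.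
have [i [ai _]] := gauss_max tp0; set a := tcoef _ i in ai.
have a0 : a != 0 by rewrite -nabs_eq0 ai bnorm_eq0.
have ai1 : nabs a^-1 * bnorm A (tpoly p) = 1 by rewrite -ai -nabsM mulVf ?nabs1.
have PE : tpoly (a^-1%:P * p) = bconst A a^-1 * tpoly p by rewrite tpolyM tpolyC.
have P1 : bnorm A (tpoly (a^-1%:P * p)) = 1.
  by rewrite PE gaussM -ai1; congr (_ * _); exact: (berk_const (gauss_pt k)).
have zP (z : disc k) : z (tpoly (a^-1%:P * p)) = nabs a^-1 * z (tpoly p).
  by rewrite PE berkM berk_const.
exists (tpoly (a^-1%:P * p)); split=> //.
- by rewrite zP ep mulr0.
- move=> z; rewrite zP => /eqP; rewrite mulf_eq0 nabs_eq0 invr_eq0 (negPf a0) => /eqP.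
  exact: killer_unique.
- move=> u eu u0; apply: above_killed_value u0 => //; last by rewrite P1.
  by rewrite zP ep mulr0.
Qed.

Lemma prod_norm1 (T : eqType) (s : seq T) (F : T -> A) N :
  (forall e, e \in s -> bnorm A (F e) = 1) -> bnorm A (\prod_(e <- s) F e ^+ N) = 1.
Proof.
move=> h; have hX f n : bnorm A f = 1 -> bnorm A (f ^+ n) = 1.
  by move=> f1; apply: etrans (berkX (gauss_pt k) f n) _; rewrite [gauss_pt k f]f1 expr1n.
elim: s h => [|e s ih] h; first by rewrite big_nil; exact: (berk1 (gauss_pt k)).
rewrite big_cons gaussM hX ?mul1r; first by apply: ih => e' e's; apply: h; rewrite inE e's orbT.
by apply: h; rewrite inE eqxx.
Qed.

Lemma prod_eq0 (T : eqType) (s : seq T) (F : T -> A) N (z : disc k) :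
  z (\prod_(e <- s) F e ^+ N) = 0 -> exists2 e, e \in s & z (F e) = 0.
Proof.
elim: s => [|e s ih]; first by rewrite big_nil berk1 => /eqP; rewrite oner_eq0.
rewrite big_cons berkM berkX => /eqP; rewrite mulf_eq0 expf_eq0 => /orP[/andP[_ /eqP h]|/eqP/ih[e' es h]].
  by exists e => //; rewrite inE eqxx.
by exists e' => //; rewrite inE es orbT.
Qed.

Lemma prod_le_factor (T : eqType) (s : seq T) (F : T -> A) N (z : disc k) e :
  (forall e, e \in s -> bnorm A (F e) = 1) -> e \in s ->
  z (\prod_(e <- s) F e ^+ N) <= z (F e) ^+ N.
Proof.
move=> h es; rewrite (big_rem e es) /= berkM berkX ler_piMr ?exprn_ge0 ?berk_ge0//.
rewrite (le_trans (berk_le _ _))// prod_norm1// => e' e's; apply: h; exact: mem_rem e's.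
Qed.

End Generators.

Section LocalIdealIncluded.
Variables (R : realType) (k : nafield R) (K : completed_closure k).
Variables (c : R) (phi : disc k -> \bar R).
Hypotheses (c0 : 0 < c) (sub : subharmonic K c phi).
Hypothesis phi_le0 : forall z, (phi z <= 0)%E.
Local Notation A := (tate_alg k).
Local Notation r := (Defs.radius K).
Local Notation al := (al K).
Local Notation lrad := (lrad K).
Local Notation fphi := (fphi phi).

Lemma weight_bound (e : R) : 0 < e <= 1 -> exists (E : seq (disc k)) (F : disc k -> A) (N : nat) (M : R),
  [/\ forall x, x \in E -> [/\ bnorm A (F x) = 1, x (F x) = 0 & forall z : disc k, z (F x) = 0 -> z = x],
      0 <= M &
      forall z, 0 < r z -> weight K phi e z <= M \/
        exists2 x, x \in E & z (F x) ^+ N * weight K phi e z <= M].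
Proof.
move=> /andP[e0 e1].
have [L [E [Er hE]]] := steep_bound c0 sub.
have [C hC] := phi_lower_bound c0 sub.
have /choice[F hF] : forall x : disc k, exists P : A, rigid K x ->
    [/\ bnorm A P = 1, x P = 0, forall z : disc k, z P = 0 -> z = x &
      forall u, disc_le x u -> 0 < r u -> u P <= r u].
  move=> x; have [xr|] := pselect (rigid K x); last by exists 0.
  by have [P hP] := rigid_generator xr; exists P.
pose N := (Num.bound (2 * c)).+1.
have cN : 2 * c <= N%:R.
  by rewrite ltW// (lt_le_trans (archi_boundP _)) ?ler_nat// mulr_ge0// ltW.
(* The bound 2 C + 2 c alpha(u) on the exponent, with alpha(u) <= L when u is not above a point of
   E. *)
pose M := expR (2 * `|C| + 2 * c * `|L|).
exists E, F, N, M; split; [by move=> x xE; have [] := hF x (Er x xE)|exact: expR_ge0|].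
have cl : 0 <= c * `|L| by rewrite mulr_ge0// ltW.
have CC := ler_norm C; have LL := ler_norm L.
move=> z z0; have az := al_ge0 z0; have al_l := al_le_lrad z0.
have f0 : fphi z <= 0 := fphi_le0 phi_le0 z.
(* Here e <= 1 and phi <= 0 turn 1 + e into 2, and alpha <= - log r replaces the log discrepancy. *)
have w2 : - ((1 + e) * fphi z) - lrad z <= 2 * - fphi z - al z by nra.
have [h|[u [su zu h]]] := hC z z0.
  left; rewrite ler_expR; apply: (le_trans w2); lra.
have u0 := su.1; have au := al_ge0 u0.
have w3 : - ((1 + e) * fphi z) - lrad z <= 2 * `|C| + 2 * (c * al u).
  by apply: (le_trans w2); lra.
have [uL|[x xE xu]] := hE u su.
  left; rewrite ler_expR; apply: (le_trans w3).
  have : c * al u <= c * `|L| by rewrite ler_wpM2l ?(ltW c0)// (le_trans uL).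
  lra.
right; exists x => //; have [_ _ _ hx] := hF x (Er x xE).
have zF : z (F x) <= expR (- al u).
  apply: (le_trans (zu _)); apply: (le_trans (hx u xu u0)).
  by rewrite -(expN_lrad u0) ler_expR lerN2 al_le_lrad.
have zFN : z (F x) ^+ N <= expR (- (N%:R * al u)).
  rewrite (_ : - _ = N%:R * (- al u)); last by ring.
  by rewrite expRM_natl lerXn2r ?nnegrE ?berk_ge0 ?expR_ge0.
apply: (@le_trans _ _ (expR (- (N%:R * al u)) * expR (2 * `|C| + 2 * (c * al u)))).
  by rewrite ler_pM ?exprn_ge0 ?berk_ge0 ?expR_ge0 ?ler_expR.
rewrite -expRD ler_expR.
have : 2 * c * al u <= N%:R * al u by rewrite ler_wpM2r.
move: cl; lra.
Qed.

Lemma mem_In (T : eqType) (s : seq T) x : x \in s -> List.In x s.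
Proof.
by elim: s => [//|y s ih]; rewrite inE => /predU1P[->|/ih]; [left|right].
Qed.

Variables (x : disc k) (O : stalk x).
Local Notation J := (local_multiplier_ideal K phi O).

Lemma local_ideal_included : J `<=` extended_ideal O (Hphi K phi).
Proof.
move=> g0 /(local_multiplier_idealP sub _)[e0 [V [f [e00 <- [C0 hC0]]]]].
(* [weight_bound] asks for e <= 1; a smaller e gives a smaller weight, so the bound on f
   persists. *)
pose e := Num.min e0 1.
have e01 : 0 < e <= 1 by rewrite lt_min e00 ltr01 ge_min lexx orbT.
have {}hC (y : berk V) : 0 < r (berk_pull (ad_res V) y) ->
    y f * weight K phi e (berk_pull (ad_res V) y) <= C0.
  move=> y0; apply: le_trans (hC0 y y0); rewrite ler_wpM2l ?berk_ge0//.
  by apply: weight_mono => //; rewrite ge_min lexx.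
have [E [F [N [M [hF M0 hM]]]]] := weight_bound e01.
pose Ei := [seq u <- E | `[< ad_set V u >]]; pose Eo := [seq u <- E | ~~ `[< ad_set V u >]].
have EiE u : u \in Ei -> u \in E by rewrite mem_filter => /andP[].
have EoE u : u \in Eo -> u \in E by rewrite mem_filter => /andP[].
have EiF u : u \in Ei -> bnorm A (F u) = 1 by move=> /EiE/hF[].
have EoF u : u \in Eo -> bnorm A (F u) = 1 by move=> /EoE/hF[].
pose P := \prod_(u <- Ei) F u ^+ N; pose q := \prod_(u <- Eo) F u ^+ N.
have P1 : bnorm A P = 1 by exact: prod_norm1.
have q1 : bnorm A q = 1 by exact: prod_norm1.
have PV (z : disc k) : z P = 0 -> ad_set V z.
  move=> /prod_eq0[u ui zu]; have [_ _ h] := hF u (EiE u ui); rewrite (h z zu).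
  by move: ui; rewrite mem_filter => /andP[/asboolP].
(* A zero of q in the spectrum of V would map to a point of Eo, while its image lies in V. *)
have [qi hqi] : exists qi, ad_res V q * qi = 1.
  apply: berk_invertible => y; apply/eqP => /(@prod_eq0 _ _ _ _ _ _ (berk_pull (ad_res V) y))[u uo yu].
  have [_ _ h] := hF u (EoE u uo); move: uo; rewrite mem_filter => /andP[/asboolP].
  by case; rewrite -(h _ yu); exact: ad_image.
have [_ _ /(_ f)[a [g [fE _ _]]]] := domain_division P1 PV.
(* B dominates the inverses of the thresholds of [domain_lift] at the points of Ei; with inverses,
   enlarging B strengthens the condition on z, as [uniform_bound] requires. *)
have [B B0 hB] : exists2 B : R, 0 <= B & forall u, List.In u E -> u \in Ei ->
    forall z : disc k, z (F u) * B < 1 -> exists y : berk V, berk_pull (ad_res V) y = z.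
  apply: uniform_bound => u _; have [ui|] := boolP (u \in Ei); last by exists 0.
  have [|eta eta0 lift] := @domain_lift _ _ V (F u) (EiF u ui).
    move=> z zu; have [_ _ h] := hF u (EiE u ui); rewrite (h z zu).
    by move: ui; rewrite mem_filter => /andP[/asboolP].
  exists eta^-1 => B etaB _ z zB; apply: lift.
  have := le_lt_trans (ler_wpM2l (berk_ge0 z (F u)) etaB) zB.
  by rewrite ltr_pdivrMr// mul1r.
have w0 (z : disc k) : 0 <= weight K phi e z by exact: weight_ge0.
have zP (z : disc k) : z P <= 1 by rewrite -P1 berk_le.
have zq (z : disc k) : z q <= 1 by rewrite -q1 berk_le.
have HPq : Hphi K phi (P * q).
  apply/(HphiP sub phi_le0); exists e; first by case/andP: e01.
  exists M => z z0; rewrite berkM.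
  have [h|[u uE h]] := hM z z0; apply: le_trans h.
    by rewrite ler_piMl// mulr_ile1 ?berk_ge0.
  rewrite ler_wpM2r//; have [ui|uo] := boolP `[< ad_set V u >].
    rewrite -[leRHS]mulr1 ler_pM ?berk_ge0//; apply: prod_le_factor => //.
    by rewrite mem_filter ui.
  rewrite -[leRHS]mul1r ler_pM ?berk_ge0//; apply: prod_le_factor => //.
  by rewrite mem_filter uo.
have Haq : Hphi K phi (a * q).
  apply/(HphiP sub phi_le0); exists e; first by case/andP: e01.
  have an0 := bnorm_ge0 a; have gn0 := bnorm_ge0 g.
  have BM : 0 <= bnorm A a * (B ^+ N * M) by rewrite !mulr_ge0 ?exprn_ge0.
  have aM : 0 <= bnorm A a * M by rewrite mulr_ge0.
  have gM : 0 <= M * bnorm V g by rewrite mulr_ge0.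
  (* The three summands serve in turn: when the weight is bounded or u lies outside V; when u is in
     V and z is far from u; when u is in V and z is near u. *)
  exists (bnorm A a * M + bnorm A a * (B ^+ N * M) + (`|C0| + M * bnorm V g)) => z z0.
  rewrite berkM; have za := berk_le z a; have C0n := normr_ge0 C0.
  have [h|[u uE h]] := hM z z0.
    have : z a * z q * weight K phi e z <= bnorm A a * M.
      by rewrite -mulrA ler_pM ?mulr_ge0 ?berk_ge0// (le_trans _ h)// ler_piMl.
    lra.
  have [ui|uo] := boolP `[< ad_set V u >]; last first.
    have : z a * z q * weight K phi e z <= bnorm A a * M.
      rewrite -mulrA ler_pM ?mulr_ge0 ?berk_ge0// (le_trans _ h)// ler_wpM2r//.
      by apply: prod_le_factor => //; rewrite mem_filter uo.
    lra.
  have uEi : u \in Ei by rewrite mem_filter ui.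
  have aq : z a * z q * weight K phi e z <= z a * weight K phi e z.
    by rewrite ler_wpM2r// ler_piMr ?berk_ge0.
  (* Near u the point z lifts to some y of V, where a = f - P g can be estimated by f and P. Far
     from u the factor (z (F u) * B) ^+ N is at least 1 and may be inserted, so the bound on the
     weight multiplied by F u ^+ N suffices. *)
  apply: (le_trans aq); have [lt1|ge1] := ltP (z (F u) * B) 1.
    have [y yz] := hB u (mem_In uE) uEi z lt1.
    have hy := hC y; rewrite yz in hy; have {}hy := hy z0.
    have ya : z a = y (ad_res V a) by rewrite -yz.
    have yP : y (ad_res V P) = z P by rewrite -yz.
    have zPw : z P * weight K phi e z <= M.
      apply: (le_trans _ h); rewrite ler_wpM2r//; exact: prod_le_factor.
    have h1 : z a <= y f + z P * bnorm V g.
      rewrite ya (_ : ad_res V a = f - ad_res V P * g); last by rewrite fE addrK.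
      rewrite (le_trans (berkD _ _ _))// (msN (berk_ms y)) lerD2l berkM yP.
      by rewrite ler_wpM2l ?berk_ge0 ?berk_le.
    have : z a * weight K phi e z <= `|C0| + M * bnorm V g.
      apply: (le_trans (ler_wpM2r (w0 z) h1)); rewrite mulrDl lerD//.
        exact: le_trans hy (ler_norm C0).
      by rewrite mulrAC ler_wpM2r.
    lra.
  have : z a * weight K phi e z <= bnorm A a * (B ^+ N * M).
    rewrite ler_pM ?berk_ge0//; apply: (@le_trans _ _ ((z (F u) * B) ^+ N * weight K phi e z)).
      by rewrite ler_peMl// exprn_ege1.
    by rewrite exprMn [_ * B ^+ N]mulrC -mulrA ler_wpM2l ?exprn_ge0.
  lra.
pose hs (i : 'I_2) := if i == ord0 then a * q else P * q.
pose cs (i : 'I_2) := if i == ord0 then germ O V qi else germ O V (qi * g).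
exists 2%N, hs, cs; split; first by move=> i; rewrite /hs; case: ifP.
rewrite !big_ord_recl big_ord0 addr0 /hs /cs /=.
rewrite !(germ_whole O V) -!rmorphM -rmorphD; congr (germ O V _).
have e1 (b d qq w : V) : qq * w = 1 -> b * qq * w + d * qq * (w * g) = b + d * g.
  move=> qw; have -> : b * qq * w + d * qq * (w * g) = (b + d * g) * (qq * w) by ring.
  by rewrite qw mulr1.
by rewrite !rmorphM e1.
Qed.

End LocalIdealIncluded.

Theorem lemma4p13 (R : realType) (k : nafield R) (K : completed_closure k)
    (phi : disc k -> \bar R) (phi_qsh : quasisubharmonic K phi)
    (phi_le0 : forall y, (phi y <= 0)%E)
    (x : disc k) (x_rigid : rigid K x) (O : stalk x) :
  local_multiplier_ideal K phi O = extended_ideal O (Hphi K phi).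
Proof.
have [c c0 sub] := phi_qsh; apply/seteqP; split.
  exact: (local_ideal_included c0 sub phi_le0).
exact: (extended_ideal_included sub phi_le0).
Qed.
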